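(* Let $0<|q|<1$ and $a,b,c,d,e,f\in\mathbb C^\ast$ such that $|q^2a^2|<|bcdef|$ and no denominator factors vanish. Then $${}_8W_7\left(a;b,c,d,e,f;q,\tfrac{q^2a^2}{bcdef}\right)=\frac{(qa,\frac qa,\frac qe,\frac qf,\frac{qa}{bc},\frac{qa}{bd},\frac{qa}{cd},\frac{qa}{ef};q)_\infty}{(q,\frac qb,\frac qc,\frac qd,\frac{qa}{e},\frac{qa}{f},\frac{qa^2}{bcd},\frac{q}{ef};q)_\infty}\;{}_4\psi_4\left(\begin{matrix}a,e,f,\frac{qa^2}{bcd}\\ \frac{qa}{b},\frac{qa}{c},\frac{qa}{d},ef\end{matrix};q,q\right)$$ $$+\frac{(qa,\frac ba,\frac ca,\frac da,\frac{qa}{ef},\frac{q^2a}{bcd},\frac{q^2a^2}{bcde},\frac{q^2a^2}{bcdf};q)_\infty}{(\frac qb,\frac qc,\frac qd,\frac{qa}{e},\frac{qa}{f},\frac{bcd}{qa^2},\frac{q^2a^2}{bcd},\frac{q^2a^2}{bcdef};q)_\infty}\;{}_4\phi_3\left(\begin{matrix}\frac{qa}{bc},\frac{qa}{bd},\frac{qa}{cd},\frac{q^2a^2}{bcdef}\\ \frac{q^2a}{bcd},\frac{q^2a^2}{bcde},\frac{q^2a^2}{bcdf}\end{matrix};q,q\right)$$ $$+\frac{(a,qa,\frac qa,e,f,\frac{qa}{bc},\frac{qa}{bd},\frac{qa}{cd},\frac{q^2a}{bef},\frac{q^2a}{cef},\frac{q^2a}{def};q)_\infty}{(\frac qb,\frac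 qc,\frac qd,\frac{qa}{b},\frac{qa}{c},\frac{qa}{d},\frac{qa}{e},\frac{qa}{f},\frac{ef}{q},\frac{q^2}{ef},\frac{q^2a^2}{bcdef};q)_\infty}\;{}_4\phi_3\left(\begin{matrix}\frac qe,\frac qf,\frac{qa}{ef},\frac{q^2a^2}{bcdef}\\ \frac{q^2a}{bef},\frac{q^2a}{cef},\frac{q^2a}{def}\end{matrix};q,q\right).$$
   Context: $\mathbb C^\ast=\mathbb C\setminus\{0\}$. $(x;q)_\infty=\prod_{n\ge0}(1-xq^n)$, $(x;q)_k=(x;q)_\infty/(xq^k;q)_\infty$ for $k\in\mathbb Z$, $(x_1,\dots,x_m;q)_k=\prod_i(x_i;q)_k$ for $k\in\mathbb Z\cup\{\infty\}$. ${}_4\phi_3\left(\begin{matrix}a_1,\dots,a_4\\ b_1,b_2,b_3\end{matrix};q,z\right)=\sum_{k\ge0}\frac{(a_1,\dots,a_4;q)_k}{(q,b_1,b_2,b_3;q)_k}z^k$; ${}_4\psi_4\left(\begin{matrix}a_1,\dots,a_4\\ b_1,\dots,b_4\end{matrix};q,z\right)=\sum_{k\in\mathbb Z}\frac{(a_1,\dots,a_4;q)_k}{(b_1,\dots,b_4;q)_k}z^k$; $${}_8W_7(a;a_4,\dots,a_8;q,z)=\sum_{k=0}^\infty\frac{1-aq^{2k}}{1-a}\,\frac{(a;q)_k}{(q;q)_k}\prod_{j=4}^8\frac{(a_j;q)_k}{(qa/a_j;q)_k}\,z^k .$$ *)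

(* Defs.v *)
From Stdlib Require Import Reals ZArith List Lra Lia.
From Coquelicot Require Import Coquelicot.
Export ListNotations.
Open Scope C_scope.

Fixpoint qprod (x q : C) (n : nat) : C :=
  match n with
  | O => 1
  | S m => qprod x q m * (1 - x * q ^ m)
  end.

Definition qpoch_inf (x q : C) : C :=
  iota (T := C_CompleteNormedModule)
    (fun l => filterlim (qprod x q) eventually (locally l)).

(** [(x;q)_k] for [k] in Z, with [(x;q)_{-n} = 1 / ((1 - x/q) ... (1 - x/q^n))].
    This finite-product form is [(x;q)_oo / (x q^k;q)_oo] whenever that quotient
    makes sense (lemma [qpoch_quot] below), and it also covers the terminating
    case [x = q^{-m}], where the quotient may read 0/0. *)
Definition qpoch (x q : C) (k : Z) : C :=
  match k with
  | Zneg p => / qprod (x / q ^ Pos.to_nat p) q (Pos.to_nat p)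
  | _ => qprod x q (Z.to_nat k)
  end.

Definition Cprod (l : list C) : C := fold_right Cmult 1 l.

Definition qpochs (xs : list C) (q : C) (k : Z) : C :=
  Cprod (map (fun x => qpoch x q k) xs).

Definition qpochs_inf (xs : list C) (q : C) : C :=
  Cprod (map (fun x => qpoch_inf x q) xs).

Definition Cpowz (z : C) (k : Z) : C :=
  match k with
  | Zneg p => / z ^ Pos.to_nat p
  | _ => z ^ Z.to_nat k
  end.

Definition Cseries (t : nat -> C) : C :=
  iota (T := C_CompleteNormedModule) (fun l => is_series t l).

Definition ex_Cseries (t : nat -> C) : Prop := exists l : C, is_series t l.

Definition Cbiseries (t : Z -> C) : C :=
  Cseries (fun n => t (Z.of_nat n)) + Cseries (fun n => t (- Z.of_nat (S n))%Z).

Definition ex_Cbiseries (t : Z -> C) : Prop :=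
  ex_Cseries (fun n => t (Z.of_nat n)) /\
  ex_Cseries (fun n => t (- Z.of_nat (S n))%Z).

Definition phi43_term (a1 a2 a3 a4 b1 b2 b3 q z : C) (k : nat) : C :=
  qpochs [a1; a2; a3; a4] q (Z.of_nat k) /
  qpochs [q; b1; b2; b3] q (Z.of_nat k) * z ^ k.

Definition phi43 (a1 a2 a3 a4 b1 b2 b3 q z : C) : C :=
  Cseries (phi43_term a1 a2 a3 a4 b1 b2 b3 q z).

(** If [b_j = q^m] with [m >= 1], then [1/(b_j;q)_{-n}] is the product
    [(1 - b_j/q) ... (1 - b_j/q^n)], which vanishes for [n >= m].  The total
    inverse, with [/ 0 = 0], gives exactly this (lemma [Cinv_qpoch_neg]). *)
Definition psi44_term (a1 a2 a3 a4 b1 b2 b3 b4 q z : C) (k : Z) : C :=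
  qpochs [a1; a2; a3; a4] q k / qpochs [b1; b2; b3; b4] q k * Cpowz z k.

Definition psi44 (a1 a2 a3 a4 b1 b2 b3 b4 q z : C) : C :=
  Cbiseries (psi44_term a1 a2 a3 a4 b1 b2 b3 b4 q z).

Definition W87_term (a a4 a5 a6 a7 a8 q z : C) (k : nat) : C :=
  (1 - a * q ^ (2 * k)) / (1 - a) *
  (qpoch a q (Z.of_nat k) / qpoch q q (Z.of_nat k)) *
  Cprod (map (fun aj => qpoch aj q (Z.of_nat k) /
                        qpoch (q * a / aj) q (Z.of_nat k))
             [a4; a5; a6; a7; a8]) * z ^ k.

Definition W87 (a a4 a5 a6 a7 a8 q z : C) : C :=
  Cseries (W87_term a a4 a5 a6 a7 a8 q z).

(** No factor in a denominator of a term of the series is zero.  In the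
    bilateral series, such factors come from the lower parameters when [k >= 0]
    and from the upper parameters when [k < 0]. *)
Definition phi43_wd (b1 b2 b3 q : C) : Prop :=
  forall b, In b [q; b1; b2; b3] -> forall k : nat, qpoch b q (Z.of_nat k) <> 0.

Definition psi44_wd (a1 a2 a3 a4 b1 b2 b3 b4 q : C) : Prop :=
  (forall b, In b [b1; b2; b3; b4] ->
     forall k : nat, qpoch b q (Z.of_nat k) <> 0) /\
  (forall a, In a [a1; a2; a3; a4] ->
     forall n : nat, qprod (a / q ^ n) q n <> 0).

Definition W87_wd (a a4 a5 a6 a7 a8 q : C) : Prop :=
  1 - a <> 0 /\
  (forall k : nat, qpoch q q (Z.of_nat k) <> 0) /\
  forall aj, In aj [a4; a5; a6; a7; a8] ->
    forall k : nat, qpoch (q * a / aj) q (Z.of_nat k) <> 0.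

Lemma Cinv_0 : / (0 : C) = 0.
Proof.
apply injective_projections; simpl; unfold Rdiv; ring.
Qed.

Lemma Cinv_invol (z : C) : / / z = z.
Proof.
destruct (Ceq_dec z 0) as [->|hz].
- now rewrite !Cinv_0.
- field; exact hz.
Qed.

Lemma Cinv_qpoch_neg (x q : C) (n : nat) :
  / qpoch x q (- Z.of_nat n) = qprod (x / q ^ n) q n.
Proof.
destruct n as [|n].
- simpl. field.
- unfold qpoch, Z.of_nat, Z.opp. rewrite SuccNat2Pos.id_succ.
  apply Cinv_invol.
Qed.

Lemma qpoch_of_nat (x q : C) (n : nat) : qpoch x q (Z.of_nat n) = qprod x q n.
Proof.
unfold qpoch. rewrite <- (Nat2Z.id n) at 2. destruct n; reflexivity.
Qed.

Lemma qprod_add (x q : C) (m n : nat) :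
  qprod x q (m + n) = qprod x q m * qprod (x * q ^ m) q n.
Proof.
induction n as [|n IH].
- rewrite Nat.add_0_r. simpl. ring.
- rewrite Nat.add_succ_r. simpl. rewrite IH, Cpow_add_r. ring.
Qed.

Lemma Cmod_qprod_le (x q : C) : (Cmod q < 1)%R ->
  forall n, (Cmod (qprod x q n) <= exp (Cmod x / (1 - Cmod q)))%R.
Proof.
intros hq n.
assert (h : (Cmod (qprod x q n) <=
             exp (Cmod x * ((1 - Cmod q ^ n) / (1 - Cmod q))))%R).
{ induction n as [|n IH].
  - simpl. rewrite Cmod_1.
    replace (Cmod x * ((1 - 1) / (1 - Cmod q)))%R with 0%R by (field; lra).
    rewrite exp_0. lra.
  - simpl. rewrite Cmod_mult.
    replace (Cmod x * ((1 - Cmod q * Cmod q ^ n) / (1 - Cmod q)))%R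
      with (Cmod x * ((1 - Cmod q ^ n) / (1 - Cmod q)) + Cmod x * Cmod q ^ n)%R
      by (field; lra).
    rewrite exp_plus.
    apply Rmult_le_compat; try apply Cmod_ge_0; [exact IH|].
    eapply Rle_trans; [apply Cmod_triangle|].
    rewrite Cmod_opp, Cmod_mult, Cmod_pow, Cmod_1.
    apply exp_ineq1_le. }
eapply Rle_trans; [exact h|].
assert (hm : (Cmod x * ((1 - Cmod q ^ n) / (1 - Cmod q)) <=
              Cmod x / (1 - Cmod q))%R).
{ unfold Rdiv. apply Rmult_le_compat_l; [apply Cmod_ge_0|].
  assert (0 < / (1 - Cmod q))%R by (apply Rinv_0_lt_compat; lra).
  assert (0 <= Cmod q ^ n)%R by (apply pow_le, Cmod_ge_0).
  nra. }
destruct (Rle_lt_or_eq_dec _ _ hm) as [hl|He].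
- left. now apply exp_increasing.
- rewrite He. right. reflexivity.
Qed.

Lemma qpoch_inf_correct (x q : C) : (Cmod q < 1)%R ->
  filterlim (qprod x q) eventually (locally (qpoch_inf x q)).
Proof.
intros hq.
set (M := exp (Cmod x / (1 - Cmod q))).
pose (d := fun n : nat => - (qprod x q n * (x * q ^ n))).
assert (hex : ex_series (V := C_CompleteNormedModule) d).
{ apply (ex_series_le (V := C_CompleteNormedModule) d
           (fun n => scal (M * Cmod x)%R (Cmod q ^ n)%R)).
  - intros n. change (Cmod (d n) <= M * Cmod x * Cmod q ^ n)%R. unfold d.
    rewrite Cmod_opp, !Cmod_mult, Cmod_pow.
    rewrite Rmult_assoc. apply Rmult_le_compat_r.
    + apply Rmult_le_pos; [|apply pow_le]; apply Cmod_ge_0.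
    + now apply Cmod_qprod_le.
  - apply (ex_series_scal (K := R_AbsRing) (V := R_NormedModule)).
    apply ex_series_geom. rewrite Rabs_pos_eq; [exact hq|apply Cmod_ge_0]. }
assert (hsum : forall n, qprod x q (S n) = 1 + sum_n (G := C_AbelianMonoid) d n).
{ induction n as [|n IH].
  - rewrite sum_O. unfold d. simpl. ring.
  - rewrite sum_Sn. change (plus ?u ?v) with (u + v).
    rewrite Cplus_assoc, <- IH.
    change (qprod x q (S (S n))) with (qprod x q (S n) * (1 - x * q ^ S n)).
    unfold d. ring. }
destruct hex as [l hl].
assert (hlim : filterlim (qprod x q) eventually
                 (locally (T := C_CompleteNormedModule) (1 + l))).
{ intros P HP.
  assert (h1 : filterlim (fun n => plus (RtoC 1 : C_CompleteNormedModule)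
                  (sum_n (G := C_CompleteNormedModule) d n)) eventually
                  (locally (plus (RtoC 1 : C_CompleteNormedModule) l))).
  { eapply filterlim_comp_2;
      [apply filterlim_const | exact hl | apply (filterlim_plus (K := C_AbsRing) (V := C_NormedModule))]. }
  destruct (h1 P HP) as [N HN].
  exists (S N). intros [|n] hn; [lia|].
  rewrite hsum. apply HN. lia. }
assert (he : qpoch_inf x q = 1 + l)
  by exact (iota_filterlim_locally (V := C_CompleteNormedModule)
              (F := eventually) (qprod x q) (1 + l) hlim).
rewrite he. exact hlim.
Qed.

Lemma qpoch_inf_split (x q : C) (n : nat) : (Cmod q < 1)%R ->
  qpoch_inf x q = qprod x q n * qpoch_inf (x * q ^ n) q.
Proof.
intros hq.
assert (h1 : filterlim (fun m => qprod x q (n + m)) eventually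
   (locally (T := C_CompleteNormedModule) (qpoch_inf x q))).
{ intros P HP. destruct (qpoch_inf_correct x q hq P HP) as [N HN].
  exists N. intros m hm. apply HN. lia. }
assert (h2 : filterlim (fun m => qprod x q (n + m)) eventually
   (locally (T := C_CompleteNormedModule)
      (qprod x q n * qpoch_inf (x * q ^ n) q))).
{ apply (filterlim_ext (fun m => scal (V := C_CompleteNormedModule)
           (qprod x q n) (qprod (x * q ^ n) q m))).
  - intros m. symmetry. apply qprod_add.
  - eapply filterlim_comp; [now apply qpoch_inf_correct|].
    apply (filterlim_scal_r (V := C_CompleteNormedModule)). }
exact (filterlim_locally_unique (V := C_CompleteNormedModule) _ _ _ h1 h2).
Qed.

Lemma qpoch_quot (x q : C) (k : Z) : q <> 0 -> (Cmod q < 1)%R ->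
  qpoch_inf (x * Cpowz q k) q <> 0 ->
  qpoch x q k = qpoch_inf x q / qpoch_inf (x * Cpowz q k) q.
Proof.
intros q0 hq hk.
assert (hpos : forall n : nat, qpoch_inf (x * q ^ n) q <> 0 ->
          qprod x q n = qpoch_inf x q / qpoch_inf (x * q ^ n) q).
{ intros n hn. rewrite (qpoch_inf_split x q n hq). field. exact hn. }
destruct k as [|p|p]; [now apply hpos .. |].
unfold Cpowz in *. unfold qpoch.
set (n := Pos.to_nat p) in *. fold (x / q ^ n) in *.
assert (hqn : q ^ n <> 0) by now apply Cpow_nz.
assert (hs := qpoch_inf_split (x / q ^ n) q n hq).
replace (x / q ^ n * q ^ n) with x in hs by (field; exact hqn).
rewrite hs in hk |- *.
assert (qprod (x / q ^ n) q n <> 0) by (intros e; apply hk; rewrite e; ring).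
assert (qpoch_inf x q <> 0) by (intros e; apply hk; rewrite e; ring).
field. now split.
Qed.

(* Main.v *)
(** Jackson's terminating sum turns into a well-poised Bailey lemma, and that
    into Bailey's terminating transformation, whose right-hand side can be read
    as a convolution with weight [v q^r - q^(n-r)].  As [n] tends to infinity the
    two ends of the convolution separate and give the nonterminating Watson
    transformation [8W7 = Ra + Rl] with two balanced [4phi3] series.

    The residues of
    [(x1 t, x2 t, x3 t, y1/t, y2/t)_oo / (u1 t, u2 t, u3 t, v1/t, v2/t)_oo]
    sum to zero (truncate the products, use Lagrange interpolation, pass to the
    limit by Tannery's theorem).  This relates [Ra], [Rl], the [4psi4] and the
    remaining [4phi3].  Eliminating [Ra] gives the theorem, except that the two
    contributions to the coefficient of [Rl] still have to be combined; this is
    Weierstrass' addition formula for theta functions.  For [a q^n] with large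
    [n] that formula follows from the case [e = 1] of Watson's transformation
    and a residue sum, and it is invariant under [a -> a q].

    All of this is done for parameters no monomial of which is a power of [q].
    The general case follows by continuity along
    [(a s, b s^2, c s^2, d s^2, e s^3, f s^3)], [s -> 1]. *)
Require Import Defs.
From Stdlib Require Import Reals ZArith List Lra Lia FinFun FunctionalExtensionality.
From Coquelicot Require Import Coquelicot.
Open Scope C_scope.

(** * Complex limits and series *)

(** Two of the five families of poles in the residue sum, q^-k and q^(k+1), together fill the
    lattice q^Z; this is where the bilateral series comes from. Two others, at 1/(a q^k) and 1/(l
    q^k) with l = q a^2/(bcd), reproduce the two series of the Watson transformation. Eliminating
    the first leaves the second with a coefficient that is a sum of two infinite products, while the
    theorem asserts a single one: hence the need for a theta identity. That identity is first
    obtained multiplied by the value of a 3phi2 series, which might vanish. Replacing a by a q^n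
    sends the parameters of this series to 0 and its value to 1/(q;q)_oo, so it is nonzero for large
    n. The intermediate steps divide by many products that do not occur in the theorem. A parameter
    is kept away from the powers of q by its modulus alone, so real factors s > 1 suffice for the
    perturbation. The hypotheses of the theorem are what keeps the limiting denominators nonzero and
    the limiting argument below 1 in modulus. *)

Definition cvgC (u : nat -> C) (l : C) : Prop :=
  forall eps : R, (0 < eps)%R ->
  exists N, forall n, (N <= n)%nat -> (Cmod (u n - l) < eps)%R.

(** Estimates are done in epsilon form; this is the passage to the filters behind [qpoch_inf] and
    [Cseries]. *)
Lemma cvgC_filterlim (u : nat -> C) (l : C) :
  cvgC u l <->
  filterlim u eventually (locally (T := C_CompleteNormedModule) l).
Proof.
split.
- intros h. apply (proj2 (filterlim_locally_ball_norm (U := C_NormedModule) u l)).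
  intros eps. destruct (h eps (cond_pos eps)) as [N HN].
  exists N. intros n hn. exact (HN n hn).
- intros h eps he.
  destruct (proj1 (filterlim_locally_ball_norm (U := C_NormedModule) u l) h
              (mkposreal eps he)) as [N HN].
  exists N. intros n hn. exact (HN n hn).
Qed.

Lemma cvgC_unique (u : nat -> C) (l l' : C) : cvgC u l -> cvgC u l' -> l = l'.
Proof.
intros h h'. apply cvgC_filterlim in h. apply cvgC_filterlim in h'.
exact (filterlim_locally_unique (V := C_CompleteNormedModule) _ _ _ h h').
Qed.

Lemma cvgC_ext_ev (u v : nat -> C) (l : C) (N : nat) :
  (forall n, (N <= n)%nat -> u n = v n) -> cvgC u l -> cvgC v l.
Proof.
intros e h eps he. destruct (h eps he) as [M HM].
exists (Nat.max N M). intros n hn. rewrite <- e by lia. apply HM. lia.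
Qed.

Lemma cvgC_ext (u v : nat -> C) (l : C) :
  (forall n, u n = v n) -> cvgC u l -> cvgC v l.
Proof. intros e. apply (cvgC_ext_ev u v l 0). auto. Qed.

Lemma cvgC_const (l : C) : cvgC (fun _ => l) l.
Proof.
intros eps he. exists 0%nat. intros n _. unfold Cminus.
rewrite Cplus_opp_r, Cmod_0. exact he.
Qed.

Lemma cvgC_sub (u : nat -> C) (l : C) (f : nat -> nat) :
  (forall n, (n <= f n)%nat) -> cvgC u l -> cvgC (fun n => u (f n)) l.
Proof.
intros hf h eps he. destruct (h eps he) as [N HN].
exists N. intros n hn. apply HN. specialize (hf n). lia.
Qed.

Lemma cvgC_shift (u : nat -> C) (l : C) (k : nat) :
  cvgC u l -> cvgC (fun n => u (n - k)%nat) l.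
Proof.
intros h eps he. destruct (h eps he) as [N HN].
exists (N + k)%nat. intros n hn. apply HN. lia.
Qed.

Lemma cvgC_plus (u v : nat -> C) (l m : C) :
  cvgC u l -> cvgC v m -> cvgC (fun n => u n + v n) (l + m).
Proof.
intros h1 h2 eps he.
destruct (h1 (eps / 2)%R) as [N1 H1]; [lra|].
destruct (h2 (eps / 2)%R) as [N2 H2]; [lra|].
exists (Nat.max N1 N2). intros n hn.
replace (u n + v n - (l + m)) with ((u n - l) + (v n - m)) by ring.
eapply Rle_lt_trans; [apply Cmod_triangle|].
specialize (H1 n ltac:(lia)). specialize (H2 n ltac:(lia)). lra.
Qed.

Lemma cvgC_bounded (u : nat -> C) (l : C) : cvgC u l ->
  exists N, forall n, (N <= n)%nat -> (Cmod (u n) <= Cmod l + 1)%R.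
Proof.
intros h. destruct (h 1%R Rlt_0_1) as [N HN]. exists N. intros n hn.
replace (u n) with (l + (u n - l)) by ring.
eapply Rle_trans; [apply Cmod_triangle|]. specialize (HN n hn). lra.
Qed.

Lemma cvgC_mult (u v : nat -> C) (l m : C) :
  cvgC u l -> cvgC v m -> cvgC (fun n => u n * v n) (l * m).
Proof.
intros h1 h2 eps he.
destruct (cvgC_bounded u l h1) as [N0 H0].
assert (hl := Cmod_ge_0 l). assert (hm := Cmod_ge_0 m).
(* In u v - l m = u (v - m) + (u - l) m the cofactors are bounded by |l| + 1 and |m|, whose sum is
   [A]. *)
set (A := (Cmod l + 1 + Cmod m)%R).
assert (hA : (0 < A)%R) by (unfold A; lra).
destruct (h1 (eps / (2 * A))%R) as [N1 H1]; [apply Rdiv_lt_0_compat; lra|].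
destruct (h2 (eps / (2 * A))%R) as [N2 H2]; [apply Rdiv_lt_0_compat; lra|].
exists (Nat.max N0 (Nat.max N1 N2)). intros n hn.
specialize (H0 n ltac:(lia)). specialize (H1 n ltac:(lia)). specialize (H2 n ltac:(lia)).
replace (u n * v n - l * m) with (u n * (v n - m) + (u n - l) * m) by ring.
eapply Rle_lt_trans; [apply Cmod_triangle|]. rewrite !Cmod_mult.
assert (hu := Cmod_ge_0 (u n)).
assert (e1 := Cmod_ge_0 (u n - l)). assert (e2 := Cmod_ge_0 (v n - m)).
set (x := (eps / (2 * A))%R) in *.
assert (hx : eps = (2 * A * x)%R) by (unfold x; field; lra).
rewrite hx. unfold A in *.
assert (Cmod (u n) * Cmod (v n - m) <= (Cmod l + 1) * x)%R
  by (apply Rmult_le_compat; lra).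
assert (Cmod (u n - l) * Cmod m <= x * Cmod m)%R
  by (apply Rmult_le_compat_r; lra).
assert (0 < x)%R by (unfold x; apply Rdiv_lt_0_compat; lra).
nra.
Qed.

Lemma cvgC_inv (u : nat -> C) (l : C) :
  l <> 0 -> cvgC u l -> cvgC (fun n => / u n) (/ l).
Proof.
intros hl h eps he.
assert (pl : (0 < Cmod l)%R) by now apply Cmod_gt_0.
destruct (h (Cmod l / 2)%R) as [N1 H1]; [lra|].
(* Once |u n| > |l|/2, the difference of inverses |u n - l| / |u n l| is below 2 |u n - l| /
   |l|^2. *)
destruct (h (eps * (Cmod l * Cmod l / 2))%R) as [N2 H2].
{ apply Rmult_lt_0_compat; [exact he|]. nra. }
exists (Nat.max N1 N2). intros n hn.
specialize (H1 n ltac:(lia)). specialize (H2 n ltac:(lia)).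
assert (hu : (Cmod l / 2 < Cmod (u n))%R).
{ assert (Cmod l <= Cmod (u n) + Cmod (u n - l))%R.
  { replace l with (u n + - (u n - l)) at 1 by ring.
    eapply Rle_trans; [apply Cmod_triangle|]. rewrite Cmod_opp. lra. }
  lra. }
assert (un0 : u n <> 0).
{ intros e. rewrite e, Cmod_0 in hu. lra. }
replace (/ u n - / l) with (- (u n - l) * (/ (u n * l))) by (field; now split).
rewrite Cmod_mult, Cmod_opp, Cmod_inv, Cmod_mult by (now apply Cmult_neq_0).
assert (hp : (Cmod l * Cmod l / 2 < Cmod (u n) * Cmod l)%R) by nra.
assert (hq : (0 < Cmod l * Cmod l / 2)%R) by nra.
apply (Rmult_lt_reg_r (Cmod (u n) * Cmod l)); [lra|].
rewrite Rmult_assoc, Rinv_l by lra. rewrite Rmult_1_r.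
eapply Rlt_trans; [exact H2|]. apply Rmult_lt_compat_l; lra.
Qed.

Lemma cvgC_div (u v : nat -> C) (l m : C) :
  m <> 0 -> cvgC u l -> cvgC v m -> cvgC (fun n => u n / v n) (l / m).
Proof. intros hm h1 h2. apply cvgC_mult; [|apply cvgC_inv]; assumption. Qed.

Lemma cvgC_opp (u : nat -> C) (l : C) : cvgC u l -> cvgC (fun n => - u n) (- l).
Proof.
intros h. apply (cvgC_ext (fun n => (-(1)) * u n)); [intros; ring|].
replace (- l) with (-(1) * l) by ring. apply cvgC_mult; [apply cvgC_const|exact h].
Qed.

Lemma cvgC_minus (u v : nat -> C) (l m : C) :
  cvgC u l -> cvgC v m -> cvgC (fun n => u n - v n) (l - m).
Proof. intros h1 h2. apply cvgC_plus; [|apply cvgC_opp]; assumption. Qed.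

Lemma cvgC_pow (u : nat -> C) (l : C) (k : nat) :
  cvgC u l -> cvgC (fun n => u n ^ k) (l ^ k).
Proof.
intros h. induction k as [|k IH]; simpl; [apply cvgC_const|].
now apply cvgC_mult.
Qed.

Lemma cvgC_le (u : nat -> C) (l : C) (M : R) (N : nat) :
  cvgC u l -> (forall n, (N <= n)%nat -> (Cmod (u n) <= M)%R) -> (Cmod l <= M)%R.
Proof.
intros h hM. apply Rnot_lt_le. intros hlt.
destruct (h (Cmod l - M)%R) as [N1 H1]; [lra|].
specialize (H1 (Nat.max N N1) ltac:(lia)). specialize (hM (Nat.max N N1) ltac:(lia)).
assert (Cmod l <= Cmod (u (Nat.max N N1)) + Cmod (u (Nat.max N N1) - l))%R.
{ replace l with (u (Nat.max N N1) + - (u (Nat.max N N1) - l)) at 1 by ring.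
  eapply Rle_trans; [apply Cmod_triangle|]. rewrite Cmod_opp. lra. }
lra.
Qed.

Lemma cvgC_qpow (q : C) : (Cmod q < 1)%R -> cvgC (fun n => q ^ n) 0.
Proof.
intros hq eps he.
destruct (pow_lt_1_zero (Cmod q)) with (y := eps) as [N HN];
  [rewrite Rabs_pos_eq; [exact hq|apply Cmod_ge_0]|exact he|].
exists N. intros n hn. specialize (HN n hn).
replace (q ^ n - 0) with (q ^ n) by ring. rewrite Cmod_pow.
rewrite Rabs_pos_eq in HN; [exact HN|apply pow_le, Cmod_ge_0].
Qed.

(** * Finite sums, geometric domination and Tannery's theorem *)

(** The upper end is excluded, unlike in [sum_n], so that empty sums exist and sums concatenate
    without a shift. *)
Fixpoint sumC (t : nat -> C) (n : nat) : C :=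
  match n with O => 0 | S m => sumC t m + t m end.

Lemma sumC_S (t : nat -> C) (n : nat) : sumC t (S n) = sumC t n + t n.
Proof. reflexivity. Qed.

Lemma sumC_ext (t t' : nat -> C) (n : nat) :
  (forall k, (k < n)%nat -> t k = t' k) -> sumC t n = sumC t' n.
Proof.
induction n as [|n IH]; intros h; simpl; [reflexivity|].
rewrite IH by (intros; apply h; lia). rewrite h by lia. reflexivity.
Qed.

Lemma sumC_plus (t t' : nat -> C) (n : nat) :
  sumC (fun k => t k + t' k) n = sumC t n + sumC t' n.
Proof. induction n as [|n IH]; simpl; [ring|]. rewrite IH. ring. Qed.

Lemma sumC_scal (a : C) (t : nat -> C) (n : nat) :
  sumC (fun k => a * t k) n = a * sumC t n.
Proof. induction n as [|n IH]; simpl; [ring|]. rewrite IH. ring. Qed.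

Lemma sumC_0 (n : nat) : sumC (fun _ => 0) n = 0.
Proof. induction n as [|n IH]; simpl; [ring|]. rewrite IH. ring. Qed.

Lemma sumC_app (t : nat -> C) (m n : nat) :
  sumC t (m + n) = sumC t m + sumC (fun k => t (m + k)%nat) n.
Proof.
induction n as [|n IH].
- rewrite Nat.add_0_r. simpl. ring.
- rewrite Nat.add_succ_r. simpl. rewrite IH. ring.
Qed.

Lemma sumC_head (t : nat -> C) (n : nat) :
  sumC t (S n) = t 0%nat + sumC (fun k => t (S k)) n.
Proof. change (S n) with (1 + n)%nat. rewrite sumC_app. simpl. ring. Qed.

Lemma sumC_rev (t : nat -> C) (n : nat) :
  sumC (fun k => t (n - S k)%nat) n = sumC t n.
Proof.
induction n as [|n IH]; [reflexivity|].
rewrite sumC_head. simpl. rewrite Nat.sub_0_r, IH. ring.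
Qed.

(** Interchange of summation over the triangle k <= r < n, with r = k + i; it performs the exchange
    in the Bailey lemma. *)
Lemma sumC_triangle (f : nat -> nat -> C) (n : nat) :
  sumC (fun r => sumC (f r) (S r)) n =
  sumC (fun k => sumC (fun i => f (k + i)%nat k) (n - k)) n.
Proof.
induction n as [|n IH]; [reflexivity|].
rewrite (sumC_S (fun r => sumC (f r) (S r))), IH, (sumC_S (f n)).
rewrite (sumC_S (fun k => sumC (fun i => f (k + i)%nat k) (S n - k)) n).
rewrite (sumC_ext (fun k => sumC (fun i => f (k + i)%nat k) (S n - k))
          (fun k => sumC (fun i => f (k + i)%nat k) (n - k) + f n k)).
- rewrite sumC_plus. replace (S n - n)%nat with 1%nat by lia.
  simpl. rewrite Nat.add_0_r. ring.
- intros k hk. replace (S n - k)%nat with (S (n - k)) by lia. rewrite sumC_S.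
  replace (k + (n - k))%nat with n by lia. reflexivity.
Qed.

Lemma sum_n_sumC (t : nat -> C) (n : nat) :
  sum_n (G := C_AbelianMonoid) t n = sumC t (S n).
Proof.
induction n as [|n IH].
- rewrite sum_O. simpl. ring.
- rewrite sum_Sn, IH. reflexivity.
Qed.

Lemma is_series_cvgC (t : nat -> C) (l : C) :
  is_series (K := C_AbsRing) (V := C_NormedModule) t l <-> cvgC (sumC t) l.
Proof.
split.
- intros h. assert (h' : cvgC (fun n => sumC t (S n)) l).
  { apply (cvgC_ext (sum_n (G := C_AbelianMonoid) t)); [apply sum_n_sumC|].
    apply cvgC_filterlim. exact h. }
  apply (cvgC_ext_ev (fun n => sumC t (S (n - 1))) _ _ 1).
  + intros n hn. replace (S (n - 1)) with n by lia. reflexivity.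
  + exact (cvgC_shift _ _ 1 h').
- intros h. apply cvgC_filterlim.
  apply (cvgC_ext (fun n => sumC t (S n))); [symmetry; apply sum_n_sumC|].
  apply (cvgC_sub _ _ S); [lia|exact h].
Qed.

Lemma Cseries_eq (t : nat -> C) (l : C) : cvgC (sumC t) l -> Cseries t = l.
Proof.
intros h. apply is_series_cvgC in h.
exact (iota_filterlim_locally (V := C_CompleteNormedModule)
         (F := eventually) (sum_n t) l h).
Qed.

Lemma ex_Cseries_eq (t : nat -> C) : ex_Cseries t -> cvgC (sumC t) (Cseries t).
Proof.
intros [l h]. apply is_series_cvgC in h. rewrite (Cseries_eq t l h). exact h.
Qed.

Lemma ex_Cseries_cvgC (t : nat -> C) (l : C) : cvgC (sumC t) l -> ex_Cseries t.
Proof. intros h. exists l. now apply is_series_cvgC. Qed.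

Lemma Cseries_ext (t t' : nat -> C) : (forall k, t k = t' k) -> Cseries t = Cseries t'.
Proof.
intros e. unfold Cseries. f_equal.
apply functional_extensionality. intros l.
replace t' with t; [reflexivity|].
now apply functional_extensionality.
Qed.

Lemma geom_dominated_ex (t : nat -> C) (M r : R) :
  (0 <= r < 1)%R -> (forall k, (Cmod (t k) <= M * r ^ k)%R) -> ex_Cseries t.
Proof.
intros hr h.
apply (ex_series_le (K := C_AbsRing) (V := C_CompleteNormedModule) t (fun k => scal M (r ^ k)%R)).
- intros k. exact (h k).
- apply (ex_series_scal (K := R_AbsRing) (V := R_NormedModule)).
  apply ex_series_geom. rewrite Rabs_pos_eq; lra.
Qed.

Lemma geom_dominated_sum (t : nat -> C) (M r : R) (n : nat) :
  (0 <= r < 1)%R -> (forall k, (Cmod (t k) <= M * r ^ k)%R) ->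
  (Cmod (sumC t n) <= M / (1 - r))%R.
Proof.
intros hr h.
assert (hM : (0 <= M)%R).
{ specialize (h 0%nat). simpl in h. assert (hc := Cmod_ge_0 (t 0%nat)). lra. }
(* The bound M/(1 - r) does not pass through the induction; the partial geometric sum does. *)
assert (h1 : (Cmod (sumC t n) <= M * ((1 - r ^ n) / (1 - r)))%R).
{ induction n as [|n IH]; simpl.
  - rewrite Cmod_0. replace (M * ((1 - 1) / (1 - r)))%R with 0%R by (field; lra). lra.
  - eapply Rle_trans; [apply Cmod_triangle|]. specialize (h n).
    replace (M * ((1 - r * r ^ n) / (1 - r)))%R
      with (M * ((1 - r ^ n) / (1 - r)) + M * r ^ n)%R by (field; lra). lra. }
eapply Rle_trans; [exact h1|].
unfold Rdiv. apply Rmult_le_compat_l; [exact hM|].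
assert (0 < / (1 - r))%R by (apply Rinv_0_lt_compat; lra).
assert (0 <= r ^ n)%R by (apply pow_le; lra). nra.
Qed.

Lemma geom_dominated_tail (t : nat -> C) (M r : R) (n : nat) :
  (0 <= r < 1)%R -> (forall k, (Cmod (t k) <= M * r ^ k)%R) ->
  (Cmod (Cseries t - sumC t n) <= M * r ^ n / (1 - r))%R.
Proof.
intros hr h.
assert (hl := ex_Cseries_eq t (geom_dominated_ex t M r hr h)).
apply (cvgC_le (fun m => sumC t m - sumC t n) _ _ n).
- apply cvgC_minus; [exact hl|apply cvgC_const].
- intros m hm. replace m with (n + (m - n))%nat by lia.
  rewrite sumC_app.
  replace (sumC t n + sumC (fun k => t (n + k)%nat) (m - n) - sumC t n)
    with (sumC (fun k => t (n + k)%nat) (m - n)) by ring.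
  apply geom_dominated_sum; [exact hr|].
  intros k. rewrite Rmult_assoc, <- pow_add. apply h.
Qed.

(** A majorant uniform in n cuts all tails at one index, and the finite sums that remain converge
    term by term. The bound is asked only from [N0] on, because bounds for perturbed denominators
    hold only eventually. *)
Lemma tannery (t : nat -> nat -> C) (T : nat -> C) (M r : R) (N0 : nat) :
  (0 <= r < 1)%R ->
  (forall n k, (N0 <= n)%nat -> (Cmod (t n k) <= M * r ^ k)%R) ->
  (forall k, cvgC (fun n => t n k) (T k)) ->
  ex_Cseries T /\ cvgC (fun n => Cseries (t n)) (Cseries T).
Proof.
intros hr hd hc.
assert (hT : forall k, (Cmod (T k) <= M * r ^ k)%R).
{ intros k. apply (cvgC_le _ _ _ N0 (hc k)). intros n hn. now apply hd. }
assert (hM : (0 <= M)%R).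
{ specialize (hT 0%nat). simpl in hT. assert (h := Cmod_ge_0 (T 0%nat)). lra. }
split; [exact (geom_dominated_ex T M r hr hT)|].
intros eps he.
(* This makes the tail M r^K/(1 - r) at most eps/3; M + 1 in place of M covers M = 0. *)
destruct (pow_lt_1_zero r) with (y := (eps * (1 - r) / (3 * (M + 1)))%R) as [K HK].
{ rewrite Rabs_pos_eq; lra. }
{ apply Rdiv_lt_0_compat; [|lra]. apply Rmult_lt_0_compat; lra. }
specialize (HK K (le_n K)). rewrite Rabs_pos_eq in HK by (apply pow_le; lra).
assert (htail : (M * r ^ K / (1 - r) <= eps / 3)%R).
{ apply (Rmult_le_reg_r (1 - r)); [lra|].
  unfold Rdiv. rewrite (Rmult_assoc (M * r ^ K)), Rinv_l by lra.
  apply (Rmult_lt_compat_r (M + 1)) in HK; [|lra].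
  replace (eps * (1 - r) / (3 * (M + 1)) * (M + 1))%R
    with (eps * / 3 * (1 - r))%R in HK by (field; lra).
  assert (0 <= r ^ K)%R by (apply pow_le; lra). nra. }
assert (hfin : cvgC (fun n => sumC (t n) K) (sumC T K)).
{ clear - hc. induction K as [|K IH]; simpl; [apply cvgC_const|].
  now apply cvgC_plus. }
destruct (hfin (eps / 3)%R) as [N1 H1]; [lra|].
exists (Nat.max N0 N1). intros n hn.
specialize (H1 n ltac:(lia)).
assert (h2 := geom_dominated_tail (t n) M r K hr (fun k => hd n k ltac:(lia))).
assert (h3 := geom_dominated_tail T M r K hr hT).
replace (Cseries (t n) - Cseries T) with
  ((Cseries (t n) - sumC (t n) K) + (sumC (t n) K - sumC T K) + - (Cseries T - sumC T K)) by ring.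
eapply Rle_lt_trans; [apply Cmod_triangle|]. rewrite Cmod_opp.
assert (h4 := Cmod_triangle (Cseries (t n) - sumC (t n) K) (sumC (t n) K - sumC T K)).
lra.
Qed.

Lemma Cseries_finite (t : nat -> C) (n : nat) :
  (forall k, (n <= k)%nat -> t k = 0) -> Cseries t = sumC t n.
Proof.
intros h. apply Cseries_eq.
apply (cvgC_ext_ev (fun _ => sumC t n) _ _ n); [|apply cvgC_const].
intros m hm. replace m with (n + (m - n))%nat by lia. rewrite sumC_app.
rewrite (sumC_ext (fun k => t (n + k)%nat) (fun _ => 0)) by (intros; apply h; lia).
rewrite sumC_0. ring.
Qed.

(** Terminating sums are extended by zero to series. Since the length is at least n, each fixed
    index is eventually inside the sum. *)
Lemma tannery_sum (t : nat -> nat -> C) (T : nat -> C) (M r : R) (len : nat -> nat) :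
  (forall n, (n <= len n)%nat) -> (0 <= r < 1)%R ->
  (forall n k, (k < len n)%nat -> (Cmod (t n k) <= M * r ^ k)%R) ->
  (forall k, cvgC (fun n => t n k) (T k)) ->
  ex_Cseries T /\ cvgC (fun n => sumC (t n) (len n)) (Cseries T).
Proof.
intros hlen hr hd hc.
pose (t' n k := if lt_dec k (len n) then t n k else 0).
assert (hM : (0 <= M)%R).
{ specialize (hlen 1%nat). specialize (hd 1%nat 0%nat ltac:(lia)). simpl in hd.
  assert (h := Cmod_ge_0 (t 1%nat 0%nat)). lra. }
destruct (tannery t' T M r 0 hr) as [h1 h2].
- intros n k _. unfold t'. destruct (lt_dec k (len n)); [now apply hd|].
  rewrite Cmod_0. apply Rmult_le_pos; [exact hM|apply pow_le; lra].
- intros k. apply (cvgC_ext_ev (fun n => t n k) _ _ (S k)); [|apply hc].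
  intros n hn. unfold t'. destruct (lt_dec k (len n)); [reflexivity|].
  specialize (hlen n). lia.
- split; [exact h1|]. revert h2. apply cvgC_ext. intros n.
  rewrite (Cseries_finite (t' n) (len n)).
  + apply sumC_ext. intros k hk. unfold t'. destruct (lt_dec k (len n)); [reflexivity|lia].
  + intros k hk. unfold t'. destruct (lt_dec k (len n)); [lia|reflexivity].
Qed.

Lemma Cseries_scal (a : C) (t : nat -> C) :
  ex_Cseries t -> Cseries (fun k => a * t k) = a * Cseries t.
Proof.
intros h. apply Cseries_eq. apply (cvgC_ext (fun n => a * sumC t n)).
- intros n. symmetry. apply sumC_scal.
- apply cvgC_mult; [apply cvgC_const|now apply ex_Cseries_eq].
Qed.

Lemma Cseries_head (t : nat -> C) :
  ex_Cseries t -> Cseries t = t 0%nat + Cseries (fun k => t (S k)).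
Proof.
intros h. apply ex_Cseries_eq in h.
assert (h1 : cvgC (sumC (fun k => t (S k))) (Cseries t - t 0%nat)).
{ apply (cvgC_ext (fun n => sumC t (S n) - t 0%nat)).
  - intros n. rewrite sumC_head. ring.
  - apply cvgC_minus; [|apply cvgC_const]. apply (cvgC_sub _ _ S); [lia|exact h]. }
rewrite (Cseries_eq _ _ h1). ring.
Qed.

(** * q-shifted factorials *)

Lemma neq0_div (x y : C) : x <> 0 -> y <> 0 -> x / y <> 0.
Proof.
intros hx hy e. apply hx. replace x with (x / y * y) by (field; exact hy). rewrite e. ring.
Qed.

Lemma qprod_S (x q : C) (n : nat) : qprod x q (S n) = qprod x q n * (1 - x * q ^ n).
Proof. reflexivity. Qed.

Lemma qprod_head (x q : C) (n : nat) : qprod x q (S n) = (1 - x) * qprod (x * q) q n.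
Proof.
change (S n) with (1 + n)%nat. rewrite qprod_add. simpl.
replace (x * (q * 1)) with (x * q) by ring. ring.
Qed.

Lemma qprod_neq0 (x q : C) (n : nat) :
  (forall k, (k < n)%nat -> x * q ^ k <> 1) -> qprod x q n <> 0.
Proof.
induction n as [|n IH]; intros h; simpl.
- exact C1_nz.
- apply Cmult_neq_0; [apply IH; intros; apply h; lia|].
  intros e. apply (h n (Nat.lt_succ_diag_r n)).
  replace (x * q ^ n) with (1 - (1 - x * q ^ n)) by ring. rewrite e. ring.
Qed.

Lemma qprod_shift_neq0 (x q : C) (m n : nat) :
  (forall k, qprod x q k <> 0) -> qprod (x * q ^ m) q n <> 0.
Proof.
intros h e. apply (h (m + n)%nat). rewrite qprod_add, e. ring.
Qed.

Lemma qprod_1 (q : C) (n : nat) : qprod 1 q (S n) = 0.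
Proof. rewrite qprod_head. ring. Qed.

Lemma qprod_0 (q : C) (n : nat) : qprod 0 q n = 1.
Proof. induction n as [|n IH]; simpl; [reflexivity|]. rewrite IH. ring. Qed.

(** This is (-1)^k q^(k(k-1)/2), the factor that appears when a q-shifted factorial is reversed. *)
Fixpoint qsign (q : C) (k : nat) : C :=
  match k with O => 1 | S j => qsign q j * - q ^ j end.

Lemma qsign_neq0 (q : C) (k : nat) : q <> 0 -> qsign q k <> 0.
Proof.
intros hq. induction k as [|k IH]; simpl; [exact C1_nz|].
apply Cmult_neq_0; [exact IH|]. intros e.
apply (Cpow_nz q k hq). replace (q ^ k) with (- - q ^ k) by ring. rewrite e. ring.
Qed.

(** Both sides are q^(k^2). *)
Lemma qsign_sqr (q : C) (k : nat) : qsign q k * qsign q k * q ^ k = (q ^ k) ^ k.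
Proof.
induction k as [|k IH]; [simpl; ring|].
assert (h : forall m, (q ^ S k) ^ m = (q ^ k) ^ m * q ^ m).
{ intros m. change (q ^ S k) with (q * q ^ k). rewrite Cpow_mult_l. ring. }
rewrite h. cbn [qsign Cpow]. rewrite <- IH. ring.
Qed.

(** Each factor is 1 - y q^j = - y q^j (1 - 1/(y q^j)), and the last brackets, read backwards, are
    the factors of the product on the right. *)
Lemma qprod_rev (y q : C) (k : nat) : y <> 0 -> q <> 0 ->
  qprod y q k = y ^ k * qsign q k * qprod (q / (y * q ^ k)) q k.
Proof.
intros hy hq. induction k as [|k IH]; [simpl; ring|].
rewrite qprod_S, IH, qprod_head. cbn [qsign Cpow].
assert (hk := Cpow_nz q k hq).
replace (q / (y * (q * q ^ k)) * q) with (q / (y * q ^ k)) by (field; auto).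
field. auto.
Qed.

Lemma one_minus_pow_pos (q : C) (n : nat) : (Cmod q < 1)%R -> q ^ S n <> 1.
Proof.
intros hq e. assert (h : Cmod (q ^ S n) = 1%R) by (rewrite e; apply Cmod_1).
rewrite Cmod_pow in h. assert (hp := Cmod_ge_0 q).
assert (Cmod q ^ S n < 1)%R.
{ apply (Rle_lt_trans _ (Cmod q)); [|exact hq]. simpl.
  assert (Cmod q ^ n <= 1)%R.
  { replace 1%R with (1 ^ n)%R by apply pow1. apply pow_incr. lra. }
  assert (0 <= Cmod q ^ n)%R by now apply pow_le. nra. }
lra.
Qed.

Lemma qprod_q_neq0 (q : C) (n : nat) : (Cmod q < 1)%R -> qprod q q n <> 0.
Proof.
intros hq. apply qprod_neq0. intros k _. exact (one_minus_pow_pos q k hq).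
Qed.

(** * Uniform bounds for q-shifted factorials and continuity in the base point *)

Definition qbnd (q : C) (A : R) : R := exp (A / (1 - Cmod q)).

Lemma qbnd_pos (q : C) (A : R) : (0 < qbnd q A)%R.
Proof. apply exp_pos. Qed.

Lemma qprod_upper (q x : C) (A : R) (n : nat) : (Cmod q < 1)%R ->
  (Cmod x <= A)%R -> (Cmod (qprod x q n) <= qbnd q A)%R.
Proof.
intros hq hx. eapply Rle_trans; [now apply Cmod_qprod_le|].
unfold qbnd. assert (Cmod x / (1 - Cmod q) <= A / (1 - Cmod q))%R.
{ unfold Rdiv. apply Rmult_le_compat_r; [|exact hx].
  left. apply Rinv_0_lt_compat. lra. }
destruct H as [h|h]; [left; now apply exp_increasing|rewrite h; lra].
Qed.

(** The inequality prod (1 - t_j) >= 1 - sum t_j with t_j = |x| |q|^j, whose sum is at most 1/2. *)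
Lemma qprod_tail_lower (q x : C) (n : nat) : (Cmod q < 1)%R ->
  (Cmod x / (1 - Cmod q) <= 1 / 2)%R -> (1 / 2 <= Cmod (qprod x q n))%R.
Proof.
intros hq hx.
assert (hpq := Cmod_ge_0 q). assert (hpx := Cmod_ge_0 x).
assert (hi : (0 < / (1 - Cmod q))%R) by (apply Rinv_0_lt_compat; lra).
assert (hx1 : (Cmod x <= 1 / 2)%R).
{ apply (Rmult_le_compat_r (1 - Cmod q)) in hx; [|lra].
  unfold Rdiv in hx at 1. rewrite Rmult_assoc, Rinv_l in hx by lra. nra. }
assert (h : (1 - Cmod x * ((1 - Cmod q ^ n) / (1 - Cmod q)) <= Cmod (qprod x q n))%R).
{ induction n as [|n IH]; cbn [qprod].
  - rewrite Cmod_1. simpl. unfold Rdiv. rewrite Rminus_diag, Rmult_0_l. lra.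
  - rewrite Cmod_mult.
    assert (h1 : (1 - Cmod x * Cmod q ^ n <= Cmod (1 - x * q ^ n))%R).
    { assert (h := Cmod_triangle (1 - x * q ^ n) (x * q ^ n)).
      replace (1 - x * q ^ n + x * q ^ n) with (RtoC 1) in h by ring.
      rewrite Cmod_1, Cmod_mult, Cmod_pow in h. lra. }
    assert (h0 : (0 <= Cmod q ^ n <= 1)%R).
    { split; [now apply pow_le|].
      replace 1%R with (1 ^ n)%R by apply pow1. apply pow_incr. lra. }
    set (u := (Cmod q ^ n)%R) in *. change (Cmod q ^ S n)%R with (Cmod q * u)%R.
    replace (Cmod x * ((1 - Cmod q * u) / (1 - Cmod q)))%R
      with (Cmod x * ((1 - u) / (1 - Cmod q)) + Cmod x * u)%R by (field; lra).
    assert (h2 : (0 <= Cmod x * ((1 - u) / (1 - Cmod q)) <= 1 / 2)%R).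
    { split.
      - apply Rmult_le_pos; [exact hpx|]. unfold Rdiv. nra.
      - eapply Rle_trans; [|exact hx]. unfold Rdiv.
        apply Rmult_le_compat_l; [exact hpx|]. nra. }
    assert (0 <= Cmod x * u <= 1 / 2)%R by nra.
    eapply Rle_trans; [|apply Rmult_le_compat; [| |exact IH|exact h1]]; nra. }
eapply Rle_trans; [|exact h].
assert (Cmod x * ((1 - Cmod q ^ n) / (1 - Cmod q)) <= Cmod x / (1 - Cmod q))%R.
{ unfold Rdiv. apply Rmult_le_compat_l; [exact hpx|].
  assert (0 <= Cmod q ^ n)%R by now apply pow_le. nra. }
lra.
Qed.

Lemma cvgC_qprod (q : C) (u : nat -> C) (x : C) (k : nat) :
  cvgC u x -> cvgC (fun n => qprod (u n) q k) (qprod x q k).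
Proof.
intros h. induction k as [|k IH]; simpl; [apply cvgC_const|].
apply cvgC_mult; [exact IH|]. apply cvgC_minus; [apply cvgC_const|].
apply cvgC_mult; [exact h|apply cvgC_const].
Qed.

(** A lower bound uniform in the length k as well as in n, which is what dominated convergence needs
    for denominators. Beyond a fixed index K the factors contribute at least 1/2; the first K
    factors converge to a nonzero product. *)
Lemma qprod_lower_cvg (q : C) (u : nat -> C) (y : C) : (Cmod q < 1)%R ->
  cvgC u y -> (forall k, qprod y q k <> 0) ->
  exists m N, (0 < m)%R /\
    forall n k, (N <= n)%nat -> (m <= Cmod (qprod (u n) q k))%R.
Proof.
intros hq hu hy.
assert (hpq := Cmod_ge_0 q). assert (hpy := Cmod_ge_0 y).
set (A := (Cmod y + 1)%R).
(* From [K] on, A |q|^K/(1 - |q|) <= 1/2, the hypothesis of [qprod_tail_lower]. *)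
destruct (pow_lt_1_zero (Cmod q)) with (y := ((1 - Cmod q) / (2 * A))%R) as [K HK].
{ rewrite Rabs_pos_eq; lra. }
{ apply Rdiv_lt_0_compat; unfold A; lra. }
specialize (HK K (le_n K)). rewrite Rabs_pos_eq in HK by now apply pow_le.
assert (hyK : (0 < Cmod (qprod y q K))%R) by now apply Cmod_gt_0.
destruct (cvgC_bounded u y hu) as [N1 H1].
destruct (cvgC_qprod q u y K hu (Cmod (qprod y q K) / 2)%R) as [N2 H2]; [lra|].
set (E := qbnd q A). assert (hE : (0 < E)%R) by apply qbnd_pos.
set (L := (Cmod (qprod y q K) / 2)%R) in *.
(* L/2 serves k >= K. For k < K the product of length K is at least L and the missing factors have
   modulus at most E, which gives L/E. *)
exists (Rmin (L / 2) (L / E)), (Nat.max N1 N2). split.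
{ apply Rmin_pos; apply Rdiv_lt_0_compat; unfold L; lra. }
intros n k hn. specialize (H1 n ltac:(lia)). specialize (H2 n ltac:(lia)).
assert (hL : (L <= Cmod (qprod (u n) q K))%R).
{ assert (h := Cmod_triangle (qprod (u n) q K) (- (qprod (u n) q K - qprod y q K))).
  rewrite Cmod_opp in h.
  replace (qprod (u n) q K + - (qprod (u n) q K - qprod y q K)) with (qprod y q K) in h by ring.
  unfold L in *. lra. }
assert (L0 : (0 < L)%R) by (unfold L; lra).
destruct (le_lt_dec K k) as [hk|hk].
- eapply Rle_trans; [apply Rmin_l|].
  replace k with (K + (k - K))%nat by lia. rewrite qprod_add, Cmod_mult.
  assert (ht : (1 / 2 <= Cmod (qprod (u n * q ^ K) q (k - K)))%R).
  { apply qprod_tail_lower; [exact hq|]. rewrite Cmod_mult, Cmod_pow.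
    assert (h0 : (0 <= Cmod q ^ K)%R) by now apply pow_le.
    apply (Rmult_le_reg_r (1 - Cmod q)); [lra|].
    unfold Rdiv at 1. rewrite Rmult_assoc, Rinv_l by lra. rewrite Rmult_1_r.
    apply (Rle_trans _ (A * ((1 - Cmod q) / (2 * A)))).
    - apply Rmult_le_compat; try apply Cmod_ge_0; try assumption. lra.
    - right. field. unfold A. lra. }
  apply (Rle_trans _ (L * (1 / 2))); [lra|].
  apply Rmult_le_compat; lra.
- eapply Rle_trans; [apply Rmin_r|].
  assert (hs : (Cmod (qprod (u n) q K) <= Cmod (qprod (u n) q k) * E)%R).
  { replace K with (k + (K - k))%nat at 1 by lia. rewrite qprod_add, Cmod_mult.
    apply Rmult_le_compat_l; [apply Cmod_ge_0|].
    apply qprod_upper; [exact hq|]. rewrite Cmod_mult, Cmod_pow.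
    assert (Cmod q ^ k <= 1)%R.
    { replace 1%R with (1 ^ k)%R by apply pow1. apply pow_incr. lra. }
    assert (0 <= Cmod q ^ k)%R by now apply pow_le.
    assert (hu0 := Cmod_ge_0 (u n)). fold A in H1. nra. }
  apply (Rmult_le_reg_r E); [exact hE|].
  unfold Rdiv. rewrite Rmult_assoc, Rinv_l by lra. lra.
Qed.

Lemma qprod_lower (q y : C) : (Cmod q < 1)%R -> (forall k, qprod y q k <> 0) ->
  exists m, (0 < m)%R /\ forall k, (m <= Cmod (qprod y q k))%R.
Proof.
intros hq hy.
destruct (qprod_lower_cvg q (fun _ => y) y hq (cvgC_const y) hy) as (m & N & hm & h).
exists m. split; [exact hm|]. intros k. exact (h N k (le_n N)).
Qed.

Lemma cvgC_qpoch_inf (x q : C) : (Cmod q < 1)%R -> cvgC (qprod x q) (qpoch_inf x q).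
Proof. intros hq. apply cvgC_filterlim. now apply qpoch_inf_correct. Qed.

Lemma qpoch_inf_neq0 (x q : C) : (Cmod q < 1)%R ->
  (forall k, qprod x q k <> 0) -> qpoch_inf x q <> 0.
Proof.
intros hq h e. destruct (qprod_lower q x hq h) as (m & hm & hl).
destruct (cvgC_qpoch_inf x q hq m hm) as [N HN].
specialize (HN N (le_n N)). specialize (hl N).
rewrite e in HN. replace (qprod x q N - 0) with (qprod x q N) in HN by ring. lra.
Qed.

Lemma qpoch_inf_head (x q : C) : (Cmod q < 1)%R ->
  qpoch_inf x q = (1 - x) * qpoch_inf (x * q) q.
Proof.
intros hq. rewrite (qpoch_inf_split x q 1 hq). simpl.
replace (x * (q * 1)) with (x * q) by ring. ring.
Qed.

(** The differences of successive partial products telescope. As a series, the infinite product is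
    accessible to [tannery], which gives its continuity in x. *)
Lemma qpoch_inf_series (x q : C) : (Cmod q < 1)%R ->
  qpoch_inf x q = 1 - Cseries (fun k => qprod x q k * (x * q ^ k)).
Proof.
intros hq.
replace (Cseries (fun k => qprod x q k * (x * q ^ k))) with (1 - qpoch_inf x q); [ring|].
symmetry. apply Cseries_eq.
apply (cvgC_ext (fun n => 1 - qprod x q n)).
- intros n. induction n as [|n IH]; simpl; [ring|]. rewrite <- IH. ring.
- apply cvgC_minus; [apply cvgC_const|now apply cvgC_qpoch_inf].
Qed.

Lemma cvgC_qpoch_inf_cont (q : C) (u : nat -> C) (x : C) : (Cmod q < 1)%R ->
  cvgC u x -> cvgC (fun n => qpoch_inf (u n) q) (qpoch_inf x q).
Proof.
intros hq hu. rewrite (qpoch_inf_series x q hq).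
apply (cvgC_ext (fun n => 1 - Cseries (fun k => qprod (u n) q k * (u n * q ^ k)))).
{ intros n. symmetry. now apply qpoch_inf_series. }
apply cvgC_minus; [apply cvgC_const|].
destruct (cvgC_bounded u x hu) as [N HN].
refine (proj2 (tannery _ _ (qbnd q (Cmod x + 1) * (Cmod x + 1)) (Cmod q) N _ _ _)).
- split; [apply Cmod_ge_0|exact hq].
- intros n k hn. rewrite !Cmod_mult, Cmod_pow, <- Rmult_assoc.
  apply Rmult_le_compat_r; [apply pow_le, Cmod_ge_0|].
  apply Rmult_le_compat; try apply Cmod_ge_0; [|now apply HN].
  apply qprod_upper; [exact hq|now apply HN].
- intros k. apply cvgC_mult; [now apply cvgC_qprod|].
  apply cvgC_mult; [exact hu|apply cvgC_const].
Qed.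

(** * Nonvanishing conditions and tactics for them *)

Definition qreg (x q : C) : Prop := forall k, qprod x q k <> 0.

(** For nonzero q: x is no integer power of q of either sign, expressed with natural exponents only.
    Unlike [qreg], this is stable under inversion and under multiplication by powers of q. *)
Definition qsep (q x : C) : Prop := forall j k, x * q ^ j <> q ^ k.

Lemma qsep_reg (q x : C) : qsep q x -> qreg x q.
Proof. intros h k. apply qprod_neq0. intros j _. exact (h j 0%nat). Qed.

Ltac qneq0 := match goal with
  | |- qprod ?q ?q _ <> _ => apply qprod_q_neq0; assumption
  | h : qreg ?x ?q |- qprod ?x ?q _ <> _ => apply h
  | h : qsep ?q ?x |- qprod ?x ?q _ <> _ => apply (qsep_reg _ _ h)
  | |- qpoch_inf ?x ?q <> _ => apply qpoch_inf_neq0; [assumption | intros ?; qneq0]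
  end.

Ltac neq0 := repeat first
  [assumption | qneq0 | exact C1_nz | apply Cpow_nz | apply neq0_div | apply Cmult_neq_0].

Ltac unlet := repeat match goal with v := _ |- _ => subst v end; subst.

Ltac nz := solve [neq0 | unlet; neq0].

Ltac cfield := field; repeat split; neq0.

Ltac cast H x y := replace x with y in H by (unlet; cfield).

(** * Jackson's sum and Bailey's transformation *)

Lemma qreg_factor (x q : C) (k : nat) : qreg x q -> 1 - x * q ^ k <> 0.
Proof. intros h e. apply (h (S k)). simpl. rewrite e. ring. Qed.

Lemma qreg_shift (x q : C) (m : nat) : qreg x q -> qreg (x * q ^ m) q.
Proof. intros h k. now apply qprod_shift_neq0. Qed.

(** Kernel of a well-poised Bailey pair relative to [(a, K)]; truncated
    subtraction makes it meaningful only for [r <= n]. *)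
Definition wpker (a K q : C) (n r : nat) : C :=
  qprod (K / a) q (n - r) * qprod K q (n + r) /
  (qprod q q (n - r) * qprod (q * a) q (n + r)).

(** Coefficient of a very-well-poised series in base a with three free parameters; the argument is
    kept apart. *)
Definition wp3 (a b c d q : C) (r : nat) : C :=
  (1 - a * q ^ (2 * r)) / (1 - a) *
  (qprod a q r * qprod b q r * qprod c q r * qprod d q r /
   (qprod q q r * qprod (q * a / b) q r * qprod (q * a / c) q r * qprod (q * a / d) q r)).

(** The certificate of a telescoping proof of Jackson's sum, divided by the summand, with R = q^r
    and M = q^(n-r). The two terms on the right become [Gp] and [Gm] below. *)
Lemma jackson_rational (a b c d K q R M : C) :
  a <> 0 -> b <> 0 -> c <> 0 -> d <> 0 -> R <> 0 ->
  K = a * a * q / (b * c * d) ->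
  1 - a * R * R <> 0 -> 1 - q * M <> 0 -> 1 - a * q * R * R * M <> 0 ->
  (1 - q * (R * M)) * (1 - a * q * (R * M) / b) * (1 - a * q * (R * M) / c) * (1 - a * q * (R * M) / d) *
    ((1 - K * M / a) * (1 - K * (R * R * M)) / ((1 - q * M) * (1 - a * q * R * R * M))) -
  (1 - K * (R * M)) * (1 - K * b * (R * M) / a) * (1 - K * c * (R * M) / a) * (1 - K * d * (R * M) / a) =
  - M * (1 - K * q * (R * M) * (R * M)) / (1 - a * R * R) *
  ((K / a) * (1 - a * R) * (1 - b * R) * (1 - c * R) * (1 - d * R) * (1 - K * (R * R * M)) / (1 - a * q * R * R * M)
  - q * (1 - R) * (1 - a * R / b) * (1 - a * R / c) * (1 - a * R / d) * (1 - K * M / a) / (1 - q * M)).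
Proof.
intros ha hb hc hd hR -> h1 h2 h3.
field.
repeat split; assumption.
Qed.

Lemma sub_neq0_of_div (x y t : C) : x <> 0 -> 1 - y / x * t <> 0 -> x - y * t <> 0.
Proof.
intros hx h e. apply h.
replace (1 - y / x * t) with ((x - y * t) * / x) by (field; exact hx).
rewrite e. ring.
Qed.

(** Up to a factor free of r, [wpker] carries the parameters q^-n and K q^n of Jackson's 8phi7, and
    K = a^2 q/(bcd) is its balancing condition. Creative telescoping gives a first order recurrence
    in n for the sum. *)
Lemma jackson_sum (q a b c d K : C) (n : nat) :
  q <> 0 -> a <> 0 -> b <> 0 -> c <> 0 -> d <> 0 ->
  K = a * a * q / (b * c * d) ->
  qreg q q -> qreg a q -> qreg (q * a / b) q -> qreg (q * a / c) q -> qreg (q * a / d) q ->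
  sumC (fun r => wpker a K q n r * (wp3 a b c d q r * (K / a) ^ r)) (S n) =
  qprod K q n * qprod (K * b / a) q n * qprod (K * c / a) q n * qprod (K * d / a) q n /
  (qprod q q n * qprod (q * a / b) q n * qprod (q * a / c) q n * qprod (q * a / d) q n).
Proof.
intros hq ha hb hc hd hK rq ra rb rc rd.
assert (raq : qreg (q * a) q).
{ replace (q * a) with (a * q ^ 1) by (simpl; ring). now apply qreg_shift. }
assert (ra0 : 1 - a <> 0).
{ assert (h := qreg_factor a q 0 ra). simpl in h. now rewrite Cmult_1_r in h. }
assert (f1 : forall k, 1 - q ^ S k <> 0) by (intros k; exact (qreg_factor q q k rq)).
assert (f2 : forall k, 1 - q * a * q ^ k <> 0) by (intros k; now apply qreg_factor).
assert (f2' : forall k, 1 - a * q ^ k <> 0) by (intros k; now apply qreg_factor).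
assert (f3 : forall k, 1 - q * a / b * q ^ k <> 0) by (intros k; now apply qreg_factor).
assert (f4 : forall k, 1 - q * a / c * q ^ k <> 0) by (intros k; now apply qreg_factor).
assert (f5 : forall k, 1 - q * a / d * q ^ k <> 0) by (intros k; now apply qreg_factor).
assert (fq := fun k => Cpow_nz q k hq).
pose (W r := wp3 a b c d q r * (K / a) ^ r).
pose (T n r := wpker a K q n r * W r).
pose (Q k := q ^ k).
(* The quotient Nn/Dn is the ratio of consecutive values of the closed form. *)
pose (Nn n := (1 - K * Q n) * (1 - K * b * Q n / a) * (1 - K * c * Q n / a) * (1 - K * d * Q n / a)).
pose (Dn n := (1 - q * Q n) * (1 - a * q * Q n / b) * (1 - a * q * Q n / c) * (1 - a * q * Q n / d)).
(* The two halves of the certificate. For r + 1 <= n, [Gp] at r equals [Gm] at r + 1 ([tele]), so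
   the differences in [step] cancel in pairs. *)
pose (Gp n r := T n r * (- (Q n / Q r) * (1 - K * q * Q n * Q n) / (1 - a * Q r * Q r) *
   ((K / a) * (1 - a * Q r) * (1 - b * Q r) * (1 - c * Q r) * (1 - d * Q r) * (1 - K * (Q n * Q r)) /
     (1 - a * q * Q n * Q r)))).
pose (Gm n r := T n r * (- (Q n / Q r) * (1 - K * q * Q n * Q n) / (1 - a * Q r * Q r) *
   (q * (1 - Q r) * (1 - a * Q r / b) * (1 - a * Q r / c) * (1 - a * Q r / d) * (1 - K * (Q n / Q r) / a) /
     (1 - q * (Q n / Q r))))).
assert (hdec : forall r m, Q (r + m)%nat = Q r * Q m) by (intros; unfold Q; apply Cpow_add_r).
assert (hQ0 : forall r, Q r <> 0) by (intros; unfold Q; apply fq).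
assert (hQdiv : forall r m, Q (r + m)%nat / Q r = Q m).
{ intros. rewrite hdec. field. apply hQ0. }
assert (step : forall r m, Dn (r + m)%nat * T (S (r + m)) r - Nn (r + m)%nat * T (r + m)%nat r =
                Gp (r + m)%nat r - Gm (r + m)%nat r).
{ intros r m. unfold Gp, Gm. rewrite hQdiv.
  assert (hT : T (S (r + m)) r = T (r + m)%nat r *
     ((1 - K * Q m / a) * (1 - K * (Q r * Q r * Q m)) / ((1 - q * Q m) * (1 - a * q * Q r * Q r * Q m)))).
  { unfold T, wpker.
    replace (S (r + m) - r)%nat with (S m) by lia.
    replace (r + m - r)%nat with m by lia.
    replace (S (r + m) + r)%nat with (S (r + m + r)) by lia.
    rewrite !qprod_S. fold (Q m) (Q (r + m + r)%nat). rewrite !hdec.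
    assert (e2 : q * a * (Q r * Q m * Q r) = q * a * q ^ (r + m + r))
      by (fold (Q (r + m + r)%nat); rewrite !hdec; ring).
    assert (h2 := f2 (r + m + r)%nat). rewrite <- e2 in h2.
    field. repeat split; auto.
    - intros e. apply h2. rewrite <- e. ring.
    - exact (f1 m). }
  rewrite hT, hdec. unfold Dn, Nn. rewrite hdec.
  assert (h := jackson_rational a b c d K q (Q r) (Q m) ha hb hc hd (hQ0 r) hK).
  assert (h1 : 1 - a * Q r * Q r <> 0).
  { replace (a * Q r * Q r) with (a * q ^ (r + r)); [apply f2'|].
    fold (Q (r + r)%nat). rewrite hdec. ring. }
  assert (h2 : 1 - q * Q m <> 0) by exact (f1 m).
  assert (h3 : 1 - a * q * Q r * Q r * Q m <> 0).
  { replace (a * q * Q r * Q r * Q m) with (q * a * q ^ (r + m + r)); [apply f2|].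
    fold (Q (r + m + r)%nat). rewrite !hdec. ring. }
  specialize (h h1 h2 h3).
  match type of h with ?l = ?r0 =>
    transitivity (T (r + m)%nat r * l); [ring|rewrite h] end.
  field. repeat split; auto.
  intros e; apply h3; rewrite <- e; ring. }
assert (hW : forall r, W (S r) = W r * ((1 - a * q * q * Q r * Q r) / (1 - a * Q r * Q r) *
    ((1 - a * Q r) * (1 - b * Q r) * (1 - c * Q r) * (1 - d * Q r) /
     ((1 - q * Q r) * (1 - q * a / b * Q r) * (1 - q * a / c * Q r) * (1 - q * a / d * Q r))) * (K / a))).
{ intros r. unfold W, wp3. rewrite !qprod_S. fold (Q r).
  replace (q ^ (2 * S r)) with (q * q * Q r * Q r)
    by (replace (2 * S r)%nat with (2 + (r + r))%nat by lia; rewrite Cpow_add_r; fold (Q (r + r)%nat); rewrite hdec; simpl; ring).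
  replace (q ^ (2 * r)) with (Q r * Q r)
    by (replace (2 * r)%nat with (r + r)%nat by lia; symmetry; apply hdec).
  assert (h1 : 1 - a * (Q r * Q r) <> 0) by (rewrite <- hdec; apply f2').
  assert (k1 := f1 r). change (q ^ S r) with (q * Q r) in k1.
  assert (k2 := f3 r). assert (k3 := f4 r). assert (k4 := f5 r). fold (Q r) in k2, k3, k4.
  change ((K / a) ^ S r) with (K / a * (K / a) ^ r).
  assert (k2' := sub_neq0_of_div _ _ _ hb k2). assert (k3' := sub_neq0_of_div _ _ _ hc k3).
  assert (k4' := sub_neq0_of_div _ _ _ hd k4).
  field. repeat split; auto; intros e; apply h1; rewrite <- e; ring. }
assert (hm1 : forall r, 1 - a * Q r * Q r <> 0).
{ intros r. replace (a * Q r * Q r) with (a * q ^ (r + r)); [apply f2'|].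
  fold (Q (r + r)%nat). rewrite hdec. ring. }
assert (hS : forall m, Q (S m) = q * Q m) by reflexivity.
assert (tele : forall r m, Gm (r + S m)%nat (S r) = Gp (r + S m)%nat r).
{ intros r m. unfold Gm, Gp.
  replace (Q (r + S m)%nat / Q (S r)) with (Q m)
    by (replace (r + S m)%nat with (S r + m)%nat by lia; symmetry; apply hQdiv).
  replace (Q (r + S m)%nat / Q r) with (Q (S m)) by (symmetry; apply hQdiv).
  unfold T. rewrite hW. unfold wpker.
  replace (r + S m - r)%nat with (S m) by lia.
  replace (r + S m - S r)%nat with m by lia.
  replace (r + S m + S r)%nat with (S (r + S m + r)) by lia.
  rewrite !qprod_S. fold (Q m) (Q (r + S m + r)%nat).
  replace (Q (r + S m + r)%nat) with (q * Q m * Q r * Q r)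
    by (rewrite !hdec, hS; ring).
  replace (Q (r + S m)%nat) with (q * Q m * Q r)
    by (rewrite !hdec, hS; ring).
  change (Q (S m)) with (q * Q m). change (Q (S r)) with (q * Q r).
  assert (k1 := f1 m). change (q ^ S m) with (q * Q m) in k1.
  assert (k1r := f1 r). change (q ^ S r) with (q * Q r) in k1r.
  assert (k2 := f2 (r + S m + r)%nat).
  replace (q ^ (r + S m + r)) with (q * Q m * Q r * Q r) in k2
    by (fold (Q (r + S m + r)%nat); rewrite !hdec, hS; ring).
  assert (k3 := hm1 r). assert (k4 := hm1 (S r)). change (Q (S r)) with (q * Q r) in k4.
  assert (b1 := sub_neq0_of_div _ _ _ hb (f3 r)). assert (b2 := sub_neq0_of_div _ _ _ hc (f4 r)).
  assert (b3 := sub_neq0_of_div _ _ _ hd (f5 r)). fold (Q r) in b1, b2, b3.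
  field. repeat split; auto; intros e.
  all: try (apply k3; rewrite <- e; ring).
  all: try (apply k4; rewrite <- e; ring).
  all: try (apply k2; rewrite <- e; ring). }
(* Row n + 1 has one term more than row n; it cancels what the telescoping leaves at the upper
   end. *)
assert (last : forall r, Gp r r + Dn r * T (S r) (S r) = 0).
{ intros r. unfold Gp, Dn, T. rewrite hW. unfold wpker.
  replace (r - r)%nat with 0%nat by lia. replace (S r - S r)%nat with 0%nat by lia.
  replace (S r + S r)%nat with (S (S (r + r))) by lia.
  rewrite !qprod_S. fold (Q (r + r)%nat) (Q (S (r + r))). rewrite hS, hdec.
  change (qprod (K / a) q 0) with (RtoC 1). change (qprod q q 0) with (RtoC 1).
  assert (k2 := f2 (r + r)%nat). fold (Q (r + r)%nat) in k2. rewrite hdec in k2.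
  assert (k2' := f2 (S (r + r))). fold (Q (S (r + r))) in k2'. rewrite hS, hdec in k2'.
  assert (k1r := f1 r). fold (Q (S r)) in k1r. rewrite hS in k1r.
  assert (k3 := hm1 r).
  assert (b1 := sub_neq0_of_div _ _ _ hb (f3 r)). assert (b2 := sub_neq0_of_div _ _ _ hc (f4 r)).
  assert (b3 := sub_neq0_of_div _ _ _ hd (f5 r)). fold (Q r) in b1, b2, b3.
  assert (hQr := hQ0 r).
  field. repeat split; auto; intros e.
  all: try (apply k3; rewrite <- e; ring).
  all: try (apply k2; rewrite <- e; ring).
  all: try (apply k2'; rewrite <- e; ring). }
(* At the lower end nothing remains: [Gm] at 0 contains the factor 1 - q^0. *)
assert (part : forall r m, sumC (fun j => Dn (r + m)%nat * T (S (r + m)) j - Nn (r + m)%nat * T (r + m)%nat j) (S r)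
                 = Gp (r + m)%nat r).
{ induction r as [|r IH]; intros m.
  - rewrite sumC_S, step. unfold Gm. change (Q 0%nat) with (RtoC 1).
    change (sumC (fun j => Dn (0 + m)%nat * T (S (0 + m)) j - Nn (0 + m)%nat * T (0 + m)%nat j) 0) with (RtoC 0). unfold Cdiv. ring.
  - rewrite sumC_S. rewrite step.
    replace (S r + m)%nat with (r + S m)%nat by lia. rewrite IH, tele. ring. }
assert (rec : forall n, Dn n * sumC (T (S n)) (S (S n)) = Nn n * sumC (T n) (S n)).
{ intros n0. rewrite (sumC_S (T (S n0)) (S n0)).
  assert (h := part n0 0%nat). rewrite Nat.add_0_r in h.
  rewrite (sumC_ext _ (fun j => Dn n0 * T (S n0) j + - Nn n0 * T n0 j)) in h by (intros; ring).
  rewrite sumC_plus, !sumC_scal in h.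
  replace (Dn n0 * (sumC (T (S n0)) (S n0) + T (S n0) (S n0)))
    with (Dn n0 * sumC (T (S n0)) (S n0) + - Nn n0 * sumC (T n0) (S n0) +
          Nn n0 * sumC (T n0) (S n0) + Dn n0 * T (S n0) (S n0)) by ring.
  rewrite h. replace (Gp n0 n0) with (- (Dn n0 * T (S n0) (S n0))); [ring|].
  assert (h1 := last n0).
  replace (Gp n0 n0) with (Gp n0 n0 + Dn n0 * T (S n0) (S n0) - Dn n0 * T (S n0) (S n0)) by ring.
  rewrite h1. ring. }
change (sumC (T n) (S n) = qprod K q n * qprod (K * b / a) q n * qprod (K * c / a) q n * qprod (K * d / a) q n /
  (qprod q q n * qprod (q * a / b) q n * qprod (q * a / c) q n * qprod (q * a / d) q n)).
induction n as [|n IH].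
- simpl. unfold T, W, wpker, wp3. simpl. field. auto.
- rewrite !qprod_S. fold (Q n).
  assert (k1 := f1 n). change (q ^ S n) with (q * Q n) in k1.
  assert (b1 := sub_neq0_of_div _ _ _ hb (f3 n)). assert (b2 := sub_neq0_of_div _ _ _ hc (f4 n)).
  assert (b3 := sub_neq0_of_div _ _ _ hd (f5 n)). fold (Q n) in b1, b2, b3.
  assert (hD : Dn n <> 0).
  { unfold Dn. repeat apply Cmult_neq_0; [exact k1| | |].
    - intros e. apply (f3 n). rewrite <- e. fold (Q n). field. exact hb.
    - intros e. apply (f4 n). rewrite <- e. fold (Q n). field. exact hc.
    - intros e. apply (f5 n). rewrite <- e. fold (Q n). field. exact hd. }
  replace (sumC (T (S n)) (S (S n))) with (Nn n / Dn n * sumC (T n) (S n)).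
  + rewrite IH. unfold Nn, Dn.
    field. repeat split; auto.
  + transitivity (/ Dn n * (Nn n * sumC (T n) (S n))); [field; exact hD|].
    rewrite <- rec. field. exact hD.
Qed.

(** * The well-poised Bailey lemma *)

(** The coefficient of [al k] after the sums in [wp_bailey] have been exchanged. It is again a
    Jackson sum, in base c q^(2k). *)
Lemma wp_bailey_inner (q a c r1 r2 K : C) (k m : nat) :
  q <> 0 -> a <> 0 -> c <> 0 -> r1 <> 0 -> r2 <> 0 ->
  K = c * a * q / (r1 * r2) ->
  qreg q q -> qreg a q -> qreg c q -> qreg (q * a / r1) q -> qreg (q * a / r2) q ->
  qreg (K * r1 / a) q -> qreg (K * r2 / a) q ->
  sumC (fun i =>
    (1 - c * q ^ (2 * (k + i))) / (1 - c) *
    (qprod r1 q (k + i) * qprod r2 q (k + i) /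
     (qprod (K * r1 / a) q (k + i) * qprod (K * r2 / a) q (k + i))) *
    wpker c K q (k + m) (k + i) * (K / c) ^ (k + i) * wpker a c q (k + i) k) (S m) =
  qprod (q * a / r1) q (k + m) * qprod (q * a / r2) q (k + m) /
  (qprod (K * r1 / a) q (k + m) * qprod (K * r2 / a) q (k + m)) *
  (wpker a K q (k + m) k *
   (qprod r1 q k * qprod r2 q k / (qprod (q * a / r1) q k * qprod (q * a / r2) q k) * (K / c) ^ k)).
Proof.
intros hq ha hc h1 h2 hK rq ra rc r1a r2a rk1 rk2.
assert (hqk := Cpow_nz q k hq).
assert (raq : qreg (q * a) q).
{ replace (q * a) with (a * q ^ 1) by (simpl; ring). now apply qreg_shift. }
assert (rcq : qreg (q * c) q).
{ replace (q * c) with (c * q ^ 1) by (simpl; ring). now apply qreg_shift. }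
assert (c0 : 1 - c <> 0).
{ assert (h := qreg_factor c q 0 rc). simpl in h. now rewrite Cmult_1_r in h. }
assert (e2k : q ^ (2 * k) = q ^ k * q ^ k).
{ rewrite <- Cpow_add_r. f_equal. lia. }
assert (ea1 : q * (c * q ^ (2 * k)) / (r1 * q ^ k) = K * r2 / a * q ^ k)
  by (rewrite hK, e2k; field; auto).
assert (ea2 : q * (c * q ^ (2 * k)) / (r2 * q ^ k) = K * r1 / a * q ^ k)
  by (rewrite hK, e2k; field; auto).
assert (ea3 : q * (c * q ^ (2 * k)) / (c / a) = q * a * q ^ (2 * k))
  by (rewrite e2k; field; auto).
(* The third parameter c/a makes the second kernel [wpker a c] part of the well-poised term. *)
assert (J := jackson_sum q (c * q ^ (2 * k)) (r1 * q ^ k) (r2 * q ^ k) (c / a) (K * q ^ (2 * k)) m hq).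
assert (h2k : q ^ (2 * k) <> 0) by now apply Cpow_nz.
assert (hca : c / a <> 0).
{ intros e. apply hc. replace c with (c / a * a) by (field; exact ha). rewrite e. ring. }
specialize (J (Cmult_neq_0 _ _ hc h2k) (Cmult_neq_0 _ _ h1 hqk) (Cmult_neq_0 _ _ h2 hqk) hca).
rewrite ea1, ea2, ea3 in J.
assert (hKJ : K * q ^ (2 * k) = c * q ^ (2 * k) * (c * q ^ (2 * k)) * q / (r1 * q ^ k * (r2 * q ^ k) * (c / a))).
{ rewrite hK, e2k. cfield. }
specialize (J hKJ rq (qreg_shift _ _ _ rc)
   (qreg_shift _ _ _ rk2) (qreg_shift _ _ _ rk1) (qreg_shift _ _ _ raq)).
replace (K * q ^ (2 * k) * (r1 * q ^ k) / (c * q ^ (2 * k))) with (q * a / r2 * q ^ k) in J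
  by (rewrite hK; field; auto).
replace (K * q ^ (2 * k) * (r2 * q ^ k) / (c * q ^ (2 * k))) with (q * a / r1 * q ^ k) in J
  by (rewrite hK; field; auto).
replace (K * q ^ (2 * k) * (c / a) / (c * q ^ (2 * k))) with (K / a) in J by (field; auto).
replace (K * q ^ (2 * k) / (c * q ^ (2 * k))) with (K / c) in J by (field; auto).
(* All that does not depend on the summation index i. *)
set (cf := qprod r1 q k * qprod r2 q k / (qprod (K * r1 / a) q k * qprod (K * r2 / a) q k) *
   (qprod K q (2 * k) / qprod (q * c) q (2 * k)) * (K / c) ^ k *
   (qprod c q (2 * k) / qprod (q * a) q (2 * k)) * ((1 - c * q ^ (2 * k)) / (1 - c))).
assert (f1 := qreg_factor c q (2 * k) rc).
rewrite (sumC_ext _ (fun i => cf * (wpker (c * q ^ (2 * k)) (K * q ^ (2 * k)) q m i *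
     (wp3 (c * q ^ (2 * k)) (r1 * q ^ k) (r2 * q ^ k) (c / a) q i * (K / c) ^ i)))).
- rewrite sumC_scal, J. unfold cf, wpker.
  replace (k + m - k)%nat with m by lia.
  replace (k + m + k)%nat with (2 * k + m)%nat by lia.
  rewrite !qprod_add.
  assert (g1 := rk1 k). assert (g2 := rk2 k). assert (g3 := r1a k). assert (g4 := r2a k).
  assert (g5 := rcq (2 * k)%nat). assert (g6 := raq (2 * k)%nat).
  assert (g7 := rq m). assert (g8 := qreg_shift _ _ k rk1 m). assert (g9 := qreg_shift _ _ k rk2 m).
  assert (g10 := qreg_shift _ _ (2 * k) raq m).
  assert (g11 : qprod c q (2 * k) * (1 - c * q ^ (2 * k)) = (1 - c) * qprod (q * c) q (2 * k)).
  { rewrite <- qprod_S, qprod_head. now rewrite (Cmult_comm c q). }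
  set (X1 := qprod (K * r1 / a) q k) in *. set (X2 := qprod (K * r2 / a) q k) in *.
  set (X5 := qprod (q * c) q (2 * k)) in *. set (X6 := qprod (q * a) q (2 * k)) in *.
  set (X8 := qprod (K * r1 / a * q ^ k) q m) in *. set (X9 := qprod (K * r2 / a * q ^ k) q m) in *.
  set (X10 := qprod (q * a * q ^ (2 * k)) q m) in *.
  set (Z1 := qprod c q (2 * k)) in *. set (Z2 := q ^ (2 * k)) in *.
  set (Kp := (K / c) ^ k). set (Y1 := qprod K q (2 * k)). set (Y2 := qprod (K * Z2) q m).
  set (Y3 := qprod (K / a) q m). set (Y4 := qprod (q * a / r1 * q ^ k) q m).
  set (Y5 := qprod (q * a / r2 * q ^ k) q m).
  assert (g11' : Z1 * (1 - c * Z2) / (1 - c) = X5) by (rewrite g11; field; exact c0).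
  transitivity (qprod r1 q k * qprod r2 q k / (X1 * X2) * (Y1 / X5) * Kp / X6 * (Z1 * (1 - c * Z2) / (1 - c)) *
    (Y2 * Y5 * Y4 * Y3 / (qprod q q m * X9 * X8 * X10))).
  + cfield.
  + rewrite g11'. cfield.
- intros i hi. unfold cf, wpker, wp3. rewrite ea1, ea2, ea3.
  replace (k + m - (k + i))%nat with (m - i)%nat by lia.
  replace (k + m + (k + i))%nat with (2 * k + (m + i))%nat by lia.
  replace (k + i - k)%nat with i by lia.
  replace (k + i + k)%nat with (2 * k + i)%nat by lia.
  replace (2 * (k + i))%nat with (2 * k + 2 * i)%nat by lia.
  replace (K * q ^ (2 * k) / (c * q ^ (2 * k))) with (K / c) by (field; auto).
  rewrite !Cpow_add_r, !qprod_add.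
  replace (q * c * q ^ (2 * k)) with (q * (c * q ^ (2 * k))) by ring.
  assert (g1 := rk1 k). assert (g2 := rk2 k).
  assert (g5 := rcq (2 * k)%nat). assert (g6 := raq (2 * k)%nat).
  assert (g8 := qreg_shift _ _ k rk1 i). assert (g9 := qreg_shift _ _ k rk2 i).
  assert (g10 := qreg_shift _ _ (2 * k) raq i).
  assert (g12 := qreg_shift _ _ (2 * k) rcq).
  rewrite <- (Cmult_assoc q c) in g12.
  assert (g13 := qreg_shift _ _ m g12 i). specialize (g12 m).
  cfield.
Qed.

(** Moves a well-poised Bailey pair from parameter c to parameter K. The sequence [al] is arbitrary,
    so the identity may be checked coefficient by coefficient in [al k]. *)
Lemma wp_bailey (q a c r1 r2 K : C) (al : nat -> C) (n : nat) :
  q <> 0 -> a <> 0 -> c <> 0 -> r1 <> 0 -> r2 <> 0 ->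
  K = c * a * q / (r1 * r2) ->
  qreg q q -> qreg a q -> qreg c q -> qreg (q * a / r1) q -> qreg (q * a / r2) q ->
  qreg (K * r1 / a) q -> qreg (K * r2 / a) q ->
  sumC (fun k => wpker a K q n k *
    (qprod r1 q k * qprod r2 q k / (qprod (q * a / r1) q k * qprod (q * a / r2) q k) * (K / c) ^ k * al k)) (S n) =
  qprod (K * r1 / a) q n * qprod (K * r2 / a) q n /
  (qprod (q * a / r1) q n * qprod (q * a / r2) q n) *
  sumC (fun r =>
    (1 - c * q ^ (2 * r)) / (1 - c) *
    (qprod r1 q r * qprod r2 q r / (qprod (K * r1 / a) q r * qprod (K * r2 / a) q r)) *
    wpker c K q n r * (K / c) ^ r * sumC (fun k => wpker a c q r k * al k) (S r)) (S n).
Proof.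
intros hq ha hc h1 h2 hK rq ra rc r1a r2a rk1 rk2.
pose (g r k := (1 - c * q ^ (2 * r)) / (1 - c) *
    (qprod r1 q r * qprod r2 q r / (qprod (K * r1 / a) q r * qprod (K * r2 / a) q r)) *
    wpker c K q n r * (K / c) ^ r * wpker a c q r k).
rewrite (sumC_ext (fun r => (1 - c * q ^ (2 * r)) / (1 - c) * _ * _ * _ * _)
   (fun r => sumC (fun k => g r k * al k) (S r))).
2:{ intros r _. rewrite <- sumC_scal. apply sumC_ext. intros k _. unfold g. ring. }
rewrite (sumC_triangle (fun r k => g r k * al k)).
rewrite <- sumC_scal. apply sumC_ext. intros k hk.
rewrite (sumC_ext (fun i => g (k + i)%nat k * al k) (fun i => al k * g (k + i)%nat k)) by (intros; ring).
rewrite sumC_scal.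
destruct (Nat.le_exists_sub k n) as (m & -> & _); [lia|].
rewrite (Nat.add_comm m k) in *.
replace (S (k + m) - k)%nat with (S m) by lia. unfold g. rewrite ?(Nat.add_comm m k).
rewrite (wp_bailey_inner q a c r1 r2 K k m) by assumption.
cfield.
Qed.

(** * Bailey's terminating transformation *)

(** Reversing (x/q^n;q)_r gives the last r factors of (q/x;q)_n. Thus a base containing q^-n turns
    into a product of length n - r with a fixed base. *)
Lemma qprod_div_pow (x q : C) (n r : nat) : x <> 0 -> q <> 0 -> (r <= n)%nat ->
  qprod (x / q ^ n) q r * qprod (q / x) q (n - r) =
  (x / q ^ n) ^ r * qsign q r * qprod (q / x) q n.
Proof.
intros hx hq hr. assert (hn := Cpow_nz q n hq).
assert (hy : x / q ^ n <> 0).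
{ intros e. apply hx. replace x with (x / q ^ n * q ^ n) by (field; auto). rewrite e. ring. }
rewrite (qprod_rev (x / q ^ n) q r hy hq).
replace (qprod (q / x) q n) with (qprod (q / x) q (n - r) * qprod (q / x * q ^ (n - r)) q r)
  by (rewrite <- qprod_add; f_equal; lia).
replace (q / (x / q ^ n * q ^ r)) with (q / x * q ^ (n - r)); [ring|].
replace (q ^ n) with (q ^ (n - r) * q ^ r) in * by (rewrite <- Cpow_add_r; f_equal; lia).
assert (hr' := Cpow_nz q r hq). assert (hnr := Cpow_nz q (n - r) hq). field. auto.
Qed.

Lemma div_of_mul (x y w : C) : y <> 0 -> x * y = w -> x = w / y.
Proof. intros hy <-. field. exact hy. Qed.

(** With four free lower parameters it serves both a 4phi3, where one of them is q, and each half of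
    a 4psi4. *)
Definition h44 (x1 x2 x3 x4 y1 y2 y3 y4 q : C) (k : nat) : C :=
  qprod x1 q k * qprod x2 q k * qprod x3 q k * qprod x4 q k /
  (qprod y1 q k * qprod y2 q k * qprod y3 q k * qprod y4 q k).

Definition w87 (a b c d e f q : C) (k : nat) : C :=
  (1 - a * q ^ (2 * k)) / (1 - a) * (qprod a q k / qprod q q k) *
  (qprod b q k / qprod (q * a / b) q k * (qprod c q k / qprod (q * a / c) q k) *
   (qprod d q k / qprod (q * a / d) q k) * (qprod e q k / qprod (q * a / e) q k) *
   (qprod f q k / qprod (q * a / f) q k)).

(** Bailey's terminating [10phi9] transformation, for one parameter equal to
    [a z q^n]: the shape on the right separates the two ends of the sum. *)
Lemma bailey_two_ended (q a b c d e f z v : C) (n : nat) :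
  q <> 0 -> a <> 0 -> b <> 0 -> c <> 0 -> d <> 0 -> e <> 0 -> f <> 0 ->
  z = q * q * a * a / (b * c * d * e * f) -> v = b * c * d / (q * a) ->
  qreg q q -> qreg a q -> qreg (q * a / b) q -> qreg (q * a / c) q -> qreg (q * a / d) q ->
  qreg (q * a / e) q -> qreg (q * a / f) q ->
  (forall m, qreg (v / q ^ m) q) -> (forall m, qreg (q / z / q ^ m) q) ->
  (forall m, qreg (d * b / a / q ^ m) q) -> (forall m, qreg (d * c / a / q ^ m) q) ->
  qreg z q -> qreg (1 / v) q -> qreg (z * e) q -> qreg (z * f) q ->
  qreg (q * a / (b * d)) q -> qreg (q * a / (c * d)) q -> qreg (a * z) q ->
  (forall m, qreg (d / q ^ m) q) -> (forall m, qreg (d / a / q ^ m) q) ->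
  sumC (fun k => qprod z q (n - k) * qprod (a * z) q (n + k) /
                 (qprod q q (n - k) * qprod (q * a) q (n + k)) *
                 (w87 a b c d e f q k * z ^ k)) (S n) =
  qprod (a * z) q n * qprod (z * e) q n * qprod (z * f) q n /
  (qprod (q * a / b) q n * qprod (q * a / c) q n * qprod (q * a / d) q n) *
  (/ (v - 1) * sumC (fun r =>
     h44 b c d (q * a / (e * f)) q (q * a / e) (q * a / f) (q * v) q r *
     h44 (q * a / (b * c)) (q * a / (b * d)) (q * a / (c * d)) z q (q / v) (z * e) (z * f) q (n - r) *
     (v * q ^ r - q ^ (n - r))) (S n)).
Proof.
intros hq ha hb hc hd he hf hz hv rq ra rb rc rd re rf rv rz rdb rdc rz0 rv1 rze rzf rbd rcd raz rdn rdan.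
assert (hqn := Cpow_nz q n hq).
assert (hz0 : z <> 0) by nz.
assert (hv0 : v <> 0) by nz.
set (c' := v / q ^ n). set (K := d / q ^ n). set (D := a * z * q ^ n).
assert (hc' : c' <> 0) by nz.
assert (hK0 : K <> 0) by nz.
assert (hD : D <> 0) by (unfold D; repeat apply Cmult_neq_0; auto).
assert (hK : K = c' * a * q / (b * c)) by (unfold K, c'; rewrite hv; field; auto).
assert (rqaD : qreg (q * a / D) q).
{ replace (q * a / D) with (q / z / q ^ n); [apply rz|]. unfold D. field. auto. }
assert (rKb : qreg (K * b / a) q).
{ replace (K * b / a) with (d * b / a / q ^ n); [apply rdb|]. unfold K. field. auto. }
assert (rKc : qreg (K * c / a) q).
{ replace (K * c / a) with (d * c / a / q ^ n); [apply rdc|]. unfold K. field. auto. }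
(* With this choice the inner sum of the Bailey lemma is Jackson's sum for e, f, D. *)
pose (al k := wp3 a e f D q k * (c' / a) ^ k).
assert (hB := wp_bailey q a c' b c K al n hq ha hc' hb hc hK rq ra (rv n) rb rc rKb rKc).
assert (hc'D : c' = a * a * q / (e * f * D)).
{ unfold c', D. rewrite hv, hz. field. auto 10. }
assert (hJ : forall r, sumC (fun k => wpker a c' q r k * al k) (S r) =
  qprod c' q r * qprod (c' * e / a) q r * qprod (c' * f / a) q r * qprod (c' * D / a) q r /
  (qprod q q r * qprod (q * a / e) q r * qprod (q * a / f) q r * qprod (q * a / D) q r)).
{ intros r. exact (jackson_sum q a e f D c' r hq ha he hf hD hc'D rq ra re rf rqaD). }
assert (rqad : forall k, qprod (q * a / d) q k <> 0) by exact rd.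
assert (hsg := fun k => qsign_neq0 q k hq).
assert (hda : d / a <> 0) by nz.
(* Every factor whose base contains a negative power of q^n is reversed; the powers so produced
   combine to z^k, and a factor free of k splits off. *)
assert (hL : forall k, (k <= n)%nat ->
   wpker a K q n k * (qprod b q k * qprod c q k / (qprod (q * a / b) q k * qprod (q * a / c) q k) *
      (K / c') ^ k * al k) =
   qprod (K / a) q n * qprod K q n / (qprod (a * z) q n * qprod z q n) *
   (qprod z q (n - k) * qprod (a * z) q (n + k) /
                 (qprod q q (n - k) * qprod (q * a) q (n + k)) *
                 (w87 a b c d e f q k * z ^ k))).
{ intros k hk. unfold wpker, al, wp3, w87.
  assert (hqk := Cpow_nz q k hq).
  assert (e1 : qprod (K / a) q (n - k) * (((d / a) ^ k) / (q ^ k) ^ k * qsign q k * qprod (q * a / d) q k)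
               = qprod (K / a) q n).
  { assert (h := qprod_div_pow (d / a) q k k hda hq (le_n k)).
    rewrite Nat.sub_diag in h. change (qprod (q / (d / a)) q 0) with (RtoC 1) in h.
    rewrite Cmult_1_r in h. unfold Cdiv at 3 in h. rewrite Cpow_mult_l, Cpow_inv in h by exact hqk.
    cast h (q / (d / a)) (q * a / d).
    unfold Cdiv at 2. rewrite <- h.
    replace (d / a / q ^ k) with (K / a * q ^ (n - k)).
    - rewrite <- qprod_add. f_equal. lia.
    - unfold K. replace (q ^ n) with (q ^ (n - k) * q ^ k) in * by (rewrite <- Cpow_add_r; f_equal; lia).
      assert (hnk := Cpow_nz q (n - k) hq). field. auto. }
  assert (e2 : qprod K q (n + k) = qprod K q n * qprod d q k).
  { rewrite qprod_add. unfold K at 2. replace (d / q ^ n * q ^ n) with d by (field; auto). reflexivity. }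
  assert (e3 : qprod (a * z) q (n + k) = qprod (a * z) q n * qprod D q k) by apply qprod_add.
  assert (e4 : qprod (q * a / D) q k * qprod z q (n - k) = (q * a / D) ^ k * qsign q k * qprod z q n).
  { assert (hqz : q / z <> 0) by nz.
    assert (h := qprod_div_pow (q / z) q n k hqz hq hk).
    cast h (q / (q / z)) z.
    replace (q * a / D) with (q / z / q ^ n) by (unfold D; field; auto). exact h. }
  assert (hp : (K / c') ^ k * (c' / a) ^ k * q ^ k = z ^ k * (d / a) ^ k * (q * a / D) ^ k).
  { rewrite <- !Cpow_mult_l. f_equal. unfold D, K. field. auto. }
  assert (hs := qsign_sqr q k).
  assert (hqaD : q * a / D <> 0) by nz.
  assert (hyk := Cpow_nz (q * a / D) k hqaD).
  rewrite <- e1, e2, e3.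
  assert (hzk : qprod z q (n - k) <> 0) by apply rz0.
  replace (qprod (q * a / D) q k) with ((q * a / D) ^ k * qsign q k * qprod z q n / qprod z q (n - k))
    by (rewrite <- e4; field; auto).
  replace ((K / c') ^ k) with (z ^ k * (d / a) ^ k * (q * a / D) ^ k / ((c' / a) ^ k * q ^ k)).
  2:{ rewrite <- hp. field. split; [auto|]. apply Cpow_nz. intros h. apply hc'.
      replace c' with (c' / a * a) by (field; auto). rewrite h. ring. }
  rewrite <- hs.
  assert (hcak : (c' / a) ^ k <> 0).
  { apply Cpow_nz. intros h. apply hc'.
    replace c' with (c' / a * a) by (field; auto). rewrite h. ring. }
  assert (g1 := rq (n - k)%nat). assert (g2 := qreg_shift _ _ 1 ra (n + k)%nat).
  replace (a * q ^ 1) with (q * a) in g2 by (simpl; ring).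
  assert (g11 : 1 - a <> 0).
  { assert (h := qreg_factor a q 0 ra). simpl in h. now rewrite Cmult_1_r in h. }
  field. repeat split; auto. }
assert (hR : forall r, (r <= n)%nat ->
   (1 - c' * q ^ (2 * r)) / (1 - c') *
    (qprod b q r * qprod c q r / (qprod (K * b / a) q r * qprod (K * c / a) q r)) *
    wpker c' K q n r * (K / c') ^ r * sumC (fun k => wpker a c' q r k * al k) (S r) =
   qprod K q n / qprod (q * c') q n * qprod (q / v) q n * qprod (z * f) q n * qprod (z * e) q n /
     (qprod (q * a / (b * d)) q n * qprod (q * a / (c * d)) q n * qprod z q n) / (v - q ^ n) *
   (h44 b c d (q * a / (e * f)) q (q * a / e) (q * a / f) (q * v) q r *
     h44 (q * a / (b * c)) (q * a / (b * d)) (q * a / (c * d)) z q (q / v) (z * e) (z * f) q (n - r) *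
     (v * q ^ r - q ^ (n - r)))).
{ intros r hr. rewrite hJ. unfold wpker, h44.
  assert (hve : v * e / a <> 0) by nz.
  assert (hvf : v * f / a <> 0) by nz.
  assert (hdb : d * b / a <> 0) by nz.
  assert (hdc : d * c / a <> 0) by nz.
  assert (hqz : q / z <> 0) by nz.
  assert (e1 := qprod_div_pow v q n r hv0 hq hr).
  assert (e2 := qprod_div_pow (v * e / a) q n r hve hq hr).
  assert (e3 := qprod_div_pow (v * f / a) q n r hvf hq hr).
  assert (e4 := qprod_div_pow (d * b / a) q n r hdb hq hr).
  assert (e5 := qprod_div_pow (d * c / a) q n r hdc hq hr).
  assert (e6 := qprod_div_pow (q / z) q n r hqz hq hr).
  cast e2 (q / (v * e / a)) (z * f).
  cast e3 (q / (v * f / a)) (z * e).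
  cast e4 (q / (d * b / a)) (q * a / (b * d)).
  cast e5 (q / (d * c / a)) (q * a / (c * d)).
  cast e6 (q / (q / z)) z.
  fold c' in e1.
  cast e2 (v * e / a / q ^ n) (c' * e / a).
  cast e3 (v * f / a / q ^ n) (c' * f / a).
  cast e4 (d * b / a / q ^ n) (K * b / a).
  cast e5 (d * c / a / q ^ n) (K * c / a).
  cast e6 (q / z / q ^ n) (q * a / D).
  replace (K / c') with (q * a / (b * c)) by (rewrite hK; field; auto).
  replace (c' * D / a) with (q * a / (e * f)) by (unfold c', D; rewrite hz, hv; field; auto 10).
  assert (e7 : qprod K q (n + r) = qprod K q n * qprod d q r).
  { rewrite qprod_add. unfold K at 2. replace (d / q ^ n * q ^ n) with d by (field; auto). reflexivity. }
  assert (e8 : qprod (q * c') q (n + r) = qprod (q * c') q n * qprod (q * v) q r).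
  { rewrite qprod_add. unfold c' at 2. replace (q * (v / q ^ n) * q ^ n) with (q * v) by (field; auto). reflexivity. }
  assert (nz : forall x y : C, x <> 0 -> y <> 0 -> x * y / a <> 0).
  { intros x y hx hy h. apply (Cmult_neq_0 _ _ hx hy). replace (x * y) with (x * y / a * a) by (field; auto). rewrite h. ring. }
  assert (hp : c' ^ r * (c' * e / a) ^ r * (c' * f / a) ^ r * (q * a / (b * c)) ^ r * q ^ r =
               (K * b / a) ^ r * (K * c / a) ^ r * (q * a / D) ^ r).
  { rewrite <- !Cpow_mult_l. f_equal. unfold D, K, c'. rewrite hz, hv. field. auto 15. }
  assert (rqv : qreg (q / v) q).
  { replace (q / v) with (1 / v * q ^ 1) by (simpl; field; auto). now apply qreg_shift. }
  assert (hqaD : q * a / D <> 0) by nz.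
  assert (y4 := Cpow_nz _ r (nz _ _ hK0 hb)). assert (y5 := Cpow_nz _ r (nz _ _ hK0 hc)).
  assert (y6 := Cpow_nz _ r hqaD). assert (yq := Cpow_nz q r hq).
  assert (hsr := hsg r).
  assert (k1 := rqv (n - r)%nat). assert (k2 := rzf (n - r)%nat). assert (k3 := rze (n - r)%nat).
  assert (k4 := rbd n). assert (k5 := rcd n). assert (k6 := rz0 n).
  assert (l1 : qprod (q * c') q n * qprod (q * v) q r <> 0).
  { rewrite <- e8. assert (h := qreg_shift _ _ 1 (rv n) (n + r)%nat). fold c' in h.
    replace (c' * q ^ 1) with (q * c') in h by (simpl; ring). exact h. }
  assert (l2 : qprod (q * c') q n <> 0) by (intros h; apply l1; rewrite h; ring).
  assert (l3 : qprod (q * v) q r <> 0) by (intros h; apply l1; rewrite h; ring).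
  assert (m1 := rq r). assert (m2 := rq (n - r)%nat). assert (m3 := re r). assert (m4 := rf r).
  assert (hvn : v - q ^ n <> 0).
  { intros h. apply (rv n 1%nat). simpl. replace v with (q ^ n + (v - q ^ n)) by ring. rewrite h. field. auto. }
  assert (hc1 : 1 - c' <> 0).
  { intros h. apply hvn. replace v with (c' * q ^ n) by (unfold c'; field; auto).
    replace (c' * q ^ n - q ^ n) with (- (1 - c') * q ^ n) by ring. rewrite h. ring. }
  (* The very-well-poised factor in base v/q^n is the source of the weight v q^r - q^(n-r). *)
  assert (hw : (1 - c' * q ^ (2 * r)) / (1 - c') = q ^ r * (v * q ^ r - q ^ (n - r)) / (v - q ^ n)).
  { unfold c'. replace (q ^ (2 * r)) with (q ^ r * q ^ r) by (rewrite <- Cpow_add_r; f_equal; lia).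
    replace (q ^ n) with (q ^ (n - r) * q ^ r) in * by (rewrite <- Cpow_add_r; f_equal; lia).
    cfield.
    intros h. apply hvn. replace (v - q ^ (n - r) * q ^ r) with (- (q ^ (n - r) * q ^ r - v)) by ring.
    rewrite h. ring. }
  rewrite hw, e7, e8.
  apply (div_of_mul _ _ _ k1) in e1. apply (div_of_mul _ _ _ k2) in e2.
  apply (div_of_mul _ _ _ k3) in e3. apply (div_of_mul _ _ _ (rbd (n - r)%nat)) in e4.
  apply (div_of_mul _ _ _ (rcd (n - r)%nat)) in e5. apply (div_of_mul _ _ _ (rz0 (n - r)%nat)) in e6.
  assert (k7 := rbd (n - r)%nat). assert (k8 := rcd (n - r)%nat). assert (k9 := rz0 (n - r)%nat).
  rewrite e1, e2, e3, e4, e5, e6.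
  replace (q ^ r) with ((K * b / a) ^ r * (K * c / a) ^ r * (q * a / D) ^ r /
     (c' ^ r * (c' * e / a) ^ r * (c' * f / a) ^ r * (q * a / (b * c)) ^ r)) at 1.
  2:{ rewrite <- hp. field. repeat split; apply Cpow_nz; auto.
      intros h. apply (Cmult_neq_0 _ _ hq ha). replace (q * a) with (q * a / (b * c) * (b * c)) by (field; auto). rewrite h. ring. }
  assert (y1 := Cpow_nz _ r hc'). assert (y2 := Cpow_nz _ r (nz _ _ hc' he)).
  assert (y3 := Cpow_nz _ r (nz _ _ hc' hf)).
  assert (y7 : (q * a / (b * c)) ^ r <> 0).
  { apply Cpow_nz. intros h. apply (Cmult_neq_0 _ _ hq ha). replace (q * a) with (q * a / (b * c) * (b * c)) by (field; auto). rewrite h. ring. }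
  clear - hvn hsr y1 y2 y3 y4 y5 y6 y7 k1 k2 k3 k4 k5 k6 k7 k8 k9 l2 l3 m1 m2 m3 m4 yq.
  cfield. }
rewrite (sumC_ext _ _ (S n) (fun k hk => hL k (proj1 (Nat.lt_succ_r k n) hk))) in hB.
rewrite (sumC_ext _ _ (S n) (fun k hk => hR k (proj1 (Nat.lt_succ_r k n) hk))) in hB.
rewrite !sumC_scal in hB.
set (SL := sumC (fun k => qprod z q (n - k) * _ / _ * _) (S n)) in *.
clear hL hR hJ.
assert (full : forall x : C, x <> 0 -> qprod (x / q ^ n) q n = (x / q ^ n) ^ n * qsign q n * qprod (q / x) q n).
{ intros x hx. rewrite <- (qprod_div_pow x q n n hx hq (le_n n)), Nat.sub_diag. simpl. ring. }
assert (nz : forall x y : C, x <> 0 -> y <> 0 -> x * y / a <> 0).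
{ intros x y hx hy h. apply (Cmult_neq_0 _ _ hx hy). replace (x * y) with (x * y / a * a) by (field; auto). rewrite h. ring. }
assert (hqv : q * v <> 0) by nz.
assert (e1 : qprod (K * b / a) q n = (K * b / a) ^ n * qsign q n * qprod (q * a / (b * d)) q n).
{ assert (h := full _ (nz _ _ hd hb)). cast h (q / (d * b / a)) (q * a / (b * d)).
  cast h (d * b / a / q ^ n) (K * b / a). exact h. }
assert (e2 : qprod (K * c / a) q n = (K * c / a) ^ n * qsign q n * qprod (q * a / (c * d)) q n).
{ assert (h := full _ (nz _ _ hd hc)). cast h (q / (d * c / a)) (q * a / (c * d)).
  cast h (d * c / a / q ^ n) (K * c / a). exact h. }
assert (e3 : qprod (K / a) q n = (K / a) ^ n * qsign q n * qprod (q * a / d) q n).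
{ assert (h := full _ hda). cast h (q / (d / a)) (q * a / d).
  cast h (d / a / q ^ n) (K / a). exact h. }
assert (e4 : qprod (q * c') q n = (q * c') ^ n * qsign q n * qprod (1 / v) q n).
{ assert (h := full _ hqv). cast h (q / (q * v)) (1 / v).
  cast h (q * v / q ^ n) (q * c'). exact h. }
assert (hv1 : 1 - 1 / v <> 0).
{ assert (h := qreg_factor _ _ 0 rv1). simpl in h. now rewrite Cmult_1_r in h. }
assert (hvm : v - 1 <> 0).
{ intros h. apply hv1. replace v with (1 + (v - 1)) by ring. rewrite h. field. }
assert (e5 : qprod (q / v) q n = qprod (1 / v) q n * (v - q ^ n) / (v - 1)).
{ assert (h : (1 - 1 / v) * qprod (q / v) q n = qprod (1 / v) q n * (1 - 1 / v * q ^ n)).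
  { rewrite <- qprod_S, qprod_head. replace (1 / v * q) with (q / v) by (field; auto). reflexivity. }
  replace (qprod (q / v) q n) with (/ (1 - 1 / v) * ((1 - 1 / v) * qprod (q / v) q n)) by (field; auto).
  rewrite h. field. auto. }
assert (hp : (K * b / a) ^ n * (K * c / a) ^ n = (q * c') ^ n * (K / a) ^ n).
{ rewrite <- !Cpow_mult_l. f_equal. unfold K, c'. rewrite hv. field. auto. }
assert (hKa : K / a <> 0) by nz.
assert (hqc : q * c' <> 0) by nz.
assert (y1 := Cpow_nz _ n hKa). assert (y2 := Cpow_nz _ n hqc). assert (y3 := hsg n).
assert (hvn : v - q ^ n <> 0).
{ intros h. apply (rv n 1%nat). simpl. replace v with (q ^ n + (v - q ^ n)) by ring. rewrite h. field. auto. }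
assert (k1 := rb n). assert (k2 := rc n). assert (k3 := rd n). assert (k4 := rbd n). assert (k5 := rcd n).
assert (k6 := rz0 n). assert (k7 := raz n). assert (k8 := rdn n n). fold K in k8. assert (k9 := rv1 n).
assert (k10 := rze n). assert (k11 := rzf n).
rewrite e1, e2, e3, e4, e5 in hB.
replace ((K * b / a) ^ n * qsign q n * qprod (q * a / (b * d)) q n *
  ((K * c / a) ^ n * qsign q n * qprod (q * a / (c * d)) q n)) with
  ((q * c') ^ n * (K / a) ^ n * (qsign q n * qsign q n * qprod (q * a / (b * d)) q n * qprod (q * a / (c * d)) q n)) in hB
  by (rewrite <- hp; ring).
clear - hB hvn hvm y1 y2 y3 k1 k2 k3 k4 k5 k6 k7 k8 k9 k10 k11.
set (Y1 := (K / a) ^ n) in *. set (Y3 := qsign q n) in *.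
set (K3 := qprod (q * a / d) q n) in *.
set (K6 := qprod z q n) in *.
set (K7 := qprod (a * z) q n) in *. set (K8 := qprod K q n) in *.
apply (f_equal (fun x => x / (Y1 * Y3 * K3 * K8 / (K7 * K6)))) in hB.
replace (Y1 * Y3 * K3 * K8 / (K7 * K6) * SL / (Y1 * Y3 * K3 * K8 / (K7 * K6))) with SL in hB
  by (field; repeat split; auto).
rewrite hB. cfield.
Qed.

(** * The nonterminating Watson transformation *)

Definition bddC (u : nat -> C) : Prop := exists M, forall n, (Cmod (u n) <= M)%R.

Lemma bddC_mult (u v : nat -> C) : bddC u -> bddC v -> bddC (fun n => u n * v n).
Proof.
intros [M h] [N k]. exists (M * N)%R. intros n. rewrite Cmod_mult.
apply Rmult_le_compat; auto using Cmod_ge_0.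
Qed.

Lemma bddC_plus (u v : nat -> C) : bddC u -> bddC v -> bddC (fun n => u n + v n).
Proof.
intros [M h] [N k]. exists (M + N)%R. intros n.
eapply Rle_trans; [apply Cmod_triangle|]. now apply Rplus_le_compat.
Qed.

Lemma bddC_const (c : C) : bddC (fun _ => c).
Proof. exists (Cmod c). intros _. lra. Qed.

Lemma bddC_qprod (x q : C) : (Cmod q < 1)%R -> bddC (qprod x q).
Proof. intros hq. exists (qbnd q (Cmod x)). intros n. apply qprod_upper; [exact hq|lra]. Qed.

Lemma bddC_inv_qprod (x q : C) : (Cmod q < 1)%R -> qreg x q -> bddC (fun n => / qprod x q n).
Proof.
intros hq h. destruct (qprod_lower q x hq h) as (m & hm & hl). exists (/ m)%R. intros n.
rewrite Cmod_inv by apply h. apply Rinv_le_contravar; auto.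
Qed.

Lemma bddC_qpow (q : C) (f : nat -> nat) : (Cmod q < 1)%R -> bddC (fun n => q ^ f n).
Proof.
intros hq. exists 1%R. intros n. rewrite Cmod_pow.
replace 1%R with (1 ^ f n)%R by apply pow1. apply pow_incr.
split; [apply Cmod_ge_0|lra].
Qed.

Lemma bddC_ext (u v : nat -> C) : (forall n, u n = v n) -> bddC u -> bddC v.
Proof. intros e [M h]. exists M. intros n. now rewrite <- e. Qed.

Definition h44inf (x1 x2 x3 x4 y1 y2 y3 y4 q : C) : C :=
  qpoch_inf x1 q * qpoch_inf x2 q * qpoch_inf x3 q * qpoch_inf x4 q /
  (qpoch_inf y1 q * qpoch_inf y2 q * qpoch_inf y3 q * qpoch_inf y4 q).

Lemma Cinv_mult_2 (a b : C) : a <> 0 -> b <> 0 -> / (a * b) = / a * / b.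
Proof. intros. field. auto. Qed.

Lemma Cinv_mult_4 (a b c d : C) : a <> 0 -> b <> 0 -> c <> 0 -> d <> 0 ->
  / (a * b * c * d) = / a * / b * / c * / d.
Proof. intros. field. auto. Qed.

Lemma h44_bdd (x1 x2 x3 x4 y1 y2 y3 y4 q : C) : (Cmod q < 1)%R ->
  qreg y1 q -> qreg y2 q -> qreg y3 q -> qreg y4 q ->
  bddC (h44 x1 x2 x3 x4 y1 y2 y3 y4 q).
Proof.
intros hq r1 r2 r3 r4.
apply (bddC_ext (fun k => qprod x1 q k * qprod x2 q k * qprod x3 q k * qprod x4 q k *
   (/ qprod y1 q k * / qprod y2 q k * / qprod y3 q k * / qprod y4 q k))).
- intros k. unfold h44, Cdiv. rewrite Cinv_mult_4 by auto. reflexivity.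
- repeat apply bddC_mult; auto using bddC_qprod, bddC_inv_qprod.
Qed.

Lemma h44_cvg (x1 x2 x3 x4 y1 y2 y3 y4 q : C) : (Cmod q < 1)%R ->
  qreg y1 q -> qreg y2 q -> qreg y3 q -> qreg y4 q ->
  cvgC (h44 x1 x2 x3 x4 y1 y2 y3 y4 q) (h44inf x1 x2 x3 x4 y1 y2 y3 y4 q).
Proof.
intros hq r1 r2 r3 r4.
apply cvgC_div.
- repeat apply Cmult_neq_0; now apply qpoch_inf_neq0.
- repeat apply cvgC_mult; now apply cvgC_qpoch_inf.
- repeat apply cvgC_mult; now apply cvgC_qpoch_inf.
Qed.

(** The weight q^r concentrates the convolution at small r, where V(n - r) is already close to its
    limit. *)
Lemma conv_limit (U V : nat -> C) (q L : C) : (Cmod q < 1)%R ->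
  bddC U -> bddC V -> cvgC V L ->
  ex_Cseries (fun k => U k * q ^ k) /\
  cvgC (fun n => sumC (fun r => U r * V (n - r)%nat * q ^ r) (S n))
       (L * Cseries (fun k => U k * q ^ k)).
Proof.
intros hq [M hM] [N hN] hV.
assert (hr : (0 <= Cmod q < 1)%R) by (split; [apply Cmod_ge_0|exact hq]).
assert (ex : ex_Cseries (fun k => U k * q ^ k)).
{ apply (geom_dominated_ex _ M (Cmod q) hr). intros k. rewrite Cmod_mult, Cmod_pow.
  apply Rmult_le_compat_r; [apply pow_le, Cmod_ge_0|apply hM]. }
split; [exact ex|].
rewrite <- Cseries_scal by exact ex.
refine (proj2 (tannery_sum _ _ (M * N) (Cmod q) S _ hr _ _)).
- intros n. lia.
- intros n k _. rewrite !Cmod_mult, Cmod_pow.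
  apply Rmult_le_compat_r; [apply pow_le, Cmod_ge_0|].
  apply Rmult_le_compat; auto using Cmod_ge_0.
- intros k. apply (cvgC_ext (fun n => V (n - k)%nat * (U k * q ^ k))).
  + intros n. ring.
  + apply cvgC_mult; [|apply cvgC_const]. now apply cvgC_shift.
Qed.

Lemma w87_bdd (a b c d e f q : C) : (Cmod q < 1)%R ->
  qreg q q -> qreg (q * a / b) q -> qreg (q * a / c) q -> qreg (q * a / d) q ->
  qreg (q * a / e) q -> qreg (q * a / f) q -> bddC (w87 a b c d e f q).
Proof.
intros hq rq rb rc rd re rf. unfold w87, Cdiv.
repeat apply bddC_mult; auto using bddC_qprod, bddC_inv_qprod, bddC_const.
apply bddC_plus; [apply bddC_const|].
apply (bddC_ext (fun n => - a * q ^ (2 * n))); [intros; ring|].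
apply bddC_mult; [apply bddC_const|now apply bddC_qpow].
Qed.

Lemma w87_series_ex (a b c d e f q z : C) : (Cmod q < 1)%R -> (Cmod z < 1)%R ->
  qreg q q -> qreg (q * a / b) q -> qreg (q * a / c) q -> qreg (q * a / d) q ->
  qreg (q * a / e) q -> qreg (q * a / f) q ->
  ex_Cseries (fun k => w87 a b c d e f q k * z ^ k).
Proof.
intros hq hz rq rb rc rd re rf.
destruct (w87_bdd a b c d e f q) as [M hM]; auto.
apply (geom_dominated_ex _ M (Cmod z)).
- split; [apply Cmod_ge_0|exact hz].
- intros k. rewrite Cmod_mult, Cmod_pow.
  apply Rmult_le_compat_r; [apply pow_le, Cmod_ge_0|apply hM].
Qed.

(** The limit of [bailey_two_ended]. The part of the convolution with weight v q^r is governed by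
    small r, the part with weight q^(n-r) by r near n; each contributes one series times the limit
    of the other coefficient. *)
Lemma bailey_nonterminating (q a b c d e f z v : C) :
  q <> 0 -> (Cmod q < 1)%R -> (Cmod z < 1)%R ->
  a <> 0 -> b <> 0 -> c <> 0 -> d <> 0 -> e <> 0 -> f <> 0 ->
  z = q * q * a * a / (b * c * d * e * f) -> v = b * c * d / (q * a) ->
  qreg a q -> qreg (q * a / b) q -> qreg (q * a / c) q -> qreg (q * a / d) q ->
  qreg (q * a / e) q -> qreg (q * a / f) q ->
  (forall m, qreg (v / q ^ m) q) -> (forall m, qreg (q / z / q ^ m) q) ->
  (forall m, qreg (d * b / a / q ^ m) q) -> (forall m, qreg (d * c / a / q ^ m) q) ->
  qreg z q -> qreg (1 / v) q -> qreg (z * e) q -> qreg (z * f) q ->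
  qreg (q * a / (b * d)) q -> qreg (q * a / (c * d)) q -> qreg (a * z) q ->
  (forall m, qreg (d / q ^ m) q) -> (forall m, qreg (d / a / q ^ m) q) ->
  qpoch_inf z q * qpoch_inf (a * z) q / (qpoch_inf q q * qpoch_inf (q * a) q) *
    Cseries (fun k => w87 a b c d e f q k * z ^ k) =
  qpoch_inf (a * z) q * qpoch_inf (z * e) q * qpoch_inf (z * f) q /
  (qpoch_inf (q * a / b) q * qpoch_inf (q * a / c) q * qpoch_inf (q * a / d) q) *
  (/ (v - 1) *
   (v * (h44inf (q * a / (b * c)) (q * a / (b * d)) (q * a / (c * d)) z q (q / v) (z * e) (z * f) q *
      Cseries (fun k => h44 b c d (q * a / (e * f)) q (q * a / e) (q * a / f) (q * v) q k * q ^ k)) -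
    h44inf b c d (q * a / (e * f)) q (q * a / e) (q * a / f) (q * v) q *
      Cseries (fun k => h44 (q * a / (b * c)) (q * a / (b * d)) (q * a / (c * d)) z
                          q (q / v) (z * e) (z * f) q k * q ^ k))).
Proof.
intros hq hq1 hz1 ha hb hc hd he hf hz hv ra rb rc rd re rf rv rz rdb rdc rz0 rv1 rze rzf rbd rcd raz rdn rdan.
assert (rq : qreg q q) by (intros k; now apply qprod_q_neq0).
assert (raq : qreg (q * a) q).
{ replace (q * a) with (a * q ^ 1) by (simpl; ring). now apply qreg_shift. }
assert (hv0 : v <> 0).
{ intros h. apply (Cmult_neq_0 _ _ (Cmult_neq_0 _ _ hb hc) hd).
  replace (b * c * d) with (v * (q * a)) by (rewrite hv; field; auto). rewrite h. ring. }
assert (rqv : qreg (q / v) q).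
{ replace (q / v) with (1 / v * q ^ 1) by (simpl; field; auto). now apply qreg_shift. }
assert (rqv' : qreg (q * v) q).
{ assert (h := qreg_shift _ _ 1 (rv 0%nat)).
  replace (v / q ^ 0 * q ^ 1) with (q * v) in h by (simpl; field; exact C1_nz). exact h. }
set (U := h44 b c d (q * a / (e * f)) q (q * a / e) (q * a / f) (q * v) q).
set (V := h44 (q * a / (b * c)) (q * a / (b * d)) (q * a / (c * d)) z q (q / v) (z * e) (z * f) q).
assert (bU : bddC U) by (apply h44_bdd; auto).
assert (bV : bddC V) by (apply h44_bdd; auto).
assert (cU := h44_cvg b c d (q * a / (e * f)) q (q * a / e) (q * a / f) (q * v) q hq1 rq re rf rqv').
assert (cV := h44_cvg (q * a / (b * c)) (q * a / (b * d)) (q * a / (c * d)) z q (q / v) (z * e) (z * f) q hq1 rq rqv rze rzf).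
fold U in cU. fold V in cV.
assert (fin := fun n => bailey_two_ended q a b c d e f z v n hq ha hb hc hd he hf hz hv rq ra rb rc rd re rf rv rz rdb rdc rz0 rv1 rze rzf rbd rcd raz rdn rdan).
apply (cvgC_unique (fun n => sumC (fun k => qprod z q (n - k) * qprod (a * z) q (n + k) /
                 (qprod q q (n - k) * qprod (q * a) q (n + k)) *
                 (w87 a b c d e f q k * z ^ k)) (S n))).
- assert (exW := w87_series_ex a b c d e f q z hq1 hz1 rq rb rc rd re rf).
  rewrite <- Cseries_scal by exact exW.
  destruct (w87_bdd a b c d e f q) as [MW hW]; auto.
  destruct (bddC_qprod z q hq1) as [M1 h1].
  destruct (bddC_qprod (a * z) q hq1) as [M2 h2].
  destruct (bddC_inv_qprod q q hq1 rq) as [M3 h3].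
  destruct (bddC_inv_qprod (q * a) q hq1 raq) as [M4 h4].
  refine (proj2 (tannery_sum _ _ (M1 * M2 * (M3 * M4) * MW) (Cmod z) S _ _ _ _)).
  + intros n. lia.
  + split; [apply Cmod_ge_0|exact hz1].
  + intros n k _. unfold Cdiv. rewrite Cinv_mult_2 by auto.
    rewrite !Cmod_mult, Cmod_pow, <- !Rmult_assoc.
    apply Rmult_le_compat_r; [apply pow_le, Cmod_ge_0|].
    apply Rmult_le_compat; auto using Cmod_ge_0.
    { repeat apply Rmult_le_pos; apply Cmod_ge_0. }
    rewrite !(Rmult_assoc (_ * _)).
    repeat apply Rmult_le_compat; auto using Cmod_ge_0; apply Rmult_le_pos; apply Cmod_ge_0.
  + intros k. apply cvgC_mult; [|apply cvgC_const].
    apply cvgC_div.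
    * apply Cmult_neq_0; now apply qpoch_inf_neq0.
    * apply cvgC_mult; [apply cvgC_shift|apply (cvgC_sub _ _ (fun n => (n + k)%nat)); [lia|]]; now apply cvgC_qpoch_inf.
    * apply cvgC_mult; [apply cvgC_shift|apply (cvgC_sub _ _ (fun n => (n + k)%nat)); [lia|]]; now apply cvgC_qpoch_inf.
- apply (cvgC_ext (fun n => qprod (a * z) q n * qprod (z * e) q n * qprod (z * f) q n /
    (qprod (q * a / b) q n * qprod (q * a / c) q n * qprod (q * a / d) q n) *
    (/ (v - 1) * (v * sumC (fun r => U r * V (n - r)%nat * q ^ r) (S n) -
       sumC (fun r => V r * U (n - r)%nat * q ^ r) (S n))))).
  + intros n. rewrite fin. f_equal. f_equal. fold U V.
    (* The part with weight q^(n-r) is reversed, so that [conv_limit] applies to it with [U] and [V]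
       exchanged. *)
    rewrite <- (sumC_rev (fun r => V r * U (n - r)%nat * q ^ r) (S n)).
    transitivity (sumC (fun k => v * (U k * V (n - k)%nat * q ^ k) +
       (- (1)) * (V (S n - S k)%nat * U (n - (S n - S k))%nat * q ^ (S n - S k))) (S n)).
    * rewrite sumC_plus, !sumC_scal. ring.
    * apply sumC_ext. intros k hk. replace (S n - S k)%nat with (n - k)%nat by lia.
      replace (n - (n - k))%nat with k by lia. ring.
  + apply cvgC_mult.
    * apply cvgC_div; [repeat apply Cmult_neq_0; now apply qpoch_inf_neq0| |];
      repeat apply cvgC_mult; now apply cvgC_qpoch_inf.
    * apply cvgC_mult; [apply cvgC_const|]. apply cvgC_minus.
      -- apply cvgC_mult; [apply cvgC_const|]. now apply conv_limit.
      -- now apply conv_limit.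
Qed.

(** * Sums of residues *)

Fixpoint sumL (f : C -> C) (l : list C) : C :=
  match l with nil => 0 | x :: l => f x + sumL f l end.

Fixpoint prodL {A : Type} (f : A -> C) (l : list A) : C :=
  match l with nil => 1 | x :: l => f x * prodL f l end.

Fixpoint prodN (f : nat -> C) (n : nat) : C :=
  match n with O => 1 | S m => prodN f m * f m end.

(** The value 1 on the diagonal lets a product over all nodes omit the node itself, without removing
    it from the list. *)
Definition dsub (x y : C) : C := if Ceq_dec x y then 1 else x - y.

(** For distinct nodes and x among them, this is the residue at x of the inverse of the product of
    all t - y. *)
Definition lagw (l : list C) (x : C) : C := / prodL (dsub x) l.

Lemma dsub_neq (x y : C) : x <> y -> dsub x y = x - y.
Proof. intros h. unfold dsub. destruct (Ceq_dec x y); [contradiction|reflexivity]. Qed.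

Lemma sub_neq0 (x y : C) : x <> y -> x - y <> 0.
Proof. intros h e. apply h. replace x with (x - y + y) by ring. rewrite e. ring. Qed.

Lemma dsub_neq0 (x y : C) : dsub x y <> 0.
Proof.
unfold dsub. destruct (Ceq_dec x y) as [e|n]; [exact C1_nz|now apply sub_neq0].
Qed.

Lemma prodL_dsub_neq0 (l : list C) (x : C) : prodL (dsub x) l <> 0.
Proof.
induction l as [|y l IH]; simpl; [exact C1_nz|].
apply Cmult_neq_0; [apply dsub_neq0|exact IH].
Qed.

Lemma sumL_ext (f g : C -> C) (l : list C) :
  (forall x, In x l -> f x = g x) -> sumL f l = sumL g l.
Proof.
induction l as [|y l IH]; intros h; simpl; [reflexivity|].
rewrite IH by (intros; apply h; now right). rewrite h by now left. reflexivity.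
Qed.

Lemma sumL_plus (f g : C -> C) (l : list C) :
  sumL (fun x => f x + g x) l = sumL f l + sumL g l.
Proof. induction l as [|y l IH]; simpl; [ring|]. rewrite IH. ring. Qed.

Lemma sumL_scal (a : C) (f : C -> C) (l : list C) :
  sumL (fun x => a * f x) l = a * sumL f l.
Proof. induction l as [|y l IH]; simpl; [ring|]. rewrite IH. ring. Qed.

Lemma sumL_app (f : C -> C) (l l' : list C) : sumL f (l ++ l') = sumL f l + sumL f l'.
Proof. induction l as [|y l IH]; simpl; [ring|]. rewrite IH. ring. Qed.

Lemma prodL_app {A : Type} (f : A -> C) (l l' : list A) :
  prodL f (l ++ l') = prodL f l * prodL f l'.
Proof. induction l as [|y l IH]; simpl; [ring|]. rewrite IH. ring. Qed.

Lemma sumL_map_seq (f : C -> C) (g : nat -> C) (n : nat) :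
  sumL f (map g (seq 0 n)) = sumC (fun k => f (g k)) n.
Proof.
induction n as [|n IH]; [reflexivity|].
rewrite seq_S, map_app, sumL_app, IH. simpl. ring.
Qed.

Lemma prodL_map_seq {A : Type} (f : A -> C) (g : nat -> A) (n : nat) :
  prodL f (map g (seq 0 n)) = prodN (fun k => f (g k)) n.
Proof.
induction n as [|n IH]; [reflexivity|].
rewrite seq_S, map_app, prodL_app, IH. simpl. ring.
Qed.

Lemma prodN_ext (f g : nat -> C) (n : nat) :
  (forall k, (k < n)%nat -> f k = g k) -> prodN f n = prodN g n.
Proof.
induction n as [|n IH]; intros h; simpl; [reflexivity|].
rewrite IH by (intros; apply h; lia). rewrite h by lia. reflexivity.
Qed.

Lemma prodN_mult (f g : nat -> C) (n : nat) :
  prodN (fun k => f k * g k) n = prodN f n * prodN g n.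
Proof. induction n as [|n IH]; simpl; [ring|]. rewrite IH. ring. Qed.

Lemma prodN_app (f : nat -> C) (m n : nat) :
  prodN f (m + n) = prodN f m * prodN (fun k => f (m + k)%nat) n.
Proof.
induction n as [|n IH].
- rewrite Nat.add_0_r. simpl. ring.
- rewrite Nat.add_succ_r. simpl. rewrite IH. ring.
Qed.

Lemma prodN_neq0 (f : nat -> C) (n : nat) : (forall k, f k <> 0) -> prodN f n <> 0.
Proof.
intros h. induction n as [|n IH]; simpl; [exact C1_nz|]. now apply Cmult_neq_0.
Qed.

Lemma prodN_const (c : C) (n : nat) : prodN (fun _ => c) n = c ^ n.
Proof. induction n as [|n IH]; simpl; [reflexivity|]. rewrite IH. ring. Qed.

Lemma qprod_prodN (x q : C) (n : nat) : qprod x q n = prodN (fun k => 1 - x * q ^ k) n.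
Proof. induction n as [|n IH]; simpl; [reflexivity|]. now rewrite IH. Qed.

Lemma lagw_cons (y : C) (l : list C) (x : C) :
  x <> y -> lagw (y :: l) x = / (x - y) * lagw l x.
Proof.
intros h. unfold lagw. simpl. rewrite dsub_neq by exact h.
field. split; [apply prodL_dsub_neq0|now apply sub_neq0].
Qed.

Lemma lagw_head (y : C) (l : list C) :
  ~ In y l -> lagw (y :: l) y = / prodL (fun x => y - x) l.
Proof.
intros h. unfold lagw. simpl. unfold dsub at 1.
destruct (Ceq_dec y y) as [_|n]; [|now elim n]. rewrite Cmult_1_l. f_equal.
clear - h. induction l as [|z l IH]; simpl; [reflexivity|].
rewrite dsub_neq by (intros ->; apply h; now left).
rewrite IH by (intros hz; apply h; now right). reflexivity.
Qed.

Lemma prodL_sub_neq0 (t : C) (l : list C) : ~ In t l -> prodL (fun x => t - x) l <> 0.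
Proof.
induction l as [|z l IH]; intros h; simpl; [exact C1_nz|].
apply Cmult_neq_0; [apply sub_neq0; intros ->; apply h; now left|].
apply IH. intros hz. apply h. now right.
Qed.

Lemma partial_fractions (l : list C) (t : C) : l <> nil -> NoDup l -> ~ In t l ->
  sumL (fun x => lagw l x / (t - x)) l = / prodL (fun x => t - x) l.
Proof.
revert t. induction l as [|y l IH]; intros t hl hd ht; [now elim hl|].
apply NoDup_cons_iff in hd. destruct hd as [hy hd].
assert (hty : t - y <> 0) by (apply sub_neq0; intros ->; apply ht; now left).
assert (ht' : ~ In t l) by (intros h; apply ht; now right).
cbn [sumL prodL]. rewrite lagw_head by exact hy.
destruct l as [|z l']; [simpl; field; exact hty|].
set (l := z :: l') in *.
assert (hl' : l <> nil) by discriminate.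
(* From 1/((x - y)(t - x)) = (1/(t - x) - 1/(y - x))/(t - y): the induction hypothesis is used at
   the two points t and y. *)
rewrite (sumL_ext _ (fun x => / (t - y) * (lagw l x / (t - x)) + - / (t - y) * (lagw l x / (y - x)))).
- rewrite sumL_plus, !sumL_scal, !IH by assumption.
  assert (h1 := prodL_sub_neq0 t l ht'). assert (h2 := prodL_sub_neq0 y l hy).
  field. auto.
- intros x hx.
  assert (hxy : x <> y) by (intros ->; contradiction).
  rewrite lagw_cons by exact hxy.
  assert (x - y <> 0) by now apply sub_neq0.
  assert (y - x <> 0) by (apply sub_neq0; auto).
  assert (t - x <> 0) by (apply sub_neq0; intros ->; contradiction).
  field. auto.
Qed.

(** Partial fractions for the tail of the list, evaluated at its head y: the sum over the tail is
    minus the weight at y. *)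
Lemma lagw_sum (l : list C) : (2 <= length l)%nat -> NoDup l -> sumL (lagw l) l = 0.
Proof.
destruct l as [|y l]; intros hl hd; [simpl in hl; lia|].
apply NoDup_cons_iff in hd. destruct hd as [hy hd].
assert (hl' : l <> nil) by (intros ->; simpl in hl; lia).
cbn [sumL]. rewrite lagw_head by exact hy.
rewrite (sumL_ext _ (fun x => - (1) * (lagw l x / (y - x)))).
- rewrite sumL_scal, partial_fractions by assumption. ring.
- intros x hx.
  assert (hxy : x <> y) by (intros ->; contradiction).
  rewrite lagw_cons by exact hxy.
  assert (x - y <> 0) by now apply sub_neq0.
  assert (y - x <> 0) by (apply sub_neq0; auto).
  field. auto.
Qed.

(** The degree condition makes the rational function [O(t^-2)] at infinity. *)
Lemma residue_sum (L : list (C * C)) (l : list C) :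
  (length L + 2 <= length l)%nat -> NoDup l ->
  sumL (fun x => prodL (fun p => fst p - snd p * x) L * lagw l x) l = 0.
Proof.
revert l. induction L as [|[al be] L IH]; intros l hl hd.
- simpl. rewrite (sumL_ext _ (lagw l)) by (intros; ring). apply lagw_sum; [exact hl|exact hd].
- destruct l as [|y l]; [simpl in hl; lia|].
  set (f x := prodL (fun p => fst p - snd p * x) L) in *.
  (* Writing al - be x = (al - be y) - be (x - y), the first term has one numerator factor fewer,
     and in the second x - y removes the pole at y. *)
  rewrite (sumL_ext _ (fun x => (al - be * y) * (f x * lagw (y :: l) x) +
     - be * ((x - y) * (f x * lagw (y :: l) x)))) by (intros; unfold f; simpl; ring).
  rewrite sumL_plus, !sumL_scal.
  rewrite IH by (simpl in *; (lia || assumption)).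
  cbn [sumL]. apply NoDup_cons_iff in hd. destruct hd as [hy hd].
  rewrite (sumL_ext _ (fun x => f x * lagw l x)).
  + rewrite IH by (simpl in *; (lia || assumption)). ring.
  + intros x hx. assert (hxy : x <> y) by (intros ->; contradiction).
    rewrite lagw_cons by exact hxy. field. now apply sub_neq0.
Qed.

Lemma qpow_inj (q : C) (j k : nat) : q <> 0 -> (Cmod q < 1)%R -> q ^ j = q ^ k -> j = k.
Proof.
assert (H : forall j k, q <> 0 -> (Cmod q < 1)%R -> (j < k)%nat -> q ^ j <> q ^ k).
{ intros i m hq hq1 h e. replace m with (i + S (m - i - 1))%nat in e by lia.
  rewrite Cpow_add_r in e. apply (one_minus_pow_pos q (m - i - 1) hq1).
  assert (hi := Cpow_nz q i hq).
  replace (q ^ S (m - i - 1)) with (q ^ i * q ^ S (m - i - 1) / q ^ i) by (field; auto).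
  rewrite <- e. field. auto. }
intros hq hq1 e. destruct (Nat.lt_trichotomy j k) as [h|[h|h]]; [|exact h|].
- now elim (H j k).
- now elim (H k j).
Qed.

Lemma prodN_split (f : nat -> C) (k n : nat) : (k < n)%nat ->
  prodN (fun j => if Nat.eq_dec j k then 1 else f j) n =
  prodN f k * prodN (fun j => f (k + S j)%nat) (n - 1 - k).
Proof.
intros h. replace n with (k + S (n - 1 - k))%nat at 1 by lia.
rewrite prodN_app. f_equal.
- apply prodN_ext. intros j hj. destruct (Nat.eq_dec j k); [lia|reflexivity].
- change (S (n - 1 - k)) with (1 + (n - 1 - k))%nat. rewrite prodN_app. simpl.
  rewrite Nat.add_0_r. destruct (Nat.eq_dec k k); [|lia].
  rewrite !Cmult_1_l. apply prodN_ext. intros j hj.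
  destruct (Nat.eq_dec (k + S j) k); [lia|reflexivity].
Qed.

(** The indices below k give (q^-k;q)_k and those above it give (q;q)_(n-1-k). *)
Lemma prodN_own (q : C) (k n : nat) : q <> 0 -> (k < n)%nat ->
  prodN (fun j => if Nat.eq_dec j k then 1 else 1 - q ^ j / q ^ k) n =
  qprod (/ q ^ k) q k * qprod q q (n - 1 - k).
Proof.
intros hq h. assert (hk := Cpow_nz q k hq).
rewrite (prodN_split (fun j => 1 - q ^ j / q ^ k)) by exact h.
rewrite !qprod_prodN. f_equal; apply prodN_ext; intros j hj.
- unfold Cdiv. ring.
- rewrite Cpow_add_r. simpl. field. exact hk.
Qed.

Lemma prodL_v (q v t : C) (N : nat) : q <> 0 -> t <> 0 ->
  (forall j, t <> v * q ^ j) ->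
  prodL (dsub t) (map (fun j => v * q ^ j) (seq 0 N)) = t ^ N * qprod (v / t) q N.
Proof.
intros hq ht h. rewrite prodL_map_seq, qprod_prodN, <- prodN_const, <- prodN_mult.
apply prodN_ext. intros j _. rewrite dsub_neq by apply h. field. exact ht.
Qed.

Lemma prodL_v_own (q v : C) (k N : nat) : q <> 0 -> (Cmod q < 1)%R -> v <> 0 -> (k < N)%nat ->
  prodL (dsub (v * q ^ k)) (map (fun j => v * q ^ j) (seq 0 N)) =
  (v * q ^ k) ^ N * / (v * q ^ k) * (qprod (/ q ^ k) q k * qprod q q (N - 1 - k)).
Proof.
intros hq hq1 hv h. assert (hk := Cpow_nz q k hq).
rewrite prodL_map_seq, <- prodN_own by assumption.
rewrite <- (prodN_const (v * q ^ k) N).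
assert (e : prodN (fun _ => v * q ^ k) N * / (v * q ^ k) =
   prodN (fun j => if Nat.eq_dec j k then 1 else v * q ^ k) N).
{ rewrite prodN_split by exact h. rewrite !prodN_const.
  replace N with (S (k + (N - 1 - k))) at 1 by lia. cbn [Cpow].
  rewrite Cpow_add_r. field. auto. }
rewrite e, <- prodN_mult. apply prodN_ext. intros j hj.
destruct (Nat.eq_dec j k) as [->|n].
- unfold dsub. destruct (Ceq_dec _ _) as [_|b]; [ring|now elim b].
- rewrite dsub_neq; [field; auto|].
  intros e'. apply n. symmetry. apply (qpow_inj q); auto.
  replace (q ^ k) with (/ v * (v * q ^ k)) by (field; auto). rewrite e'. field. auto.
Qed.

(** Converts factors t - 1/(u q^j) into 1 - u q^j t. It is the same at every pole, so it drops out
    of the sum of residues. *)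
Definition uconst (q u : C) (M : nat) : C := prodN (fun j => - / (u * q ^ j)) M.

Lemma uconst_neq0 (q u : C) (M : nat) : q <> 0 -> u <> 0 -> uconst q u M <> 0.
Proof.
intros hq hu. apply prodN_neq0. intros k e.
assert (hk : u * q ^ k <> 0) by (apply Cmult_neq_0; [exact hu|now apply Cpow_nz]).
apply C1_nz. replace (RtoC 1) with (- (- / (u * q ^ k)) * (u * q ^ k)) by (field; split; [now apply Cpow_nz|exact hu]).
rewrite e. ring.
Qed.

Lemma prodL_u (q u t : C) (M : nat) : q <> 0 -> u <> 0 ->
  (forall j, t <> / (u * q ^ j)) ->
  prodL (dsub t) (map (fun j => / (u * q ^ j)) (seq 0 M)) = uconst q u M * qprod (u * t) q M.
Proof.
intros hq hu h. unfold uconst. rewrite prodL_map_seq, qprod_prodN, <- prodN_mult.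
apply prodN_ext. intros j _. rewrite dsub_neq by apply h.
assert (hj := Cpow_nz q j hq). field. auto.
Qed.

Lemma prodL_u_own (q u : C) (k M : nat) : q <> 0 -> (Cmod q < 1)%R -> u <> 0 -> (k < M)%nat ->
  prodL (dsub (/ (u * q ^ k))) (map (fun j => / (u * q ^ j)) (seq 0 M)) =
  uconst q u M * - (u * q ^ k) * (qprod (/ q ^ k) q k * qprod q q (M - 1 - k)).
Proof.
intros hq hq1 hu h. assert (hk := Cpow_nz q k hq).
rewrite prodL_map_seq, <- prodN_own by assumption.
assert (e : uconst q u M * - (u * q ^ k) =
   prodN (fun j => if Nat.eq_dec j k then 1 else - / (u * q ^ j)) M).
{ rewrite prodN_split by exact h. unfold uconst.
  replace M with (k + S (M - 1 - k))%nat at 1 by lia. rewrite prodN_app.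
  change (S (M - 1 - k)) with (1 + (M - 1 - k))%nat. rewrite prodN_app. simpl.
  rewrite Nat.add_0_r.
  field. auto. }
rewrite e, <- prodN_mult. apply prodN_ext. intros j hj.
assert (hj' := Cpow_nz q j hq).
destruct (Nat.eq_dec j k) as [->|n].
- unfold dsub. destruct (Ceq_dec _ _) as [_|b]; [ring|now elim b].
- rewrite dsub_neq; [field; auto|].
  intros e'. apply n. apply (qpow_inj q); auto.
  replace (q ^ k) with (/ (u * / (u * q ^ k))) by (field; auto). rewrite e'. field. auto.
Qed.

Lemma NoDup_seq_map (g : nat -> C) (n : nat) :
  (forall j k, g j = g k -> j = k) -> NoDup (map g (seq 0 n)).
Proof. intros h. apply Injective_map_NoDup; [exact h|apply seq_NoDup]. Qed.

(** Up to the constants [uconst], the residue of the truncated quotient at t = 1/(u q^k). The last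
    bracket is what remains of (u t;q)_(N+1) after its vanishing factor has been removed. *)
Definition resu (q u u' u'' x1 x2 x3 y1 y2 v1 v2 : C) (N k : nat) : C :=
  - / (u * q ^ k) *
  (qprod (x1 * / (u * q ^ k)) q N * qprod (x2 * / (u * q ^ k)) q N * qprod (x3 * / (u * q ^ k)) q N *
   qprod (y1 * (u * q ^ k)) q N * qprod (y2 * (u * q ^ k)) q N /
   (qprod (u' * / (u * q ^ k)) q (S N) * qprod (u'' * / (u * q ^ k)) q (S N) *
    qprod (v1 * (u * q ^ k)) q N * qprod (v2 * (u * q ^ k)) q N *
    (qprod (/ q ^ k) q k * qprod q q (N - k)))).

(** The analogue at t = v q^k, with the same normalisation. *)
Definition resv (q v v' x1 x2 x3 y1 y2 u1 u2 u3 : C) (N k : nat) : C :=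
  v * q ^ k *
  (qprod (x1 * (v * q ^ k)) q N * qprod (x2 * (v * q ^ k)) q N * qprod (x3 * (v * q ^ k)) q N *
   qprod (y1 / (v * q ^ k)) q N * qprod (y2 / (v * q ^ k)) q N /
   (qprod (u1 * (v * q ^ k)) q (S N) * qprod (u2 * (v * q ^ k)) q (S N) * qprod (u3 * (v * q ^ k)) q (S N) *
    qprod (v' / (v * q ^ k)) q N *
    (qprod (/ q ^ k) q k * qprod q q (N - 1 - k)))).

(** An instance of [residue_sum]; the separation and regularity hypotheses make the five
    progressions of poles pairwise disjoint. The powers of t that come from the factors in 1/t are
    equal in numerator and denominator and cancel. *)
Lemma residues_finite (q u1 u2 u3 x1 x2 x3 y1 y2 v1 v2 : C) (N : nat) :
  q <> 0 -> (Cmod q < 1)%R -> u1 <> 0 -> u2 <> 0 -> u3 <> 0 -> v1 <> 0 -> v2 <> 0 ->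
  qsep q (u2 / u1) -> qsep q (u3 / u1) -> qsep q (u3 / u2) -> qsep q (v2 / v1) ->
  qreg (v1 * u1) q -> qreg (v1 * u2) q -> qreg (v1 * u3) q ->
  qreg (v2 * u1) q -> qreg (v2 * u2) q -> qreg (v2 * u3) q ->
  sumC (resu q u1 u2 u3 x1 x2 x3 y1 y2 v1 v2 N) (S N) +
  sumC (resu q u2 u1 u3 x1 x2 x3 y1 y2 v1 v2 N) (S N) +
  sumC (resu q u3 u1 u2 x1 x2 x3 y1 y2 v1 v2 N) (S N) +
  sumC (resv q v1 v2 x1 x2 x3 y1 y2 u1 u2 u3 N) N +
  sumC (resv q v2 v1 x1 x2 x3 y1 y2 u1 u2 u3 N) N = 0.
Proof.
intros hq hq1 hu1 hu2 hu3 hv1 hv2 s21 s31 s32 sv r11 r12 r13 r21 r22 r23.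
assert (hqk := fun k => Cpow_nz q k hq).
pose (gu u k := / (u * q ^ k)). pose (gv v k := v * q ^ k).
pose (lu u := map (gu u) (seq 0 (S N))). pose (lv v := map (gv v) (seq 0 N)).
pose (l := lu u1 ++ lu u2 ++ lu u3 ++ lv v1 ++ lv v2).
(* A pair (al, be) stands for al - be t: [Lx] lists the factors 1 - x q^j t, and [Ly] the factors t
   - y q^j. *)
pose (Lx (x : C) := map (fun j : nat => (RtoC 1, x * q ^ j)) (seq 0 N)).
pose (Ly (y : C) := map (fun j : nat => (- (y * q ^ j), - RtoC 1)) (seq 0 N)).
pose (L := Lx x1 ++ Lx x2 ++ Lx x3 ++ Ly y1 ++ Ly y2).
assert (huu : forall u w : C, u <> 0 -> w <> 0 -> qsep q (w / u) ->
   forall j k, gu u j <> gu w k).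
{ intros u w hu hw h j k e. apply (h k j).
  replace (q ^ j) with (/ u * / (gu u j)) by (unfold gu; field; repeat split; auto using C1_nz).
  rewrite e. unfold gu. field. repeat split; auto using C1_nz. }
assert (hvv : forall j k, gv v1 j <> gv v2 k).
{ intros j k e. apply (sv k j).
  replace (q ^ j) with (/ v1 * gv v1 j) by (unfold gv; field; auto).
  rewrite e. unfold gv. field. auto. }
assert (huv : forall u v : C, u <> 0 -> qreg (v * u) q -> forall j k, gu u j <> gv v k).
{ intros u v hu h j k e. apply (h (S (j + k))). simpl.
  replace (v * u * q ^ (j + k)) with (u * q ^ j * gv v k) by (unfold gv; rewrite Cpow_add_r; ring).
  rewrite <- e. unfold gu. replace (u * q ^ j * / (u * q ^ j)) with (RtoC 1) by (field; auto). ring. }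
assert (hgu : forall (u : C) k, u <> 0 -> gu u k <> 0).
{ intros u k hu e. apply C1_nz. replace (RtoC 1) with (gu u k * (u * q ^ k)) by (unfold gu; field; repeat split; auto using C1_nz).
  rewrite e. ring. }
assert (hgv : forall (v : C) k, v <> 0 -> gv v k <> 0) by (intros; unfold gv; apply Cmult_neq_0; auto).
assert (inu : forall u t, In t (lu u) -> exists k, (k < S N)%nat /\ t = gu u k).
{ intros u t h. apply in_map_iff in h. destruct h as (k & e & hk). apply in_seq in hk.
  exists k. split; [lia|auto]. }
assert (inv : forall v t, In t (lv v) -> exists k, (k < N)%nat /\ t = gv v k).
{ intros v t h. apply in_map_iff in h. destruct h as (k & e & hk). apply in_seq in hk.
  exists k. split; [lia|auto]. }
assert (injv : forall v : C, v <> 0 -> forall j k, gv v j = gv v k -> j = k).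
{ intros v hv j k e. apply (qpow_inj q); auto.
  replace (q ^ j) with (/ v * gv v j) by (unfold gv; field; auto). rewrite e. unfold gv. field. auto. }
assert (inju : forall u : C, u <> 0 -> forall j k, gu u j = gu u k -> j = k).
{ intros u hu j k e. apply (qpow_inj q); auto.
  replace (q ^ j) with (/ u * / gu u j) by (unfold gu; field; repeat split; auto using C1_nz). rewrite e. unfold gu. field. repeat split; auto using C1_nz. }
assert (hd : NoDup l).
{ unfold l. repeat apply NoDup_app; try (unfold lu, lv; apply NoDup_seq_map; first [now apply inju|now apply injv]).
  - intros t h1 h2. apply inv in h1, h2. destruct h1 as (j & _ & ->). destruct h2 as (k & _ & h2).
    now apply hvv in h2.
  - intros t h1 h2. apply in_app_iff in h2. apply inu in h1. destruct h1 as (j & _ & ->).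
    destruct h2 as [h2|h2]; apply inv in h2; destruct h2 as (k & _ & h2); revert h2; apply huv; auto.
  - intros t h1 h2. apply inu in h1. destruct h1 as (j & _ & ->). rewrite !in_app_iff in h2.
    destruct h2 as [h2|[h2|h2]].
    + apply inu in h2. destruct h2 as (k & _ & h2). revert h2. now apply huu.
    + apply inv in h2; destruct h2 as (k & _ & h2); revert h2; apply huv; auto.
    + apply inv in h2; destruct h2 as (k & _ & h2); revert h2; apply huv; auto.
  - intros t h1 h2. apply inu in h1. destruct h1 as (j & _ & ->). rewrite !in_app_iff in h2.
    destruct h2 as [h2|[h2|[h2|h2]]].
    + apply inu in h2. destruct h2 as (k & _ & h2). revert h2. now apply huu.
    + apply inu in h2. destruct h2 as (k & _ & h2). revert h2. now apply huu.
    + apply inv in h2; destruct h2 as (k & _ & h2); revert h2; apply huv; auto.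
    + apply inv in h2; destruct h2 as (k & _ & h2); revert h2; apply huv; auto. }
(* There are 5N numerator factors and 3(N + 1) + 2N poles: the extra factor in each of the three u
   products supplies the decay at infinity. *)
assert (hl : (length L + 2 <= length l)%nat).
{ unfold L, l, Lx, Ly, lu, lv. rewrite !length_app, !length_map, !length_seq. lia. }
assert (R := residue_sum L l hl hd).
set (f x := prodL (fun p => fst p - snd p * x) L) in *.
assert (hf : forall t : C, t <> 0 -> f t = qprod (x1 * t) q N * qprod (x2 * t) q N * qprod (x3 * t) q N *
   (t ^ N * qprod (y1 / t) q N) * (t ^ N * qprod (y2 / t) q N)).
{ intros t ht. unfold f, L, Lx, Ly. rewrite !prodL_app, !prodL_map_seq.
  assert (hx : forall x, prodN (fun k => fst (RtoC 1, x * q ^ k) - snd (RtoC 1, x * q ^ k) * t) N = qprod (x * t) q N).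
  { intros x. rewrite qprod_prodN. apply prodN_ext. intros k _. simpl. ring. }
  assert (hy : forall y, prodN (fun k => fst (- (y * q ^ k), - RtoC 1) - snd (- (y * q ^ k), - RtoC 1) * t) N =
     t ^ N * qprod (y / t) q N).
  { intros y. rewrite qprod_prodN, <- (prodN_const t N), <- prodN_mult. apply prodN_ext. intros k _. simpl. field. auto. }
  rewrite !hx, !hy. ring. }
set (A1 := uconst q u1 (S N)). set (A2 := uconst q u2 (S N)). set (A3 := uconst q u3 (S N)).
assert (hA1 : A1 <> 0) by now apply uconst_neq0. assert (hA2 : A2 <> 0) by now apply uconst_neq0.
assert (hA3 : A3 <> 0) by now apply uconst_neq0.
assert (hl' : forall t, lagw l t = / (prodL (dsub t) (lu u1) * prodL (dsub t) (lu u2) * prodL (dsub t) (lu u3) *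
   prodL (dsub t) (lv v1) * prodL (dsub t) (lv v2))).
{ intros t. unfold lagw, l. rewrite !prodL_app. f_equal. ring. }
assert (rmul : forall x y : C, x * y <> 0 -> y <> 0).
{ intros x y h e. apply h. rewrite e. ring. }
assert (lmul : forall x y : C, x * y <> 0 -> x <> 0).
{ intros x y h e. apply h. rewrite e. ring. }
assert (Tu : forall (u u' u'' : C) k, u <> 0 -> u' <> 0 -> u'' <> 0 -> (k < S N)%nat ->
   (forall j, gu u k <> gu u' j) -> (forall j, gu u k <> gu u'' j) ->
   (forall j, gu u k <> gv v1 j) -> (forall j, gu u k <> gv v2 j) ->
   f (gu u k) * / (prodL (dsub (gu u k)) (lu u) * prodL (dsub (gu u k)) (lu u') * prodL (dsub (gu u k)) (lu u'') *
     prodL (dsub (gu u k)) (lv v1) * prodL (dsub (gu u k)) (lv v2)) =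
   / (uconst q u (S N) * uconst q u' (S N) * uconst q u'' (S N)) *
     resu q u u' u'' x1 x2 x3 y1 y2 v1 v2 N k).
{ intros u u' u'' k hu hu' hu'' hk n1 n2 n3 n4.
  assert (t0 := hgu u k hu).
  assert (p0 := prodL_dsub_neq0 (lu u) (gu u k)).
  assert (p1 := prodL_dsub_neq0 (lu u') (gu u k)).
  assert (p2 := prodL_dsub_neq0 (lu u'') (gu u k)).
  assert (p3 := prodL_dsub_neq0 (lv v1) (gu u k)).
  assert (p4 := prodL_dsub_neq0 (lv v2) (gu u k)).
  assert (e0 : prodL (dsub (gu u k)) (lu u) = uconst q u (S N) * - (u * q ^ k) * (qprod (/ q ^ k) q k * qprod q q (S N - 1 - k)))
    by exact (prodL_u_own q u k (S N) hq hq1 hu hk).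
  assert (e1 : prodL (dsub (gu u k)) (lu u') = uconst q u' (S N) * qprod (u' * gu u k) q (S N))
    by exact (prodL_u q u' _ (S N) hq hu' n1).
  assert (e2 : prodL (dsub (gu u k)) (lu u'') = uconst q u'' (S N) * qprod (u'' * gu u k) q (S N))
    by exact (prodL_u q u'' _ (S N) hq hu'' n2).
  assert (e3 : prodL (dsub (gu u k)) (lv v1) = gu u k ^ N * qprod (v1 / gu u k) q N)
    by exact (prodL_v q v1 _ N hq t0 n3).
  assert (e4 : prodL (dsub (gu u k)) (lv v2) = gu u k ^ N * qprod (v2 / gu u k) q N)
    by exact (prodL_v q v2 _ N hq t0 n4).
  rewrite e0 in p0 |- *. rewrite e1 in p1 |- *. rewrite e2 in p2 |- *. rewrite e3 in p3 |- *. rewrite e4 in p4 |- *.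
  rewrite (hf _ t0). unfold resu. fold (gu u k).
  replace (S N - 1 - k)%nat with (N - k)%nat in * by lia.
  assert (ei : forall y, y * (u * q ^ k) = y / gu u k) by (intros y; unfold gu; field; repeat split; auto using C1_nz).
  rewrite !ei. replace (u * q ^ k) with (/ gu u k) in * by (unfold gu; field; repeat split; auto using C1_nz).
  apply rmul in p1, p2, p3, p4. assert (p0' := rmul _ _ p0).
  assert (q1 := rmul _ _ p0'). assert (q2 := lmul _ _ p0').
  assert (z1 := uconst_neq0 q u (S N) hq hu). assert (z2 := uconst_neq0 q u' (S N) hq hu').
  assert (z3 := uconst_neq0 q u'' (S N) hq hu''). assert (z4 := Cpow_nz (gu u k) N t0).
  set (Z1 := uconst q u (S N)) in *. set (Z2 := uconst q u' (S N)) in *. set (Z3 := uconst q u'' (S N)) in *.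
  set (t := gu u k) in *.
  clearbody Z1 Z2 Z3 t.
  field. repeat split; auto. }
assert (Tv : forall (v v' : C) k, v <> 0 -> v' <> 0 -> (k < N)%nat ->
   (forall j, gv v k <> gv v' j) ->
   (forall j, gv v k <> gu u1 j) -> (forall j, gv v k <> gu u2 j) -> (forall j, gv v k <> gu u3 j) ->
   f (gv v k) * / (prodL (dsub (gv v k)) (lu u1) * prodL (dsub (gv v k)) (lu u2) * prodL (dsub (gv v k)) (lu u3) *
     prodL (dsub (gv v k)) (lv v) * prodL (dsub (gv v k)) (lv v')) =
   / (A1 * A2 * A3) * resv q v v' x1 x2 x3 y1 y2 u1 u2 u3 N k).
{ intros v v' k hv hv' hk n0 n1 n2 n3.
  assert (t0 := hgv v k hv).
  assert (p0 := prodL_dsub_neq0 (lv v) (gv v k)).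
  assert (p1 := prodL_dsub_neq0 (lu u1) (gv v k)).
  assert (p2 := prodL_dsub_neq0 (lu u2) (gv v k)).
  assert (p3 := prodL_dsub_neq0 (lu u3) (gv v k)).
  assert (p4 := prodL_dsub_neq0 (lv v') (gv v k)).
  assert (e0 : prodL (dsub (gv v k)) (lv v) = gv v k ^ N * / gv v k * (qprod (/ q ^ k) q k * qprod q q (N - 1 - k)))
    by exact (prodL_v_own q v k N hq hq1 hv hk).
  assert (e1 : prodL (dsub (gv v k)) (lu u1) = A1 * qprod (u1 * gv v k) q (S N))
    by exact (prodL_u q u1 _ (S N) hq hu1 n1).
  assert (e2 : prodL (dsub (gv v k)) (lu u2) = A2 * qprod (u2 * gv v k) q (S N))
    by exact (prodL_u q u2 _ (S N) hq hu2 n2).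
  assert (e3 : prodL (dsub (gv v k)) (lu u3) = A3 * qprod (u3 * gv v k) q (S N))
    by exact (prodL_u q u3 _ (S N) hq hu3 n3).
  assert (e4 : prodL (dsub (gv v k)) (lv v') = gv v k ^ N * qprod (v' / gv v k) q N)
    by exact (prodL_v q v' _ N hq t0 n0).
  rewrite e0 in p0 |- *. rewrite e1 in p1 |- *. rewrite e2 in p2 |- *. rewrite e3 in p3 |- *. rewrite e4 in p4 |- *.
  rewrite (hf _ t0). unfold resv. fold (gv v k).
  apply rmul in p1, p2, p3, p4. assert (p0' := rmul _ _ p0).
  assert (q1 := rmul _ _ p0'). assert (q2 := lmul _ _ p0').
  assert (z4 := Cpow_nz (gv v k) N t0).
  set (t := gv v k) in *.
  clearbody A1 A2 A3 t.
  field. repeat split; auto. }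
assert (su : qsep q (u1 / u2) /\ qsep q (u1 / u3) /\ qsep q (u2 / u3)).
{ assert (H : forall a b : C, a <> 0 -> b <> 0 -> qsep q (a / b) -> qsep q (b / a)).
  { intros x y hx hy h j k e. apply (h k j). rewrite <- e. field. auto. }
  repeat split; apply H; auto. }
destruct su as (s12 & s13 & s23).
set (F := fun x => f x * lagw l x) in R.
assert (sl : forall u, sumL F (lu u) = sumC (fun k => F (gu u k)) (S N)) by (intros; apply sumL_map_seq).
assert (sl' : forall v, sumL F (lv v) = sumC (fun k => F (gv v k)) N) by (intros; apply sumL_map_seq).
assert (R' : sumL F (lu u1 ++ lu u2 ++ lu u3 ++ lv v1 ++ lv v2) = 0) by exact R.
rewrite !sumL_app, !sl, !sl' in R'. clear R.
set (I := / (A1 * A2 * A3)) in *.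
assert (E1 : sumC (fun k => F (gu u1 k)) (S N) = I * sumC (resu q u1 u2 u3 x1 x2 x3 y1 y2 v1 v2 N) (S N)).
{ rewrite <- sumC_scal. apply sumC_ext. intros k hk. unfold F. rewrite hl'. apply Tu; auto. }
assert (E2 : sumC (fun k => F (gu u2 k)) (S N) = I * sumC (resu q u2 u1 u3 x1 x2 x3 y1 y2 v1 v2 N) (S N)).
{ rewrite <- sumC_scal. apply sumC_ext. intros k hk. unfold F. rewrite hl'.
  rewrite (Cmult_comm (prodL (dsub (gu u2 k)) (lu u1))).
  unfold I, A1. rewrite (Cmult_comm (uconst q u1 (S N))). apply Tu; auto. }
assert (E3 : sumC (fun k => F (gu u3 k)) (S N) = I * sumC (resu q u3 u1 u2 x1 x2 x3 y1 y2 v1 v2 N) (S N)).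
{ rewrite <- sumC_scal. apply sumC_ext. intros k hk. unfold F. rewrite hl'.
  rewrite (Cmult_comm (_ * _) (prodL (dsub (gu u3 k)) (lu u3))), Cmult_assoc.
  unfold I, A1. rewrite (Cmult_comm (_ * _) A3), Cmult_assoc. apply Tu; auto. }
assert (E4 : sumC (fun k => F (gv v1 k)) N = I * sumC (resv q v1 v2 x1 x2 x3 y1 y2 u1 u2 u3 N) N).
{ rewrite <- sumC_scal. apply sumC_ext. intros k hk. unfold F. rewrite hl'. apply Tv; auto.
  all: intros j e; symmetry in e; revert e; apply huv; auto. }
assert (E5 : sumC (fun k => F (gv v2 k)) N = I * sumC (resv q v2 v1 x1 x2 x3 y1 y2 u1 u2 u3 N) N).
{ rewrite <- sumC_scal. apply sumC_ext. intros k hk. unfold F. rewrite hl'.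
  rewrite <- (Cmult_assoc _ (prodL _ (lv v1))), (Cmult_comm (prodL _ (lv v1))), Cmult_assoc.
  apply Tv; auto.
  all: intros j e; symmetry in e; revert e; first [apply huv|apply hvv]; auto. }
rewrite E1, E2, E3, E4, E5 in R'.
assert (hA : A1 * A2 * A3 <> 0) by exact (Cmult_neq_0 _ _ (Cmult_neq_0 _ _ hA1 hA2) hA3).
match goal with |- ?x = RtoC 0 => replace x with ((A1 * A2 * A3) * (I * x)) by (unfold I; clearbody A1 A2 A3; field; auto) end.
match goal with |- ?a * (I * ?x) = RtoC 0 => replace (I * x) with (RtoC 0); [ring|] end.
rewrite <- R'. ring.
Qed.

(** * Passage to the limit in the residue sums *)

Definition h55 (x1 x2 x3 x4 x5 y1 y2 y3 y4 y5 q : C) (k : nat) : C :=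
  qprod x1 q k * qprod x2 q k * qprod x3 q k * qprod x4 q k * qprod x5 q k /
  (qprod y1 q k * qprod y2 q k * qprod y3 q k * qprod y4 q k * qprod y5 q k).

Definition h55inf (x1 x2 x3 x4 x5 y1 y2 y3 y4 y5 q : C) : C :=
  qpoch_inf x1 q * qpoch_inf x2 q * qpoch_inf x3 q * qpoch_inf x4 q * qpoch_inf x5 q /
  (qpoch_inf y1 q * qpoch_inf y2 q * qpoch_inf y3 q * qpoch_inf y4 q * qpoch_inf y5 q).

Lemma Cinv_mult_5 (a b c d e : C) : a <> 0 -> b <> 0 -> c <> 0 -> d <> 0 -> e <> 0 ->
  / (a * b * c * d * e) = / a * / b * / c * / d * / e.
Proof. intros. field. auto. Qed.

Lemma h55_bdd (x1 x2 x3 x4 x5 y1 y2 y3 y4 y5 q : C) : (Cmod q < 1)%R ->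
  qreg y1 q -> qreg y2 q -> qreg y3 q -> qreg y4 q -> qreg y5 q ->
  bddC (h55 x1 x2 x3 x4 x5 y1 y2 y3 y4 y5 q).
Proof.
intros hq r1 r2 r3 r4 r5.
apply (bddC_ext (fun k => qprod x1 q k * qprod x2 q k * qprod x3 q k * qprod x4 q k * qprod x5 q k *
   (/ qprod y1 q k * / qprod y2 q k * / qprod y3 q k * / qprod y4 q k * / qprod y5 q k))).
- intros k. unfold h55, Cdiv. rewrite Cinv_mult_5 by auto. reflexivity.
- repeat apply bddC_mult; auto using bddC_qprod, bddC_inv_qprod.
Qed.

(** The first k factors are reversed; the other N - k have a base free of k, so N can tend to
    infinity. *)
Lemma qprod_div_pow_split (X q : C) (k N : nat) : X <> 0 -> q <> 0 -> (k <= N)%nat ->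
  qprod (X / q ^ k) q N =
  (X / q ^ k) ^ k * qsign q k * qprod (q / X) q k * qprod X q (N - k).
Proof.
intros hX hq hk. assert (hqk := Cpow_nz q k hq).
assert (h := qprod_div_pow X q k k hX hq (le_n k)).
rewrite Nat.sub_diag in h. change (qprod (q / X) q 0) with (RtoC 1) in h.
rewrite Cmult_1_r in h. rewrite <- h.
replace (qprod X q (N - k)) with (qprod (X / q ^ k * q ^ k) q (N - k)).
- rewrite <- qprod_add. f_equal. lia.
- f_equal. field. exact hqk.
Qed.

Lemma qprod_shift_eq (w q : C) (k N : nat) : qprod w q k <> 0 ->
  qprod (w * q ^ k) q N = qprod w q (N + k) / qprod w q k.
Proof. intros h. rewrite Nat.add_comm, qprod_add. field. exact h. Qed.

(** Tannery's theorem for residues: [A] collects the products whose length grows with n, and H k q^k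
    what depends on k alone. *)
Lemma weighted_limit (q c L : C) (A : nat -> nat -> C) (H : nat -> C) (f : nat -> nat -> C)
  (len : nat -> nat) :
  (Cmod q < 1)%R -> (forall n, (n <= len n)%nat) ->
  (exists M, forall n k, (Cmod (A n k) <= M)%R) -> bddC H ->
  (forall k, cvgC (fun n => A n k) L) ->
  (forall n k, (k < len n)%nat -> f n k = c * A n k * (H k * q ^ k)) ->
  ex_Cseries (fun k => H k * q ^ k) /\
  cvgC (fun n => sumC (f n) (len n)) (c * L * Cseries (fun k => H k * q ^ k)).
Proof.
intros hq hlen [MA hA] [MH hH] hL hf.
assert (hr : (0 <= Cmod q < 1)%R) by (split; [apply Cmod_ge_0|exact hq]).
assert (ex : ex_Cseries (fun k => H k * q ^ k)).
{ apply (geom_dominated_ex _ MH (Cmod q) hr). intros k. rewrite Cmod_mult, Cmod_pow.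
  apply Rmult_le_compat_r; [apply pow_le, Cmod_ge_0|apply hH]. }
split; [exact ex|]. rewrite <- Cseries_scal by exact ex.
refine (proj2 (tannery_sum f _ (Cmod c * MA * MH) (Cmod q) len hlen hr _ _)).
- intros n k hk. rewrite hf by exact hk. rewrite !Cmod_mult, Cmod_pow, <- Rmult_assoc.
  apply Rmult_le_compat_r; [apply pow_le, Cmod_ge_0|].
  apply Rmult_le_compat; auto using Cmod_ge_0.
  + apply Rmult_le_pos; apply Cmod_ge_0.
  + apply Rmult_le_compat_l; [apply Cmod_ge_0|apply hA].
- intros k. apply (cvgC_ext_ev (fun n => c * A n k * (H k * q ^ k)) _ _ (S k)).
  + intros n hn. symmetry. apply hf. specialize (hlen n). lia.
  + apply cvgC_mult; [|apply cvgC_const]. apply cvgC_mult; [apply cvgC_const|apply hL].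
Qed.

Definition bdd2 (A : nat -> nat -> C) : Prop := exists M, forall n k, (Cmod (A n k) <= M)%R.

Lemma bdd2_mult (A B : nat -> nat -> C) : bdd2 A -> bdd2 B -> bdd2 (fun n k => A n k * B n k).
Proof.
intros [M h] [N k]. exists (M * N)%R. intros n m. rewrite Cmod_mult.
apply Rmult_le_compat; auto using Cmod_ge_0.
Qed.

Lemma bdd2_comp (u : nat -> C) (g : nat -> nat -> nat) : bddC u -> bdd2 (fun n k => u (g n k)).
Proof. intros [M h]. exists M. intros n k. apply h. Qed.

Lemma cvgC_qprod_inf (x q : C) (g : nat -> nat) (j : nat) : (Cmod q < 1)%R ->
  (forall n, (n - j <= g n)%nat) -> cvgC (fun n => qprod x q (g n)) (qpoch_inf x q).
Proof.
intros hq hg eps he. destruct (cvgC_qpoch_inf x q hq eps he) as [N HN].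
exists (N + j)%nat. intros n hn. apply HN. specialize (hg n). lia.
Qed.

(** Reversing the products at t = 1/(u q^k) leaves powers that the condition on x1 x2 x3 collapses
    to q^(2k); together with the prefactor 1/(u q^k) this gives a series of argument q. *)
Lemma resu_limit (q u u' u'' x1 x2 x3 y1 y2 v1 v2 : C) :
  q <> 0 -> (Cmod q < 1)%R -> u <> 0 -> u' <> 0 -> u'' <> 0 ->
  x1 <> 0 -> x2 <> 0 -> x3 <> 0 -> x1 * x2 * x3 = q * q * (u * u' * u'') ->
  qreg (u' / u) q -> qreg (u'' / u) q -> qreg (q * u / u') q -> qreg (q * u / u'') q ->
  qreg (v1 * u) q -> qreg (v2 * u) q -> qreg (y1 * u) q -> qreg (y2 * u) q ->
  let H := h55 (q * u / x1) (q * u / x2) (q * u / x3) (v1 * u) (v2 * u)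
               q (q * u / u') (q * u / u'') (y1 * u) (y2 * u) q in
  ex_Cseries (fun k => H k * q ^ k) /\
  cvgC (fun N => sumC (resu q u u' u'' x1 x2 x3 y1 y2 v1 v2 N) (S N))
   (- / u * h55inf (x1 / u) (x2 / u) (x3 / u) (y1 * u) (y2 * u)
               q (u' / u) (u'' / u) (v1 * u) (v2 * u) q *
    Cseries (fun k => H k * q ^ k)).
Proof.
intros hq hq1 hu hu' hu'' hx1 hx2 hx3 hx r1 r2 r3 r4 r5 r6 r7 r8 H.
assert (rq : qreg q q) by (intros k; now apply qprod_q_neq0).
pose (A N k := qprod (x1 / u) q (N - k) * qprod (x2 / u) q (N - k) * qprod (x3 / u) q (N - k) *
   qprod (y1 * u) q (N + k) * qprod (y2 * u) q (N + k) *
   (/ qprod q q (N - k) * / qprod (u' / u) q (S N - k) * / qprod (u'' / u) q (S N - k) *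
    / qprod (v1 * u) q (N + k) * / qprod (v2 * u) q (N + k))).
apply (weighted_limit q (- / u) _ A H).
- exact hq1.
- intros n; lia.
- unfold A. repeat apply bdd2_mult;
  match goal with
  | |- bdd2 (fun N k => qprod ?x ?q (@?g N k)) => apply (bdd2_comp (qprod x q) g); now apply bddC_qprod
  | |- bdd2 (fun N k => / qprod ?x ?q (@?g N k)) => apply (bdd2_comp (fun n => / qprod x q n) g); now apply bddC_inv_qprod
  end.
- apply h55_bdd; auto.
- intros k. unfold h55inf, Cdiv at 1.
  rewrite Cinv_mult_5 by now apply qpoch_inf_neq0.
  unfold A. repeat apply cvgC_mult;
  try (apply cvgC_inv; [now apply qpoch_inf_neq0|]);
  (apply (cvgC_qprod_inf _ _ _ k); [exact hq1|intros n; lia]).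
- intros N k hk. unfold resu, A, H, h55.
  assert (hk' : (k <= N)%nat) by lia.
  assert (hqk := Cpow_nz q k hq).
  assert (ex : forall x, x * / (u * q ^ k) = x / u / q ^ k) by (intros x; field; auto).
  rewrite !ex.
  rewrite (qprod_div_pow_split (x1 / u) q k N) by auto using neq0_div.
  rewrite (qprod_div_pow_split (x2 / u) q k N) by auto using neq0_div.
  rewrite (qprod_div_pow_split (x3 / u) q k N) by auto using neq0_div.
  rewrite (qprod_div_pow_split (u' / u) q k (S N)) by auto using neq0_div.
  rewrite (qprod_div_pow_split (u'' / u) q k (S N)) by auto using neq0_div.
  replace (/ q ^ k) with (1 / q ^ k) by (field; auto).
  rewrite (qprod_div_pow_split 1 q k k) by auto using C1_nz.
  rewrite Nat.sub_diag. change (qprod 1 q 0) with (RtoC 1).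
  replace (q / 1) with q by (field; exact C1_nz).
  rewrite !Cmult_assoc.
  rewrite !qprod_shift_eq by auto.
  replace (q / (x1 / u)) with (q * u / x1) by (field; auto).
  replace (q / (x2 / u)) with (q * u / x2) by (field; auto).
  replace (q / (x3 / u)) with (q * u / x3) by (field; auto).
  replace (q / (u' / u)) with (q * u / u') by (field; auto).
  replace (q / (u'' / u)) with (q * u / u'') by (field; auto).
  assert (hp : (x1 / u / q ^ k) ^ k * (x2 / u / q ^ k) ^ k * (x3 / u / q ^ k) ^ k =
     (u' / u / q ^ k) ^ k * (u'' / u / q ^ k) ^ k * (1 / q ^ k) ^ k * (q ^ k * q ^ k)).
  { rewrite <- !Cpow_mult_l. f_equal.
    replace (x1 / u / q ^ k * (x2 / u / q ^ k) * (x3 / u / q ^ k)) with (x1 * x2 * x3 / (u * u * u) / (q ^ k * q ^ k * q ^ k)) by (field; auto).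
    rewrite hx. field. auto. }
  assert (n1 : (u' / u / q ^ k) ^ k <> 0) by auto using Cpow_nz, neq0_div.
  assert (n2 : (u'' / u / q ^ k) ^ k <> 0) by auto using Cpow_nz, neq0_div.
  assert (n3 : (1 / q ^ k) ^ k <> 0) by auto using Cpow_nz, neq0_div, C1_nz.
  assert (n4 := qsign_neq0 q k hq).
  assert (g1 := r1 (S N - k)%nat). assert (g2 := r2 (S N - k)%nat).
  assert (g3 := r3 k). assert (g4 := r4 k). assert (g5 := r5 (N + k)%nat). assert (g6 := r6 (N + k)%nat).
  assert (g7 := r7 k). assert (g8 := r8 k). assert (g9 := rq k). assert (g10 := rq (N - k)%nat).
  assert (g11 := r5 k). assert (g12 := r6 k).
  set (P1 := (x1 / u / q ^ k) ^ k) in *. set (P2 := (x2 / u / q ^ k) ^ k) in *.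
  set (P3 := (x3 / u / q ^ k) ^ k) in *. set (P4 := (u' / u / q ^ k) ^ k) in *.
  set (P5 := (u'' / u / q ^ k) ^ k) in *. set (P6 := (1 / q ^ k) ^ k) in *.
  set (Q1 := qprod (q * u / x1) q k) in *. set (Q2 := qprod (q * u / x2) q k) in *.
  set (Q3 := qprod (q * u / x3) q k) in *.
  set (R1 := qprod (x1 / u) q (N - k)) in *. set (R2 := qprod (x2 / u) q (N - k)) in *.
  set (R3 := qprod (x3 / u) q (N - k)) in *.
  set (B1 := qprod (u' / u) q (S N - k)) in *. set (B2 := qprod (u'' / u) q (S N - k)) in *.
  set (B3 := qprod (q * u / u') q k) in *. set (B4 := qprod (q * u / u'') q k) in *.
  set (B5 := qprod (v1 * u) q (N + k)) in *. set (B6 := qprod (v2 * u) q (N + k)) in *.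
  set (B7 := qprod (y1 * u) q k) in *. set (B8 := qprod (y2 * u) q k) in *.
  set (B9 := qprod q q k) in *. set (B10 := qprod q q (N - k)) in *.
  set (B11 := qprod (v1 * u) q k) in *. set (B12 := qprod (v2 * u) q k) in *.
  set (B13 := qprod (y1 * u) q (N + k)) in *. set (B14 := qprod (y2 * u) q (N + k)) in *.
  clearbody P1 P2 P3 P4 P5 P6 Q1 Q2 Q3 R1 R2 R3 B1 B2 B3 B4 B5 B6 B7 B8 B9 B10 B11 B12 B13 B14.
  set (K := q ^ k) in *. clearbody K.
  transitivity (- / u * (P1 * P2 * P3 / (P4 * P5 * P6 * K) *
     (Q1 * Q2 * Q3 * R1 * R2 * R3 * B13 * B14 * B11 * B12 / (B1 * B2 * B3 * B4 * B5 * B6 * B7 * B8 * B9 * B10)))).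
  + cfield.
  + rewrite hp. cfield.
Qed.

(** Here y1 y2 = v v' makes the powers from the reversals cancel completely, and the argument q
    comes from the prefactor v q^k. *)
Lemma resv_limit (q v v' x1 x2 x3 y1 y2 u1 u2 u3 : C) :
  q <> 0 -> (Cmod q < 1)%R -> v <> 0 -> v' <> 0 -> y1 <> 0 -> y2 <> 0 -> y1 * y2 = v * v' ->
  qreg (v' / v) q -> qreg (q * v / v') q ->
  qreg (u1 * v) q -> qreg (u2 * v) q -> qreg (u3 * v) q ->
  qreg (x1 * v) q -> qreg (x2 * v) q -> qreg (x3 * v) q ->
  let H := h55 (q * v / y1) (q * v / y2) (u1 * v) (u2 * v) (u3 * v)
               q (q * v / v') (x1 * v) (x2 * v) (x3 * v) q in
  ex_Cseries (fun k => H k * q ^ k) /\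
  cvgC (fun N => sumC (resv q v v' x1 x2 x3 y1 y2 u1 u2 u3 N) N)
   (v * h55inf (x1 * v) (x2 * v) (x3 * v) (y1 / v) (y2 / v)
               q (v' / v) (u1 * v) (u2 * v) (u3 * v) q *
    Cseries (fun k => H k * q ^ k)).
Proof.
intros hq hq1 hv hv' hy1 hy2 hy r1 r2 r3 r4 r5 r6 r7 r8 H.
assert (rq : qreg q q) by (intros k; now apply qprod_q_neq0).
pose (A N k := qprod (x1 * v) q (N + k) * qprod (x2 * v) q (N + k) * qprod (x3 * v) q (N + k) *
   qprod (y1 / v) q (N - k) * qprod (y2 / v) q (N - k) *
   (/ qprod q q (N - 1 - k) * / qprod (v' / v) q (N - k) * / qprod (u1 * v) q (S N + k) *
    / qprod (u2 * v) q (S N + k) * / qprod (u3 * v) q (S N + k))).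
apply (weighted_limit q v _ A H _ (fun N => N)).
- exact hq1.
- intros n; lia.
- unfold A. repeat apply bdd2_mult;
  match goal with
  | |- bdd2 (fun N k => qprod ?x ?q (@?g N k)) => apply (bdd2_comp (qprod x q) g); now apply bddC_qprod
  | |- bdd2 (fun N k => / qprod ?x ?q (@?g N k)) => apply (bdd2_comp (fun n => / qprod x q n) g); now apply bddC_inv_qprod
  end.
- apply h55_bdd; auto.
- intros k. unfold h55inf, Cdiv at 1.
  rewrite Cinv_mult_5 by now apply qpoch_inf_neq0.
  unfold A. repeat apply cvgC_mult;
  try (apply cvgC_inv; [now apply qpoch_inf_neq0|]);
  (apply (cvgC_qprod_inf _ _ _ (S k)); [exact hq1|intros n; lia]).
- intros N k hk. unfold resv, A, H, h55.
  assert (hk' : (k <= N)%nat) by lia.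
  assert (hqk := Cpow_nz q k hq).
  assert (ex : forall x, x / (v * q ^ k) = x / v / q ^ k) by (intros x; field; auto).
  rewrite !ex.
  rewrite (qprod_div_pow_split (y1 / v) q k N) by auto using neq0_div.
  rewrite (qprod_div_pow_split (y2 / v) q k N) by auto using neq0_div.
  rewrite (qprod_div_pow_split (v' / v) q k N) by auto using neq0_div.
  replace (/ q ^ k) with (1 / q ^ k) by (field; auto).
  rewrite (qprod_div_pow_split 1 q k k) by auto using C1_nz.
  rewrite Nat.sub_diag. change (qprod 1 q 0) with (RtoC 1).
  replace (q / 1) with q by (field; exact C1_nz).
  rewrite !Cmult_assoc.
  rewrite !qprod_shift_eq by auto.
  replace (q / (y1 / v)) with (q * v / y1) by (field; auto).
  replace (q / (y2 / v)) with (q * v / y2) by (field; auto).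
  replace (q / (v' / v)) with (q * v / v') by (field; auto).
  assert (hp : (y1 / v / q ^ k) ^ k * (y2 / v / q ^ k) ^ k =
     (v' / v / q ^ k) ^ k * (1 / q ^ k) ^ k).
  { rewrite <- !Cpow_mult_l. f_equal.
    replace (y1 / v / q ^ k * (y2 / v / q ^ k)) with (y1 * y2 / (v * v) / (q ^ k * q ^ k)) by (field; auto).
    rewrite hy. field. auto. }
  assert (n1 : (v' / v / q ^ k) ^ k <> 0) by auto using Cpow_nz, neq0_div.
  assert (n3 : (1 / q ^ k) ^ k <> 0) by auto using Cpow_nz, neq0_div, C1_nz.
  assert (n4 := qsign_neq0 q k hq).
  assert (g1 := r1 (N - k)%nat). assert (g2 := r2 k).
  assert (g3 := r3 k). assert (g4 := r4 k). assert (g5 := r5 k).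
  assert (g6 := r3 (S N + k)%nat). assert (g7 := r4 (S N + k)%nat). assert (g8 := r5 (S N + k)%nat).
  assert (g9 := rq k). assert (g10 := rq (N - 1 - k)%nat).
  assert (g11 := r6 k). assert (g12 := r7 k). assert (g13 := r8 k).
  set (P1 := (y1 / v / q ^ k) ^ k) in *. set (P2 := (y2 / v / q ^ k) ^ k) in *.
  set (P4 := (v' / v / q ^ k) ^ k) in *. set (P6 := (1 / q ^ k) ^ k) in *.
  set (Q1 := qprod (q * v / y1) q k) in *. set (Q2 := qprod (q * v / y2) q k) in *.
  set (R1 := qprod (y1 / v) q (N - k)) in *. set (R2 := qprod (y2 / v) q (N - k)) in *.
  set (B1 := qprod (v' / v) q (N - k)) in *. set (B2 := qprod (q * v / v') q k) in *.
  set (B3 := qprod (u1 * v) q k) in *. set (B4 := qprod (u2 * v) q k) in *.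
  set (B5 := qprod (u3 * v) q k) in *. set (B6 := qprod (u1 * v) q (S N + k)) in *.
  set (B7 := qprod (u2 * v) q (S N + k)) in *. set (B8 := qprod (u3 * v) q (S N + k)) in *.
  set (B9 := qprod q q k) in *. set (B10 := qprod q q (N - 1 - k)) in *.
  set (B11 := qprod (x1 * v) q k) in *. set (B12 := qprod (x2 * v) q k) in *.
  set (B13 := qprod (x3 * v) q k) in *.
  set (C1' := qprod (x1 * v) q (N + k)) in *. set (C2' := qprod (x2 * v) q (N + k)) in *.
  set (C3' := qprod (x3 * v) q (N + k)) in *.
  clearbody P1 P2 P4 P6 Q1 Q2 R1 R2 B1 B2 B3 B4 B5 B6 B7 B8 B9 B10 B11 B12 B13 C1' C2' C3'.
  set (K := q ^ k) in *. clearbody K.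
  transitivity (v * K * (P1 * P2 / (P4 * P6) *
     (Q1 * Q2 * R1 * R2 * C1' * C2' * C3' * B3 * B4 * B5 / (B1 * B2 * B6 * B7 * B8 * B9 * B10 * B11 * B12 * B13)))).
  + cfield.
  + rewrite hp. cfield.
Qed.

(** The five finite sums have limits by [resu_limit] and [resv_limit], and their total is 0 for
    every N. *)
Lemma residues_limit (q u1 u2 u3 x1 x2 x3 y1 y2 v1 v2 : C) :
  q <> 0 -> (Cmod q < 1)%R -> u1 <> 0 -> u2 <> 0 -> u3 <> 0 -> v1 <> 0 -> v2 <> 0 ->
  x1 <> 0 -> x2 <> 0 -> x3 <> 0 -> y1 <> 0 -> y2 <> 0 ->
  x1 * x2 * x3 = q * q * (u1 * u2 * u3) -> y1 * y2 = v1 * v2 ->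
  qsep q (u2 / u1) -> qsep q (u3 / u1) -> qsep q (u3 / u2) -> qsep q (v2 / v1) ->
  (forall u, In u [u1; u2; u3] -> qreg (v1 * u) q /\ qreg (v2 * u) q /\ qreg (y1 * u) q /\ qreg (y2 * u) q) ->
  (forall x, In x [x1; x2; x3] -> qreg (x * v1) q /\ qreg (x * v2) q) ->
  let Ru u u' u'' := - / u * h55inf (x1 / u) (x2 / u) (x3 / u) (y1 * u) (y2 * u)
               q (u' / u) (u'' / u) (v1 * u) (v2 * u) q *
    Cseries (fun k => h55 (q * u / x1) (q * u / x2) (q * u / x3) (v1 * u) (v2 * u)
               q (q * u / u') (q * u / u'') (y1 * u) (y2 * u) q k * q ^ k) in
  let Rv v v' := v * h55inf (x1 * v) (x2 * v) (x3 * v) (y1 / v) (y2 / v)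
               q (v' / v) (u1 * v) (u2 * v) (u3 * v) q *
    Cseries (fun k => h55 (q * v / y1) (q * v / y2) (u1 * v) (u2 * v) (u3 * v)
               q (q * v / v') (x1 * v) (x2 * v) (x3 * v) q k * q ^ k) in
  Ru u1 u2 u3 + Ru u2 u1 u3 + Ru u3 u1 u2 + Rv v1 v2 + Rv v2 v1 = 0.
Proof.
intros hq hq1 hu1 hu2 hu3 hv1 hv2 hx1 hx2 hx3 hy1 hy2 hx hy s21 s31 s32 sv hu hxv Ru Rv.
assert (sinv : forall a b : C, a <> 0 -> b <> 0 -> qsep q (a / b) -> qsep q (b / a)).
{ intros a b ha hb h j k e. apply (h k j). rewrite <- e. field. auto. }
assert (sreg : forall x, qsep q x -> qreg x q).
{ intros x h k. apply qprod_neq0. intros j _. exact (h j 0%nat). }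
assert (sreg' : forall a b : C, a <> 0 -> b <> 0 -> qsep q (a / b) -> qreg (q * b / a) q).
{ intros a b ha hb h k. apply qprod_neq0. intros j _ e. apply (h 0%nat (S j)).
  simpl. replace (q * q ^ j) with (q * b / a * q ^ j * (a / b)) by (field; auto). rewrite e. ring. }
destruct (hu u1 ltac:(simpl; auto)) as (a1 & a2 & a3 & a4).
destruct (hu u2 ltac:(simpl; auto)) as (b1 & b2 & b3 & b4).
destruct (hu u3 ltac:(simpl; auto)) as (c1 & c2 & c3 & c4).
destruct (hxv x1 ltac:(simpl; auto)) as (d1 & d2).
destruct (hxv x2 ltac:(simpl; auto)) as (d3 & d4).
destruct (hxv x3 ltac:(simpl; auto)) as (d5 & d6).
assert (comm : forall x y, qreg (x * y) q -> qreg (y * x) q) by (intros x y h; now rewrite Cmult_comm).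
apply (cvgC_unique (fun N =>
  sumC (resu q u1 u2 u3 x1 x2 x3 y1 y2 v1 v2 N) (S N) +
  sumC (resu q u2 u1 u3 x1 x2 x3 y1 y2 v1 v2 N) (S N) +
  sumC (resu q u3 u1 u2 x1 x2 x3 y1 y2 v1 v2 N) (S N) +
  sumC (resv q v1 v2 x1 x2 x3 y1 y2 u1 u2 u3 N) N +
  sumC (resv q v2 v1 x1 x2 x3 y1 y2 u1 u2 u3 N) N)).
- repeat apply cvgC_plus.
  + apply resu_limit; auto.
  + apply resu_limit; auto. rewrite hx. ring.
  + apply resu_limit; auto. rewrite hx. ring.
  + apply resv_limit; auto.
  + apply resv_limit; auto. rewrite hy. ring.
- apply (cvgC_ext (fun _ => 0)); [|apply cvgC_const].
  intros N. symmetry. apply residues_finite; auto.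
Qed.

(** * Watson's transformation for separated parameters *)

Lemma qsep_scale (q x y : C) (i j : nat) : q <> 0 -> qsep q x -> y * q ^ i = x * q ^ j -> qsep q y.
Proof.
intros hq h e m n E. apply (h (j + m)%nat (i + n)%nat).
rewrite !Cpow_add_r, Cmult_assoc, <- e, <- E. ring.
Qed.

Lemma qsep_inv (q x y : C) (i j : nat) : q <> 0 -> qsep q x -> y * x * q ^ i = q ^ j -> qsep q y.
Proof.
intros hq h e m n E. apply (h (i + n)%nat (j + m)%nat).
rewrite !Cpow_add_r, <- e. replace (q ^ n) with (y * q ^ m). ring.
Qed.

Lemma qsep_reg_div (q x : C) (m : nat) : q <> 0 -> qsep q x -> qreg (x / q ^ m) q.
Proof.
intros hq h. apply qsep_reg. apply (qsep_scale q x _ m 0); [exact hq|exact h|].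
simpl. field. now apply Cpow_nz.
Qed.

Lemma qsep_neq1 (q x : C) : qsep q x -> 1 - x <> 0.
Proof. intros h. apply sub_neq0. intros e. apply (h 0%nat 0%nat). simpl. rewrite <- e. ring. Qed.

Ltac sep_by H i j :=
  match type of H with qsep ?q ?x =>
  match goal with hq : q <> RtoC 0 |- _ =>
  first [apply (qsep_scale q x _ i j hq H); simpl; field; repeat split; assumption
        |apply (qsep_inv q x _ i j hq H); simpl; field; repeat split; assumption]
  end end.

(** Transfers separation to any monomial equal to the given one or to its inverse up to a power of
    q. The exponent 3 is reached for monomials with a^3 in [generic_shift]. *)
Ltac sepq H := first [exact H | sep_by H 0%nat 0%nat | sep_by H 0%nat 1%nat | sep_by H 1%nat 0%nat
  | sep_by H 0%nat 2%nat | sep_by H 2%nat 0%nat | sep_by H 0%nat 3%nat | sep_by H 3%nat 0%nat].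

(** [bailey_nonterminating] solved for the 8W7; separation supplies its regularity hypotheses,
    including those for all negative powers of q. *)
Lemma watson_qsep (q a b c d e f z v : C) :
  q <> 0 -> (Cmod q < 1)%R -> (Cmod z < 1)%R ->
  a <> 0 -> b <> 0 -> c <> 0 -> d <> 0 -> e <> 0 -> f <> 0 ->
  z = q * q * a * a / (b * c * d * e * f) -> v = b * c * d / (q * a) ->
  qsep q a -> qsep q (q * a / b) -> qsep q (q * a / c) -> qsep q (q * a / d) ->
  qsep q (q * a / e) -> qsep q (q * a / f) ->
  qsep q v -> qsep q z -> qsep q (q * a / (b * d)) -> qsep q (q * a / (c * d)) ->
  qsep q (z * e) -> qsep q (z * f) -> qsep q (a * z) -> qsep q d ->
  Cseries (fun k => w87 a b c d e f q k * z ^ k) =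
  qpoch_inf (q * a) q * qpoch_inf (q * a / (b * c)) q * qpoch_inf (q * a / (b * d)) q *
    qpoch_inf (q * a / (c * d)) q /
    (qpoch_inf (q * a / b) q * qpoch_inf (q * a / c) q * qpoch_inf (q * a / d) q * qpoch_inf (1 / v) q) *
    Cseries (fun k => h44 b c d (q * a / (e * f)) q (q * a / e) (q * a / f) (q * v) q k * q ^ k) +
  qpoch_inf (q * a) q * qpoch_inf (z * e) q * qpoch_inf (z * f) q * qpoch_inf b q * qpoch_inf c q *
    qpoch_inf d q * qpoch_inf (q * a / (e * f)) q /
    (qpoch_inf (q * a / b) q * qpoch_inf (q * a / c) q * qpoch_inf (q * a / d) q * qpoch_inf z q *
     qpoch_inf (q * a / e) q * qpoch_inf (q * a / f) q * qpoch_inf v q) *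
    Cseries (fun k => h44 (q * a / (b * c)) (q * a / (b * d)) (q * a / (c * d)) z
                          q (q / v) (z * e) (z * f) q k * q ^ k).
Proof.
intros hq hq1 hz1 ha hb hc hd he hf hz hv sa sb sc sd se sf sv sz sbd scd sze szf saz sdd.
assert (hz0 : z <> 0) by nz.
assert (hv0 : v <> 0) by nz.
assert (sv1 : qsep q (1 / v)) by sepq sv.
assert (sqv : qsep q (q * v)) by sepq sv.
assert (sqv' : qsep q (q / v)) by sepq sv.
assert (sqz : qsep q (q / z)) by sepq sz.
assert (sdb : qsep q (d * b / a)) by sepq sbd.
assert (sdc : qsep q (d * c / a)) by sepq scd.
assert (sda : qsep q (d / a)) by sepq sd.
assert (sqa : qsep q (q * a)) by sepq sa.
assert (R := qsep_reg q).
assert (B := bailey_nonterminating q a b c d e f z v hq hq1 hz1 ha hb hc hd he hf hz hv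
  (R _ sa) (R _ sb) (R _ sc) (R _ sd) (R _ se) (R _ sf)
  (fun m => qsep_reg_div _ _ m hq sv) (fun m => qsep_reg_div _ _ m hq sqz)
  (fun m => qsep_reg_div _ _ m hq sdb) (fun m => qsep_reg_div _ _ m hq sdc)
  (R _ sz) (R _ sv1) (R _ sze) (R _ szf) (R _ sbd) (R _ scd) (R _ saz)
  (fun m => qsep_reg_div _ _ m hq sdd) (fun m => qsep_reg_div _ _ m hq sda)).
set (SW := Cseries (fun k => w87 a b c d e f q k * z ^ k)) in *.
set (SU := Cseries (fun k => h44 b c d _ _ _ _ _ _ k * q ^ k)) in *.
set (SV := Cseries (fun k => h44 _ _ _ z _ _ _ _ _ k * q ^ k)) in *.
clearbody SW SU SV. unfold h44inf in B.
assert (I : forall x, qsep q x -> qpoch_inf x q <> 0) by (intros x h; apply qpoch_inf_neq0; [exact hq1|apply R, h]).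
assert (nq : qpoch_inf q q <> 0).
{ apply qpoch_inf_neq0; [exact hq1|intros k; now apply qprod_q_neq0]. }
assert (n1 := I _ sqa). assert (n2 := I _ sb). assert (n3 := I _ sc). assert (n4 := I _ sd).
assert (n5 := I _ se). assert (n6 := I _ sf). assert (n7 := I _ sz). assert (n8 := I _ sze).
assert (n9 := I _ szf). assert (n10 := I _ saz). assert (n11 := I _ sqv). assert (n12 := I _ sqv').
(* The prefactors v/(v - 1) and -1/(v - 1) complete (q/v;q)_oo and (qv;q)_oo to (1/v;q)_oo and
   (v;q)_oo. *)
assert (e1 := qpoch_inf_head v q hq1). replace (v * q) with (q * v) in e1 by ring.
assert (e2 := qpoch_inf_head (1 / v) q hq1). cast e2 (1 / v * q) (q / v).
assert (nv := qsep_neq1 _ _ sv). assert (nv1 := qsep_neq1 _ _ sv1).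
assert (nv' : v - 1 <> 0) by (intros e0; apply nv; replace (1 - v) with (- (v - 1)) by ring; rewrite e0; ring).
rewrite e1, e2.
set (Q1 := qpoch_inf (q * a) q) in *.
set (Q7 := qpoch_inf z q) in *.
set (Q10 := qpoch_inf (a * z) q) in *.
set (Q0 := qpoch_inf q q) in *.
clearbody Q0 Q1 Q7 Q10.
replace SW with (Q7 * Q10 / (Q0 * Q1) * SW / (Q7 * Q10 / (Q0 * Q1))) by (field; auto).
rewrite B. clear - hv0 nv nv1 nv' nq n1 n2 n3 n4 n5 n6 n7 n8 n9 n10 n11 n12.
cfield.
Qed.

(** * The addition formula for theta functions *)

Set Implicit Arguments.

(** No relevant monomial of the parameters is an integer power of [q].  Each
    monomial has positive weight when [a, b, c, d, e, f] have weights
    [1, 2, 2, 2, 3, 3]. *)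
Record generic (q a b c d e f : C) : Prop := {
  g_a : qsep q a;
  g_b : qsep q b;
  g_c : qsep q c;
  g_d : qsep q d;
  g_e : qsep q e;
  g_f : qsep q f;
  g_ba : qsep q (b / a);
  g_ca : qsep q (c / a);
  g_da : qsep q (d / a);
  g_ea : qsep q (e / a);
  g_fa : qsep q (f / a);
  g_bc : qsep q (b * c / a);
  g_bd : qsep q (b * d / a);
  g_cd : qsep q (c * d / a);
  g_v : qsep q (b * c * d / a);
  g_l : qsep q (b * c * d / (a * a));
  g_z : qsep q (b * c * d * e * f / (a * a));
  g_az : qsep q (b * c * d * e * f / (a * a * a));
  g_le : qsep q (b * c * d * e / (a * a));
  g_lf : qsep q (b * c * d * f / (a * a));
  g_ef : qsep q (e * f);
  g_efa : qsep q (e * f / a);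
  g_bef : qsep q (b * e * f / a);
  g_cef : qsep q (c * e * f / a);
  g_def : qsep q (d * e * f / a);
  g_t1 : qsep q (b * c * d * f / (a * a * a));
  g_t2 : qsep q (b * c * d * f / a);
  g_t3 : qsep q (b * c * d * f);
  g_t4 : qsep q (f * a);
  g_t5 : qsep q (f * f);
  g_t6 : qsep q (f * f * a);
  g_t7 : qsep q (b * c * d / (a * a * f));
  g_t8 : qsep q (f * f * a * a / (b * c * d));
  g_t9 : qsep q (f * a / b);
  g_t10 : qsep q (f * a / c);
  g_t11 : qsep q (f * a / d);
  g_t12 : qsep q (f * f * a / b);
  g_t13 : qsep q (f * f * a / c);
  g_t14 : qsep q (f * f * a / d)
}.

Unset Implicit Arguments.

Definition theta (x q : C) : C := qpoch_inf x q * qpoch_inf (q / x) q.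

Lemma w87_series_one (a b c d f q z : C) :
  1 - a <> 0 -> Cseries (fun k => w87 a b c d 1 f q k * z ^ k) = 1.
Proof.
intros ha. rewrite (Cseries_finite _ 1).
- simpl. unfold w87. simpl. field. exact ha.
- intros k hk. destruct k as [|k]; [lia|]. unfold w87. rewrite qprod_1. unfold Cdiv. ring.
Qed.

(** A 3phi2 of argument q. *)
Definition sser (x1 x2 x3 y1 y2 q : C) : C :=
  Cseries (fun k => qprod x1 q k * qprod x2 q k * qprod x3 q k /
                    (qprod q q k * qprod y1 q k * qprod y2 q k) * q ^ k).

Lemma sser_swap (x1 x2 x3 y1 y2 q : C) : sser x1 x2 x3 y1 y2 q = sser x1 x2 x3 y2 y1 q.
Proof. apply Cseries_ext. intros k. f_equal. f_equal. ring. Qed.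

Lemma sser_rev (x1 x2 x3 y1 y2 q : C) : sser x1 x2 x3 y1 y2 q = sser x3 x2 x1 y1 y2 q.
Proof. apply Cseries_ext. intros k. f_equal. f_equal. ring. Qed.

(** The case [e = 1] of [watson_qsep]; [f] is an auxiliary parameter that only
    enters the side conditions. *)
Lemma saalschutz_nonterminating (q a b c d f l v : C) :
  q <> 0 -> (Cmod q < 1)%R -> a <> 0 -> b <> 0 -> c <> 0 -> d <> 0 -> f <> 0 ->
  (Cmod (q * q * a * a / (b * c * d * f)) < 1)%R ->
  l = q * a * a / (b * c * d) -> v = b * c * d / (q * a) ->
  qsep q a -> qsep q (q * a / b) -> qsep q (q * a / c) -> qsep q (q * a / d) ->
  qsep q (q * a / f) -> qsep q v -> qsep q (q * q * a * a / (b * c * d * f)) ->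
  qsep q (q * a / (b * d)) -> qsep q (q * a / (c * d)) -> qsep q (q * l) ->
  qsep q (q * q * a * a * a / (b * c * d * f)) -> qsep q d ->
  RtoC 1 = qpoch_inf (q * a) q * qpoch_inf (q * a / (b * c)) q * qpoch_inf (q * a / (b * d)) q *
      qpoch_inf (q * a / (c * d)) q /
      (qpoch_inf (q * a / b) q * qpoch_inf (q * a / c) q * qpoch_inf (q * a / d) q * qpoch_inf (1 / v) q) *
      sser b c d (q * a) (q * v) q +
      qpoch_inf (q * l) q * qpoch_inf b q * qpoch_inf c q * qpoch_inf d q /
      (qpoch_inf (q * a / b) q * qpoch_inf (q * a / c) q * qpoch_inf (q * a / d) q * qpoch_inf v q) *
      sser (q * a / (b * c)) (q * a / (b * d)) (q * a / (c * d)) (q / v) (q * l) q.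
Proof.
intros hq hq1 ha hb hc hd hf hz hl hv sa sb sc sd sf sv sz sbd scd sl saz sdd.
assert (h1 := C1_nz).
assert (hv0 : v <> 0) by nz.
pose (z := q * q * a * a / (b * c * d * f)). fold z in hz, sz.
assert (ez : z = q * q * a * a / (b * c * d * 1 * f)) by (unfold z; field; auto).
assert (el : q * l = z * f) by (unfold z; rewrite hl; field; auto).
assert (sqa : qsep q (q * a / 1)) by sepq sa.
assert (saz' : qsep q (a * z)).
{ replace (a * z) with (q * q * a * a * a / (b * c * d * f)) by (unfold z; field; auto). exact saz. }
assert (sz1 : qsep q (z * 1)) by now rewrite Cmult_1_r.
rewrite el in sl.
assert (W := watson_qsep q a b c d 1 f z v hq hq1 hz ha hb hc hd h1 hf ez hv sa sb sc sd sqa sf sv sz sbd scd sz1 sl saz' sdd).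
rewrite w87_series_one in W by now apply (qsep_neq1 q).
replace (q * a / 1) with (q * a) in W, sqa by (field; auto).
cast W (q * a / (1 * f)) (q * a / f).
rewrite (Cmult_1_r z) in W. rewrite el.
assert (I : forall x, qsep q x -> qpoch_inf x q <> 0).
{ intros x h; apply qpoch_inf_neq0; [exact hq1|now apply qsep_reg]. }
rewrite W at 1. f_equal; f_equal.
- apply Cseries_ext. intros k. unfold h44.
  assert (n3 : qprod (q * v) q k <> 0) by (apply qsep_reg; sepq sv).
  cfield.
- assert (n3 := I _ sz).
  cfield.
- apply Cseries_ext. intros k. unfold h44.
  assert (n3 : qprod (q / v) q k <> 0) by (apply qsep_reg; sepq sv).
  cfield.
Qed.

Lemma qpoch_inf_1 (q : C) : (Cmod q < 1)%R -> qpoch_inf 1 q = 0.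
Proof. intros hq. rewrite qpoch_inf_head by exact hq. ring. Qed.

(** Sum of residues of [(x1 t, x2 t, x3 t)_oo / (u1 t, u2 t, u3 t)_oo]; the
    auxiliary [v1, v2] cancel from numerator and denominator. *)
Lemma three_residues (q u1 u2 u3 x1 x2 x3 v1 v2 : C) :
  q <> 0 -> (Cmod q < 1)%R -> u1 <> 0 -> u2 <> 0 -> u3 <> 0 -> v1 <> 0 -> v2 <> 0 ->
  x1 <> 0 -> x2 <> 0 -> x3 <> 0 -> x1 * x2 * x3 = q * q * (u1 * u2 * u3) ->
  qsep q (u2 / u1) -> qsep q (u3 / u1) -> qsep q (u3 / u2) -> qsep q (v2 / v1) ->
  (forall u, In u [u1; u2; u3] -> qreg (v1 * u) q /\ qreg (v2 * u) q) ->
  (forall x, In x [x1; x2; x3] -> qreg (x * v1) q /\ qreg (x * v2) q) ->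
  let Ru u u' u'' := - / u *
    (qpoch_inf (x1 / u) q * qpoch_inf (x2 / u) q * qpoch_inf (x3 / u) q /
     (qpoch_inf q q * qpoch_inf (u' / u) q * qpoch_inf (u'' / u) q)) *
    sser (q * u / x1) (q * u / x2) (q * u / x3) (q * u / u') (q * u / u'') q in
  Ru u1 u2 u3 + Ru u2 u1 u3 + Ru u3 u1 u2 = 0.
Proof.
intros hq hq1 hu1 hu2 hu3 hv1 hv2 hx1 hx2 hx3 hx s21 s31 s32 sv hu hxv Ru.
assert (hu' : forall u, In u [u1; u2; u3] -> qreg (v1 * u) q /\ qreg (v2 * u) q /\ qreg (v1 * u) q /\ qreg (v2 * u) q)
  by (intros u h; destruct (hu u h); auto).
assert (R := residues_limit q u1 u2 u3 x1 x2 x3 v1 v2 v1 v2 hq hq1 hu1 hu2 hu3 hv1 hv2 hx1 hx2 hx3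
  hv1 hv2 hx (eq_refl _) s21 s31 s32 sv hu' hxv).
cbv zeta beta in R. unfold h55inf in R.
cast R (v1 / v1) (RtoC 1).
cast R (v2 / v2) (RtoC 1).
(* With y1 = v1 and y2 = v2 the residues at v1 q^k and v2 q^k carry the factor (1;q)_oo = 0. *)
rewrite qpoch_inf_1 in R by exact hq1.
assert (nq : qpoch_inf q q <> 0).
{ apply qpoch_inf_neq0; [exact hq1|intros k; now apply qprod_q_neq0]. }
assert (H : forall u u' u'' : C, In u [u1; u2; u3] -> u' <> 0 -> u'' <> 0 -> u <> 0 ->
  qsep q (u' / u) -> qsep q (u'' / u) ->
  - / u * (qpoch_inf (x1 / u) q * qpoch_inf (x2 / u) q * qpoch_inf (x3 / u) q * qpoch_inf (v1 * u) q * qpoch_inf (v2 * u) q /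
   (qpoch_inf q q * qpoch_inf (u' / u) q * qpoch_inf (u'' / u) q * qpoch_inf (v1 * u) q * qpoch_inf (v2 * u) q)) *
   Cseries (fun k => h55 (q * u / x1) (q * u / x2) (q * u / x3) (v1 * u) (v2 * u) q (q * u / u') (q * u / u'') (v1 * u) (v2 * u) q k * q ^ k)
  = Ru u u' u'').
{ intros u u' u'' hin hu0' hu0'' hu0 s1 s2. destruct (hu u hin) as [r1 r2]. unfold Ru. f_equal; [f_equal|].
  - cfield.
  - apply Cseries_ext. intros k. unfold h55.
    assert (n3 : qprod (q * u / u') q k <> 0) by (apply qsep_reg; sepq s1).
    assert (n4 : qprod (q * u / u'') q k <> 0) by (apply qsep_reg; sepq s2).
    cfield. }
assert (s12 : qsep q (u1 / u2)) by sepq s21. assert (s13 : qsep q (u1 / u3)) by sepq s31.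
assert (s23 : qsep q (u2 / u3)) by sepq s32.
rewrite !H in R by (simpl; auto).
rewrite <- R. unfold Cdiv. ring.
Qed.

(** Three 3phi2 series X, Y, Z satisfy three linear relations: the case e = 1 of Watson's
    transformation links X with Z and, at inverted parameters, Y with Z, while a residue sum links
    all three. Eliminating X and Y leaves the addition formula times Z. *)
Lemma theta_identity_of_neq0 (q a b c d f l v : C) :
  q <> 0 -> (Cmod q < 1)%R -> a <> 0 -> b <> 0 -> c <> 0 -> d <> 0 -> f <> 0 ->
  (exists e, generic q a b c d e f) ->
  (Cmod (q * q * a * a / (b * c * d * f)) < 1)%R -> (Cmod (q * q * a / (b * c * d * f)) < 1)%R ->
  l = q * a * a / (b * c * d) -> v = b * c * d / (q * a) ->
  sser (q * a / (b * c)) (q * a / (b * d)) (q * a / (c * d)) (q / v) (q * l) q <> 0 ->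
  theta b q * theta c q * theta d q * theta l q +
  l * (theta (b / a) q * theta (c / a) q * theta (d / a) q * theta v q) =
  theta a q * theta (c * d / a) q * theta (b * d / a) q * theta (b * c / a) q.
Proof.
intros hq hq1 ha hb hc hd hf [e G] hz hz' hl hv hZ.
assert (h1 := C1_nz).
assert (hl0 : l <> 0) by nz.
assert (hv0 : v <> 0) by nz.
assert (sl : qsep q (q * a * a / (b * c * d))) by sepq (g_l G).
assert (sv : qsep q (b * c * d / (q * a))) by sepq (g_v G).
assert (E1 := saalschutz_nonterminating q a b c d f l v hq hq1 ha hb hc hd hf hz hl hv).
specialize (E1 ltac:(sepq (g_a G)) ltac:(sepq (g_ba G)) ltac:(sepq (g_ca G)) ltac:(sepq (g_da G)) ltac:(sepq (g_fa G))
  ltac:(rewrite hv; exact sv) ltac:(sepq (g_lf G)) ltac:(sepq (g_bd G)) ltac:(sepq (g_cd G)) ltac:(rewrite hl; sepq (g_l G))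
  ltac:(sepq (g_t1 G)) ltac:(sepq (g_d G))).
(* This substitution replaces l by 1/v and v by 1/l, and keeps Z up to the order of its lower
   parameters. *)
pose (a' := 1 / a). pose (b' := b / a). pose (c' := c / a). pose (d' := d / a).
assert (ha' : a' <> 0) by nz. assert (hb' : b' <> 0) by nz.
assert (hc' : c' <> 0) by nz. assert (hd' : d' <> 0) by nz.
assert (E2 := saalschutz_nonterminating q a' b' c' d' f (1 / v) (1 / l) hq hq1 ha' hb' hc' hd' hf).
unfold a', b', c', d' in E2.
cast E2 (q * q * (1 / a) * (1 / a) / (b / a * (c / a) * (d / a) * f)) (q * q * a / (b * c * d * f)).
specialize (E2 hz' ltac:(rewrite hv; field; auto) ltac:(rewrite hl; field; auto)).
specialize (E2 ltac:(sepq (g_a G)) ltac:(sepq (g_b G)) ltac:(sepq (g_c G)) ltac:(sepq (g_d G)) ltac:(sepq (g_t4 G))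
  ltac:(rewrite hl; sepq (g_l G)) ltac:(sepq (g_t2 G)) ltac:(sepq (g_bd G)) ltac:(sepq (g_cd G)) ltac:(rewrite hv; sepq (g_v G))
  ltac:(sepq (g_t3 G)) ltac:(sepq (g_da G))).
cast E2 (q * (1 / a)) (q / a).
cast E2 (q / a / (b / a * (c / a))) (q * a / (b * c)).
cast E2 (q / a / (b / a * (d / a))) (q * a / (b * d)).
cast E2 (q / a / (c / a * (d / a))) (q * a / (c * d)).
cast E2 (q / a / (b / a)) (q / b).
cast E2 (q / a / (c / a)) (q / c).
cast E2 (q / a / (d / a)) (q / d).
cast E2 (1 / (1 / l)) l.
cast E2 (q * (1 / l)) (q / l).
cast E2 (q * (1 / v)) (q / v).
cast E2 (q / (1 / l)) (q * l).
assert (nz : forall x y : C, x <> 0 -> y <> 0 -> q * x / y <> 0).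
{ intros x y hx hy. apply neq0_div; [apply Cmult_neq_0|]; auto. }
assert (hff : f * f <> 0) by nz.
(* The auxiliary pair is f and f^2; the monomials [g_t4] to [g_t14] of [generic] keep it away from
   the other parameters. *)
assert (E3 := three_residues q a l 1 (q * a / b) (q * a / c) (q * a / d) f (f * f) hq hq1 ha hl0 h1 hf hff
  (nz _ _ ha hb) (nz _ _ ha hc) (nz _ _ ha hd)).
specialize (E3 ltac:(rewrite hl; field; auto) ltac:(rewrite hl; sepq (g_v G)) ltac:(sepq (g_a G)) ltac:(rewrite hl; sepq (g_l G)) ltac:(sepq (g_f G))).
assert (ru : forall u, In u [a; l; RtoC 1] -> qreg (f * u) q /\ qreg (f * f * u) q).
{ intros u [<-|[<-|[<-|[]]]]; split; apply qsep_reg.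
  - sepq (g_t4 G). - sepq (g_t6 G). - rewrite hl. sepq (g_t7 G). - rewrite hl. sepq (g_t8 G).
  - sepq (g_f G). - sepq (g_t5 G). }
assert (rx : forall x, In x [q * a / b; q * a / c; q * a / d] -> qreg (x * f) q /\ qreg (x * (f * f)) q).
{ intros x [<-|[<-|[<-|[]]]]; split; apply qsep_reg.
  - sepq (g_t9 G). - sepq (g_t12 G). - sepq (g_t10 G). - sepq (g_t13 G). - sepq (g_t11 G). - sepq (g_t14 G). }
specialize (E3 ru rx). cbv zeta beta in E3.
cast E3 (q * a / b / a) (q / b).
cast E3 (q * a / c / a) (q / c).
cast E3 (q * a / d / a) (q / d).
cast E3 (l / a) (1 / v).
cast E3 (a / l) v.
cast E3 (q * a / (q * a / b)) b.
cast E3 (q * a / (q * a / c)) c.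
cast E3 (q * a / (q * a / d)) d.
cast E3 (q * a / l) (q * v).
cast E3 (q * a / 1) (q * a).
cast E3 (q * a / b / l) (c * d / a).
cast E3 (q * a / c / l) (b * d / a).
cast E3 (q * a / d / l) (b * c / a).
cast E3 (q * l / (q * a / b)) (q * a / (c * d)).
cast E3 (q * l / (q * a / c)) (q * a / (b * d)).
cast E3 (q * l / (q * a / d)) (q * a / (b * c)).
cast E3 (q * l / a) (q / v).
cast E3 (q * l / 1) (q * l).
cast E3 (q * a / b / 1) (q * a / b).
cast E3 (q * a / c / 1) (q * a / c).
cast E3 (q * a / d / 1) (q * a / d).
cast E3 (a / 1) a.
cast E3 (l / 1) l.
cast E3 (q * 1 / (q * a / b)) (b / a).
cast E3 (q * 1 / (q * a / c)) (c / a).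
cast E3 (q * 1 / (q * a / d)) (d / a).
cast E3 (q * 1 / a) (q / a).
cast E3 (q * 1 / l) (q / l).
rewrite (sser_swap b c d), (sser_rev (q * a / (c * d))) in E3.
rewrite (sser_swap _ _ _ (q * l)) in E2.
assert (I : forall x, qsep q x -> qpoch_inf x q <> 0).
{ intros x h; apply qpoch_inf_neq0; [exact hq1|now apply qsep_reg]. }
assert (nq : qpoch_inf q q <> 0).
{ apply qpoch_inf_neq0; [exact hq1|intros k; now apply qprod_q_neq0]. }
assert (sl' : qsep q l) by (rewrite hl; exact sl). assert (sv' : qsep q v) by (rewrite hv; exact sv).
assert (i1 : qpoch_inf (q * a / b) q <> 0) by (apply I; sepq (g_ba G)).
assert (i2 : qpoch_inf (q * a / c) q <> 0) by (apply I; sepq (g_ca G)).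
assert (i3 : qpoch_inf (q * a / d) q <> 0) by (apply I; sepq (g_da G)).
assert (i4 : qpoch_inf (1 / v) q <> 0) by (apply I; sepq sv').
assert (i5 : qpoch_inf v q <> 0) by now apply I.
assert (i6 : qpoch_inf (q / b) q <> 0) by (apply I; sepq (g_b G)).
assert (i7 : qpoch_inf (q / c) q <> 0) by (apply I; sepq (g_c G)).
assert (i8 : qpoch_inf (q / d) q <> 0) by (apply I; sepq (g_d G)).
assert (i9 : qpoch_inf (1 / l) q <> 0) by (apply I; sepq sl').
assert (i10 : qpoch_inf l q <> 0) by now apply I.
assert (i11 : qpoch_inf (q * a) q <> 0) by (apply I; sepq (g_a G)).
assert (i12 : qpoch_inf (q / a) q <> 0) by (apply I; sepq (g_a G)).
assert (i13 : qpoch_inf (q * l) q <> 0) by (apply I; sepq sl').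
assert (i14 : qpoch_inf (q / v) q <> 0) by (apply I; sepq sv').
assert (i15 : qpoch_inf (q / l) q <> 0) by (apply I; sepq sl').
assert (k1 := qpoch_inf_head a q hq1). rewrite (Cmult_comm a q) in k1.
assert (k2 := qpoch_inf_head (1 / a) q hq1). cast k2 (1 / a * q) (q / a).
assert (k3 := qpoch_inf_head l q hq1). rewrite (Cmult_comm l q) in k3.
assert (k4 := qpoch_inf_head (1 / l) q hq1). cast k4 (1 / l * q) (q / l).
assert (m1 := qsep_neq1 _ _ (g_a G)). assert (m2 := qsep_neq1 _ _ sl').
unfold theta.
replace (q / (b / a)) with (q * a / b) by (field; auto).
replace (q / (c / a)) with (q * a / c) by (field; auto).
replace (q / (d / a)) with (q * a / d) by (field; auto).
replace (q / (c * d / a)) with (q * a / (c * d)) by (field; auto).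
replace (q / (b * d / a)) with (q * a / (b * d)) by (field; auto).
replace (q / (b * c / a)) with (q * a / (b * c)) by (field; auto).
rewrite k1, k2, k3, k4 in *.
set (Z := sser (q * a / (b * c)) _ _ _ _ q) in *.
set (X := sser b c d _ _ q) in *. set (Y := sser (b / a) _ _ _ _ q) in *.
clearbody X Y Z.
set (A1 := qpoch_inf (q * a) q) in *. set (A2 := qpoch_inf (q / a) q) in *.
set (L1 := qpoch_inf (q * l) q) in *. set (L2 := qpoch_inf (q / l) q) in *.
set (V1 := qpoch_inf v q) in *. set (V2 := qpoch_inf (1 / v) q) in *. set (V3 := qpoch_inf (q / v) q) in *.
set (B1 := qpoch_inf b q) in *. set (B2 := qpoch_inf (q / b) q) in *.
set (B3 := qpoch_inf (b / a) q) in *. set (B4 := qpoch_inf (q * a / b) q) in *.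
set (C1' := qpoch_inf c q) in *. set (C2' := qpoch_inf (q / c) q) in *.
set (C3' := qpoch_inf (c / a) q) in *. set (C4' := qpoch_inf (q * a / c) q) in *.
set (D1 := qpoch_inf d q) in *. set (D2 := qpoch_inf (q / d) q) in *.
set (D3 := qpoch_inf (d / a) q) in *. set (D4 := qpoch_inf (q * a / d) q) in *.
set (F1 := qpoch_inf (c * d / a) q) in *. set (F2 := qpoch_inf (q * a / (c * d)) q) in *.
set (F3 := qpoch_inf (b * d / a) q) in *. set (F4 := qpoch_inf (q * a / (b * d)) q) in *.
set (F5 := qpoch_inf (b * c / a) q) in *. set (F6 := qpoch_inf (q * a / (b * c)) q) in *.
set (Q := qpoch_inf q q) in *.
clearbody A1 A2 L1 L2 V1 V2 V3 B1 B2 B3 B4 C1' C2' C3' C4' D1 D2 D3 D4 F1 F2 F3 F4 F5 F6 Q.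
assert (m3 : 1 - 1 / l <> 0) by (intros e0; apply i9; rewrite e0; ring).
assert (m4 : a - 1 <> 0) by (intros e0; apply m1; replace (1 - a) with (- (a - 1)) by ring; rewrite e0; ring).
assert (m5 : l - 1 <> 0) by (intros e0; apply m2; replace (1 - l) with (- (l - 1)) by ring; rewrite e0; ring).
(* X and Y, with the coefficients they have in the residue relation, are expressed through Z. *)
assert (x1 : A1 * F6 * F4 * F2 / V2 * X = B4 * C4' * D4 - L1 * B1 * C1' * D1 / V1 * Z).
{ transitivity (B4 * C4' * D4 * (A1 * F6 * F4 * F2 / (B4 * C4' * D4 * V2) * X)); [field; auto|].
  replace (A1 * F6 * F4 * F2 / (B4 * C4' * D4 * V2) * X) with (1 - L1 * B1 * C1' * D1 / (B4 * C4' * D4 * V1) * Z).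
  - field. auto.
  - rewrite E1 at 1. ring. }
assert (x2 : A2 * F6 * F4 * F2 / ((1 - l) * L1) * Y = B2 * C2' * D2 - V3 * B3 * C3' * D3 / ((1 - 1 / l) * L2) * Z).
{ transitivity (B2 * C2' * D2 * (A2 * F6 * F4 * F2 / (B2 * C2' * D2 * ((1 - l) * L1)) * Y)); [field; auto|].
  replace (A2 * F6 * F4 * F2 / (B2 * C2' * D2 * ((1 - l) * L1)) * Y) with
    (1 - V3 * B3 * C3' * D3 / (B2 * C2' * D2 * ((1 - 1 / l) * L2)) * Z).
  - cfield.
  - rewrite E2 at 1. ring. }
assert (x3 : B2 * C2' * D2 * (A1 * F6 * F4 * F2 / V2 * X) +
   (1 - a) * A1 * A2 * (F6 * F4 * F2) * (F1 * F3 * F5) / (V1 * (1 - l) * L2) * Z -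
   B4 * C4' * D4 * (A2 * F6 * F4 * F2 / ((1 - l) * L1) * Y) = 0).
{ transitivity (((1 - a) * A1 * A2 * (F6 * F4 * F2) * Q) * 0); [rewrite <- E3|ring].
  cfield. }
rewrite x1, x2 in x3.
assert (x4 : (B1 * B2 * (C1' * C2') * (D1 * D2) * ((1 - l) * L1 * L2) +
  l * (B3 * B4 * (C3' * C4') * (D3 * D4) * (V1 * V3)) -
  (1 - a) * A1 * A2 * (F1 * F2) * (F3 * F4) * (F5 * F6)) * Z = 0).
{ transitivity (- (V1 * (1 - l) * L2) * 0); [rewrite <- x3|ring]. cfield. }
match goal with |- ?x = ?y => assert (x5 : x - y = 0) end.
{ match type of x4 with ?t * Z = _ => replace t with (t * Z * / Z) by (field; exact hZ) end.
  rewrite x4. ring. }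
match goal with |- ?x = ?y => replace x with (x - y + y) by ring end.
rewrite x5. ring.
Qed.

(** * Continuity of series in their parameters *)

Lemma qprod_upper_cvg (q : C) (u : nat -> C) (x : C) : (Cmod q < 1)%R -> cvgC u x ->
  exists M N, forall n k, (N <= n)%nat -> (Cmod (qprod (u n) q k) <= M)%R.
Proof.
intros hq hu. destruct (cvgC_bounded u x hu) as [N HN].
exists (qbnd q (Cmod x + 1)), N. intros n k hn. apply qprod_upper; [exact hq|now apply HN].
Qed.

(** Uniform in k but only eventual in n, since a perturbed denominator may vanish for small n. *)
Definition ubdd (A : nat -> nat -> C) : Prop :=
  exists M N, forall n k, (N <= n)%nat -> (Cmod (A n k) <= M)%R.

Lemma ubdd_mult (A B : nat -> nat -> C) : ubdd A -> ubdd B -> ubdd (fun n k => A n k * B n k).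
Proof.
intros (M & N & h) (M' & N' & h'). exists (M * M')%R, (Nat.max N N'). intros n k hn.
rewrite Cmod_mult. apply Rmult_le_compat; try apply Cmod_ge_0; [apply h|apply h']; lia.
Qed.

Lemma ubdd_inv (q : C) (u : nat -> C) (y : C) : (Cmod q < 1)%R -> cvgC u y -> qreg y q ->
  ubdd (fun n k => / qprod (u n) q k).
Proof.
intros hq hu hy. destruct (qprod_lower_cvg q u y hq hu hy) as (m & N & hm & h).
exists (/ m)%R, N. intros n k hn. specialize (h n k hn).
rewrite Cmod_inv.
- apply Rinv_le_contravar; assumption.
- intros e. rewrite e, Cmod_0 in h. lra.
Qed.

Lemma ubdd_ext_ev (A B : nat -> nat -> C) (N0 : nat) :
  (forall n k, (N0 <= n)%nat -> A n k = B n k) -> ubdd A -> ubdd B.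
Proof.
intros e (M & N & h). exists M, (Nat.max N0 N). intros n k hn. rewrite <- e by lia. apply h. lia.
Qed.

Lemma qreg_eventually (q : C) (u : nat -> C) (y : C) : (Cmod q < 1)%R -> cvgC u y -> qreg y q ->
  exists N, forall n, (N <= n)%nat -> qreg (u n) q.
Proof.
intros hq hu hy. destruct (qprod_lower_cvg q u y hq hu hy) as (m & N & hm & h).
exists N. intros n hn k e. specialize (h n k hn). rewrite e, Cmod_0 in h. lra.
Qed.

Lemma h44_series_cont (q : C) (x1 x2 x3 x4 y1 y2 y3 y4 : nat -> C) (X1 X2 X3 X4 Y1 Y2 Y3 Y4 : C) :
  (Cmod q < 1)%R ->
  cvgC x1 X1 -> cvgC x2 X2 -> cvgC x3 X3 -> cvgC x4 X4 ->
  cvgC y1 Y1 -> cvgC y2 Y2 -> cvgC y3 Y3 -> cvgC y4 Y4 ->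
  qreg Y1 q -> qreg Y2 q -> qreg Y3 q -> qreg Y4 q ->
  ex_Cseries (fun k => h44 X1 X2 X3 X4 Y1 Y2 Y3 Y4 q k * q ^ k) /\
  cvgC (fun n => Cseries (fun k => h44 (x1 n) (x2 n) (x3 n) (x4 n) (y1 n) (y2 n) (y3 n) (y4 n) q k * q ^ k))
       (Cseries (fun k => h44 X1 X2 X3 X4 Y1 Y2 Y3 Y4 q k * q ^ k)).
Proof.
intros hq a1 a2 a3 a4 b1 b2 b3 b4 r1 r2 r3 r4.
assert (U : ubdd (fun n k => h44 (x1 n) (x2 n) (x3 n) (x4 n) (y1 n) (y2 n) (y3 n) (y4 n) q k)).
{ destruct (qreg_eventually q y1 Y1 hq b1 r1) as [N1 h1].
  destruct (qreg_eventually q y2 Y2 hq b2 r2) as [N2 h2].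
  destruct (qreg_eventually q y3 Y3 hq b3 r3) as [N3 h3].
  destruct (qreg_eventually q y4 Y4 hq b4 r4) as [N4 h4].
  apply (ubdd_ext_ev (fun n k => qprod (x1 n) q k * qprod (x2 n) q k * qprod (x3 n) q k * qprod (x4 n) q k *
    (/ qprod (y1 n) q k * / qprod (y2 n) q k * / qprod (y3 n) q k * / qprod (y4 n) q k))
    _ (N1 + N2 + N3 + N4)).
  - intros n k hn. unfold h44, Cdiv. rewrite Cinv_mult_4; [reflexivity| | | |].
    + apply h1; lia. + apply h2; lia. + apply h3; lia. + apply h4; lia.
  - repeat apply ubdd_mult; eauto using qprod_upper_cvg, ubdd_inv.
    + exact (qprod_upper_cvg q x1 X1 hq a1).
    + exact (qprod_upper_cvg q x2 X2 hq a2).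
    + exact (qprod_upper_cvg q x3 X3 hq a3).
    + exact (qprod_upper_cvg q x4 X4 hq a4). }
destruct U as (M & N & hM).
refine (tannery _ _ M (Cmod q) N _ _ _).
- split; [apply Cmod_ge_0|exact hq].
- intros n k hn. rewrite Cmod_mult, Cmod_pow.
  apply Rmult_le_compat_r; [apply pow_le, Cmod_ge_0|now apply hM].
- intros k. apply cvgC_mult; [|apply cvgC_const]. apply cvgC_div.
  + repeat apply Cmult_neq_0; auto.
  + repeat apply cvgC_mult; now apply cvgC_qprod.
  + repeat apply cvgC_mult; now apply cvgC_qprod.
Qed.

Lemma sser_h44 (x1 x2 x3 y1 y2 q : C) :
  sser x1 x2 x3 y1 y2 q = Cseries (fun k => h44 x1 x2 x3 0 q y1 y2 0 q k * q ^ k).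
Proof. apply Cseries_ext. intros k. unfold h44. rewrite qprod_0. unfold Cdiv. now rewrite !Cmult_1_r. Qed.

(** Euler's sum of q^k/(q;q)_k: the first n + 1 terms add up to 1/(q;q)_n, so the value is
    1/(q;q)_oo. *)
Lemma sser_0_neq0 (q : C) : (Cmod q < 1)%R -> sser 0 0 0 0 0 q <> 0.
Proof.
intros hq e. assert (nq : qreg q q) by (intros k; now apply qprod_q_neq0).
assert (ni := qpoch_inf_neq0 q q hq nq).
assert (h : cvgC (sumC (fun k => qprod 0 q k * qprod 0 q k * qprod 0 q k /
   (qprod q q k * qprod 0 q k * qprod 0 q k) * q ^ k)) (/ qpoch_inf q q)).
{ apply (cvgC_ext_ev (fun n => / qprod q q (n - 1)) _ _ 1).
  - intros n hn. destruct n as [|n]; [lia|]. rewrite Nat.sub_succ, Nat.sub_0_r. clear hn.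
    induction n as [|n IH].
    + simpl. field.
    + rewrite sumC_S, <- IH, !qprod_0. assert (h := nq (S n)). rewrite qprod_S in *.
      assert (h1 := nq n). change (q ^ S n) with (q * q ^ n).
      assert (h2 : 1 - q * q ^ n <> 0) by (intros e0; apply h; rewrite e0; ring).
      field. auto.
  - apply cvgC_inv; [exact ni|]. now apply cvgC_shift, cvgC_qpoch_inf. }
apply Cseries_eq in h. unfold sser in e. rewrite h in e.
apply C1_nz. replace (RtoC 1) with (/ qpoch_inf q q * qpoch_inf q q) by (field; exact ni). rewrite e. ring.
Qed.

Lemma generic_shift (q a b c d e f : C) :
  q <> 0 -> a <> 0 -> b <> 0 -> c <> 0 -> d <> 0 -> e <> 0 -> f <> 0 ->
  generic q a b c d e f -> generic q (a * q) b c d e f.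
Proof.
intros hq ha hb hc hd he hf G. assert (haq : a * q <> 0) by nz.
constructor.
- sepq (g_a G). - sepq (g_b G). - sepq (g_c G). - sepq (g_d G). - sepq (g_e G).
- sepq (g_f G). - sepq (g_ba G). - sepq (g_ca G). - sepq (g_da G). - sepq (g_ea G).
- sepq (g_fa G). - sepq (g_bc G). - sepq (g_bd G). - sepq (g_cd G). - sepq (g_v G).
- sepq (g_l G). - sepq (g_z G). - sepq (g_az G). - sepq (g_le G). - sepq (g_lf G).
- sepq (g_ef G). - sepq (g_efa G). - sepq (g_bef G). - sepq (g_cef G). - sepq (g_def G).
- sepq (g_t1 G). - sepq (g_t2 G). - sepq (g_t3 G). - sepq (g_t4 G). - sepq (g_t5 G).
- sepq (g_t6 G). - sepq (g_t7 G). - sepq (g_t8 G). - sepq (g_t9 G). - sepq (g_t10 G).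
- sepq (g_t11 G). - sepq (g_t12 G). - sepq (g_t13 G). - sepq (g_t14 G).
Qed.

(** * Quasi-periodicity and Weierstrass' formula *)

Lemma theta_mulq (x q : C) : x <> 0 -> q <> 0 -> (Cmod q < 1)%R ->
  theta (x * q) q = - / x * theta x q.
Proof.
intros hx hq hq1. unfold theta.
replace (q / (x * q)) with (1 / x) by (field; auto).
rewrite (qpoch_inf_head x q hq1), (qpoch_inf_head (1 / x) q hq1).
replace (1 / x * q) with (q / x) by (field; auto). field. auto.
Qed.

Lemma theta_divq (x q : C) : x <> 0 -> q <> 0 -> (Cmod q < 1)%R ->
  theta (x / q) q = - (x / q) * theta x q.
Proof.
intros hx hq hq1. assert (h := theta_mulq (x / q) q (neq0_div _ _ hx hq) hq hq1).
replace (x / q * q) with x in h by (field; auto). rewrite h. field. auto.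
Qed.

Definition theta_rel (q a b c d : C) : Prop :=
  theta b q * theta c q * theta d q * theta (q * a * a / (b * c * d)) q +
  q * a * a / (b * c * d) *
   (theta (b / a) q * theta (c / a) q * theta (d / a) q * theta (b * c * d / (q * a)) q) =
  theta a q * theta (c * d / a) q * theta (b * d / a) q * theta (b * c / a) q.

(** Put l = q a^2/(bcd). By quasi-periodicity each of the three products is divided by the same
    factor l^2 q when a becomes a q. *)
Lemma theta_rel_shift (q a b c d : C) :
  q <> 0 -> (Cmod q < 1)%R -> a <> 0 -> b <> 0 -> c <> 0 -> d <> 0 ->
  theta_rel q (a * q) b c d -> theta_rel q a b c d.
Proof.
intros hq hq1 ha hb hc hd. unfold theta_rel.
replace (q * (a * q) * (a * q) / (b * c * d)) with (q * a * a / (b * c * d) * q * q) by (field; auto).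
replace (b / (a * q)) with (b / a / q) by (field; auto).
replace (c / (a * q)) with (c / a / q) by (field; auto).
replace (d / (a * q)) with (d / a / q) by (field; auto).
replace (b * c * d / (q * (a * q))) with (b * c * d / (q * a) / q) by (field; auto).
replace (c * d / (a * q)) with (c * d / a / q) by (field; auto).
replace (b * d / (a * q)) with (b * d / a / q) by (field; auto).
replace (b * c / (a * q)) with (b * c / a / q) by (field; auto).
assert (hl : q * a * a / (b * c * d) <> 0) by nz.
assert (n1 := neq0_div _ _ hb ha). assert (n2 := neq0_div _ _ hc ha). assert (n3 := neq0_div _ _ hd ha).
assert (n4 : b * c * d / (q * a) <> 0) by nz.
assert (n5 : c * d / a <> 0) by nz.
assert (n6 : b * d / a <> 0) by nz.
assert (n7 : b * c / a <> 0) by nz.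
rewrite !theta_mulq by (auto using Cmult_neq_0).
rewrite !theta_divq by auto.
set (T1 := theta b q). set (T2 := theta c q). set (T3 := theta d q).
set (T4 := theta (q * a * a / (b * c * d)) q). set (T5 := theta (b / a) q).
set (T6 := theta (c / a) q). set (T7 := theta (d / a) q). set (T8 := theta (b * c * d / (q * a)) q).
intros E.
transitivity ((q * a * a / (b * c * d)) * (q * a * a / (b * c * d)) * q *
  (T1 * T2 * T3 * (- / (q * a * a / (b * c * d) * q) * (- / (q * a * a / (b * c * d)) * T4)) +
   q * a * a / (b * c * d) * q * q * (- (b / a / q) * T5 * (- (c / a / q) * T6) * (- (d / a / q) * T7) *
     (- (b * c * d / (q * a) / q) * T8)))).
- field. auto 10.
- rewrite E. field. auto 10.
Qed.

(** For a q^n with n large, the two bounds on moduli and the nonvanishing of the 3phi2 in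
    [theta_identity_of_neq0] hold, since all quantities involved carry a factor q^n; the relation
    then descends step by step to a. *)
Lemma theta_identity (q a b c d e f : C) :
  q <> 0 -> (Cmod q < 1)%R -> a <> 0 -> b <> 0 -> c <> 0 -> d <> 0 -> e <> 0 -> f <> 0 ->
  generic q a b c d e f -> theta_rel q a b c d.
Proof.
intros hq hq1 ha hb hc hd he hf G.
assert (hqn := fun n => Cpow_nz q n hq).
assert (Gn : forall n, generic q (a * q ^ n) b c d e f).
{ induction n as [|n IH].
  - simpl. now rewrite Cmult_1_r.
  - simpl. replace (a * (q * q ^ n)) with (a * q ^ n * q) by ring.
    apply generic_shift; auto. apply Cmult_neq_0; auto. }
assert (down : forall n, theta_rel q (a * q ^ n) b c d -> theta_rel q a b c d).
{ induction n as [|n IH]; intros h.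
  - simpl in h. now rewrite Cmult_1_r in h.
  - apply IH, theta_rel_shift; auto.
    + apply Cmult_neq_0; auto.
    + replace (a * q ^ n * q) with (a * q ^ S n) by (simpl; ring). exact h. }
assert (c0 : forall x : C, cvgC (fun n => x * q ^ n) 0).
{ intros x. replace (RtoC 0) with (x * 0) by ring. apply cvgC_mult; [apply cvgC_const|now apply cvgC_qpow]. }
assert (cx : forall x : C, cvgC (fun n => x * (a * q ^ n)) 0).
{ intros x. apply (cvgC_ext (fun n => x * a * q ^ n)); [intros; ring|apply c0]. }
assert (cxx : forall x : C, cvgC (fun n => x * (a * q ^ n) * (a * q ^ n)) 0).
{ intros x. replace (RtoC 0) with (0 * 0) by ring. apply cvgC_mult; [apply cx|apply c0]. }
assert (rq : qreg q q) by (intros k; now apply qprod_q_neq0).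
assert (r0 : qreg 0 q) by (intros k; rewrite qprod_0; exact C1_nz).
assert (HZ := proj2 (h44_series_cont q (fun n => q / (b * c) * (a * q ^ n)) (fun n => q / (b * d) * (a * q ^ n))
  (fun n => q / (c * d) * (a * q ^ n)) (fun _ => 0) (fun _ => q) (fun n => q * q / (b * c * d) * (a * q ^ n))
  (fun n => q * q / (b * c * d) * (a * q ^ n) * (a * q ^ n)) (fun _ => 0) 0 0 0 0 q 0 0 0 hq1
  (cx _) (cx _) (cx _) (cvgC_const _) (cvgC_const _) (cx _) (cxx _) (cvgC_const _) rq r0 r0 r0)).
rewrite <- sser_h44 in HZ.
assert (n0 := sser_0_neq0 q hq1).
assert (p0 : (0 < Cmod (sser 0 0 0 0 0 q))%R) by now apply Cmod_gt_0.
(* The tolerance is the modulus of the limit itself, so that closeness to it excludes the value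
   0. *)
destruct (HZ _ p0) as [N1 H1].
destruct (cxx (q * q / (b * c * d * f)) 1%R Rlt_0_1) as [N2 H2].
destruct (cx (q * q / (b * c * d * f)) 1%R Rlt_0_1) as [N3 H3].
set (n := (N1 + N2 + N3)%nat).
specialize (H1 n ltac:(lia)). specialize (H2 n ltac:(lia)). specialize (H3 n ltac:(lia)).
rewrite <- sser_h44 in H1. unfold Cminus in H2, H3. rewrite Copp_0, Cplus_0_r in H2, H3.
apply (down n). unfold theta_rel.
set (A := a * q ^ n) in *. assert (hA : A <> 0) by (apply Cmult_neq_0; auto).
apply (theta_identity_of_neq0 q A b c d f); auto.
- exists e. apply Gn.
- replace (q * q * A * A / (b * c * d * f)) with (q * q / (b * c * d * f) * A * A) by (field; auto). exact H2.
- replace (q * q * A / (b * c * d * f)) with (q * q / (b * c * d * f) * A) by (field; auto). exact H3.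
- intros e0.
  replace (q / (b * c * d / (q * A))) with (q * q / (b * c * d) * A) in e0 by (field; auto).
  replace (q * (q * A * A / (b * c * d))) with (q * q / (b * c * d) * A * A) in e0 by (field; auto).
  replace (q * A / (b * c)) with (q / (b * c) * A) in e0 by (field; auto).
  replace (q * A / (b * d)) with (q / (b * d) * A) in e0 by (field; auto).
  replace (q * A / (c * d)) with (q / (c * d) * A) in e0 by (field; auto).
  rewrite e0 in H1. unfold Cminus in H1. rewrite Cplus_0_l, Cmod_opp in H1. lra.
Qed.

(** * The identity for generic parameters *)

Definition hser (x1 x2 x3 x4 y1 y2 y3 y4 q : C) : C :=
  Cseries (fun k => h44 x1 x2 x3 x4 y1 y2 y3 y4 q k * q ^ k).

(** The poles at q^(k+1) produce one half of the 4psi4 with all parameters multiplied by q, that is,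
    without its term of index 0; this relates it to the full half. *)
Lemma hser_head (x1 x2 x3 x4 y1 y2 y3 y4 q : C) : (Cmod q < 1)%R ->
  qreg y1 q -> qreg y2 q -> qreg y3 q -> qreg y4 q ->
  hser x1 x2 x3 x4 y1 y2 y3 y4 q =
  1 + q * ((1 - x1) * (1 - x2) * (1 - x3) * (1 - x4) /
           ((1 - y1) * (1 - y2) * (1 - y3) * (1 - y4))) *
      hser (x1 * q) (x2 * q) (x3 * q) (x4 * q) (y1 * q) (y2 * q) (y3 * q) (y4 * q) q.
Proof.
intros hq r1 r2 r3 r4. unfold hser.
assert (s : forall y, qreg y q -> qreg (y * q) q).
{ intros y h. replace (y * q) with (y * q ^ 1) by (simpl; ring). now apply qreg_shift. }
assert (f : forall y, qreg y q -> 1 - y <> 0).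
{ intros y h. assert (h0 := qreg_factor y q 0 h). simpl in h0. now rewrite Cmult_1_r in h0. }
destruct (conv_limit (h44 x1 x2 x3 x4 y1 y2 y3 y4 q) (fun _ => 0) q 0 hq
  (h44_bdd _ _ _ _ _ _ _ _ _ hq r1 r2 r3 r4) (bddC_const 0) (cvgC_const 0)) as [ex _].
destruct (conv_limit (h44 (x1 * q) (x2 * q) (x3 * q) (x4 * q) (y1 * q) (y2 * q) (y3 * q) (y4 * q) q) (fun _ => 0) q 0 hq
  (h44_bdd _ _ _ _ _ _ _ _ _ hq (s _ r1) (s _ r2) (s _ r3) (s _ r4)) (bddC_const 0) (cvgC_const 0)) as [ex' _].
rewrite Cseries_head by exact ex. rewrite <- Cseries_scal by exact ex'. f_equal.
- unfold h44. simpl. field.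
- apply Cseries_ext. intros k. unfold h44. rewrite !qprod_head.
  assert (a1 := f _ r1). assert (a2 := f _ r2). assert (a3 := f _ r3). assert (a4 := f _ r4).
  assert (b1 := s _ r1 k). assert (b2 := s _ r2 k). assert (b3 := s _ r3 k). assert (b4 := s _ r4 k).
  simpl. cfield.
Qed.

(** [residues_limit] with u = (a, l, 1), x = (qa/b, qa/c, qa/d), y = (q/e, q/f), v = (q, q/(ef)).
    The poles from u = 1 and v = q form the bilateral series, those from v = q/(ef) the series on
    the right. *)
Lemma four_series_relation (q a b c d e f l v z : C) :
  q <> 0 -> (Cmod q < 1)%R -> a <> 0 -> b <> 0 -> c <> 0 -> d <> 0 -> e <> 0 -> f <> 0 ->
  generic q a b c d e f ->
  l = q * a * a / (b * c * d) -> v = b * c * d / (q * a) ->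
  z = q * q * a * a / (b * c * d * e * f) ->
  / a * (qpoch_inf (q / b) q * qpoch_inf (q / c) q * qpoch_inf (q / d) q *
         qpoch_inf (q * a / e) q * qpoch_inf (q * a / f) q /
         (qpoch_inf q q * qpoch_inf (1 / v) q * qpoch_inf (1 / a) q * qpoch_inf (q * a) q *
          qpoch_inf (q * a / (e * f)) q)) *
    hser b c d (q * a / (e * f)) q (q * a / e) (q * a / f) (q * v) q +
  / l * (qpoch_inf (c * d / a) q * qpoch_inf (b * d / a) q * qpoch_inf (b * c / a) q *
         qpoch_inf (z * f) q * qpoch_inf (z * e) q /
         (qpoch_inf q q * qpoch_inf v q * qpoch_inf (1 / l) q * qpoch_inf (q * l) q * qpoch_inf z q)) *
    hser (q * a / (b * c)) (q * a / (b * d)) (q * a / (c * d)) z q (q / v) (z * e) (z * f) q +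
  qpoch_inf (q * a / b) q * qpoch_inf (q * a / c) q * qpoch_inf (q * a / d) q *
         qpoch_inf (q / e) q * qpoch_inf (q / f) q /
         (qpoch_inf q q * qpoch_inf a q * qpoch_inf l q * qpoch_inf q q * qpoch_inf (q / (e * f)) q) *
    (hser a e f l (q * a / b) (q * a / c) (q * a / d) (e * f) q +
     (hser (b / a) (c / a) (d / a) (q / (e * f)) (q / a) (q / e) (q / f) (q / l) q - 1)) =
  q / (e * f) * (qpoch_inf (q * q * a / (b * e * f)) q * qpoch_inf (q * q * a / (c * e * f)) q *
         qpoch_inf (q * q * a / (d * e * f)) q * qpoch_inf f q * qpoch_inf e q /
         (qpoch_inf q q * qpoch_inf (e * f) q * qpoch_inf (q * a / (e * f)) q * qpoch_inf z q *
          qpoch_inf (q / (e * f)) q)) *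
    hser (q / e) (q / f) (q * a / (e * f)) z q (q * q * a / (b * e * f)) (q * q * a / (c * e * f))
      (q * q * a / (d * e * f)) q.
Proof.
intros hq hq1 ha hb hc hd he hf G hl hv hz.
assert (h1 := C1_nz).
assert (hl0 : l <> 0) by nz.
assert (hv0 : v <> 0) by nz.
assert (hz0 : z <> 0) by nz.
assert (hef : e * f <> 0) by nz.
assert (nz : forall x y : C, x <> 0 -> y <> 0 -> q * x / y <> 0).
{ intros x y hx hy. apply neq0_div; [apply Cmult_neq_0|]; auto. }
assert (sl : qsep q l) by (rewrite hl; sepq (g_l G)).
assert (sv : qsep q v) by (rewrite hv; sepq (g_v G)).
assert (sz : qsep q z) by (rewrite hz; sepq (g_z G)).
assert (sze : qsep q (z * e)) by (rewrite hz; sepq (g_lf G)).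
assert (szf : qsep q (z * f)) by (rewrite hz; sepq (g_le G)).
assert (R := residues_limit q a l 1 (q * a / b) (q * a / c) (q * a / d) (q / e) (q / f) q (q / (e * f)) hq hq1
  ha hl0 h1 hq (neq0_div _ _ hq hef) (nz _ _ ha hb) (nz _ _ ha hc) (nz _ _ ha hd) (neq0_div _ _ hq he) (neq0_div _ _ hq hf)).
specialize (R ltac:(rewrite hl; field; auto) ltac:(field; auto) ltac:(rewrite hl; sepq (g_v G)) ltac:(sepq (g_a G))
  ltac:(sepq sl) ltac:(sepq (g_ef G))).
assert (ru : forall u, In u [a; l; RtoC 1] -> qreg (q * u) q /\ qreg (q / (e * f) * u) q /\
   qreg (q / e * u) q /\ qreg (q / f * u) q).
{ intros u [<-|[<-|[<-|[]]]]; repeat split; first [rewrite Cmult_1_r; intros k; now apply qprod_q_neq0 | apply qsep_reg].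
  - sepq (g_a G). - sepq (g_efa G). - sepq (g_ea G). - sepq (g_fa G).
  - sepq sl. - rewrite hl. sepq (g_z G). - rewrite hl. sepq (g_le G). - rewrite hl. sepq (g_lf G).
  - sepq (g_ef G). - sepq (g_e G). - sepq (g_f G). }
assert (rx : forall x, In x [q * a / b; q * a / c; q * a / d] -> qreg (x * q) q /\ qreg (x * (q / (e * f))) q).
{ intros x [<-|[<-|[<-|[]]]]; split; apply qsep_reg.
  - sepq (g_ba G). - sepq (g_bef G). - sepq (g_ca G). - sepq (g_cef G). - sepq (g_da G). - sepq (g_def G). }
specialize (R ru rx). cbv zeta beta in R. clear ru rx.
unfold h55inf in R.
cast R (q * a / b / a) (q / b).
cast R (q * a / c / a) (q / c).
cast R (q * a / d / a) (q / d).
cast R (l / a) (1 / v).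
cast R (a / l) v.
cast R (q * a / b / l) (c * d / a).
cast R (q * a / c / l) (b * d / a).
cast R (q * a / d / l) (b * c / a).
cast R (q / e * a) (q * a / e).
cast R (q / f * a) (q * a / f).
cast R (q / (e * f) * a) (q * a / (e * f)).
cast R (q / e * l) (z * f).
cast R (q / f * l) (z * e).
cast R (q / (e * f) * l) z.
replace (q / e * 1) with (q / e) in R by ring.
replace (q / f * 1) with (q / f) in R by ring.
replace (q / (e * f) * 1) with (q / (e * f)) in R by ring.
replace (q * 1) with q in R by ring.
cast R (q * a / b / 1) (q * a / b).
cast R (q * a / c / 1) (q * a / c).
cast R (q * a / d / 1) (q * a / d).
cast R (a / 1) a.
cast R (l / 1) l.
cast R (q / e / q) (1 / e).
cast R (q / f / q) (1 / f).
cast R (q / (e * f) / q) (1 / (e * f)).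
replace (1 * q) with q in R by ring.
cast R (q / e / (q / (e * f))) f.
cast R (q / f / (q / (e * f))) e.
cast R (q / (q / (e * f))) (e * f).
cast R (a * (q / (e * f))) (q * a / (e * f)).
cast R (l * (q / (e * f))) z.
replace (1 * (q / (e * f))) with (q / (e * f)) in R by ring.
cast R (q * a / b * (q / (e * f))) (q * q * a / (b * e * f)).
cast R (q * a / c * (q / (e * f))) (q * q * a / (c * e * f)).
cast R (q * a / d * (q / (e * f))) (q * q * a / (d * e * f)).
cast R (q * a / (q * a / b)) b.
cast R (q * a / (q * a / c)) c.
cast R (q * a / (q * a / d)) d.
cast R (q * a / 1) (q * a).
cast R (q * a / l) (q * v).
cast R (q * l / (q * a / b)) (q * a / (c * d)).
cast R (q * l / (q * a / c)) (q * a / (b * d)).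
cast R (q * l / (q * a / d)) (q * a / (b * c)).
cast R (q * l / a) (q / v).
cast R (q * l / 1) (q * l).
cast R (q / (q * a / b)) (b / a).
cast R (q / (q * a / c)) (c / a).
cast R (q / (q * a / d)) (d / a).
cast R (q * q / (q / e)) (e * q).
cast R (q * q / (q / f)) (f * q).
cast R (q * q / (q / (e * f))) (e * f * q).
cast R (q * (q / (e * f)) / (q / e)) (q / f).
cast R (q * (q / (e * f)) / (q / f)) (q / e).
cast R (q * (q / (e * f)) / q) (q / (e * f)).
assert (P : forall x, qsep q x -> forall k, qprod x q k <> 0) by (intros x h; now apply qsep_reg).
assert (sqa : qsep q (q * a)) by sepq (g_a G).
assert (sql : qsep q (q * l)) by sepq sl.
assert (sqv : qsep q (q * v)) by sepq sv.
assert (sqv' : qsep q (q / v)) by sepq sv.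
assert (sae : qsep q (q * a / e)) by sepq (g_ea G).
assert (saf : qsep q (q * a / f)) by sepq (g_fa G).
assert (sab : qsep q (q * a / b)) by sepq (g_ba G).
assert (sac : qsep q (q * a / c)) by sepq (g_ca G).
assert (sad : qsep q (q * a / d)) by sepq (g_da G).
assert (sqe : qsep q (q / e)) by sepq (g_e G).
assert (sqf : qsep q (q / f)) by sepq (g_f G).
assert (sqla : qsep q (q / l)) by sepq sl.
assert (sqa' : qsep q (q / a)) by sepq (g_a G).
assert (sqef : qsep q (q / (e * f))) by sepq (g_ef G).
assert (sqab : qsep q (q * a / b * q)) by sepq (g_ba G).
assert (sqac : qsep q (q * a / c * q)) by sepq (g_ca G).
assert (sqad : qsep q (q * a / d * q)) by sepq (g_da G).
assert (sefq : qsep q (e * f * q)) by sepq (g_ef G).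
assert (sbef : qsep q (q * q * a / (b * e * f))) by sepq (g_bef G).
assert (scef : qsep q (q * q * a / (c * e * f))) by sepq (g_cef G).
assert (sdef : qsep q (q * q * a / (d * e * f))) by sepq (g_def G).
assert (Pq : forall k, qprod q q k <> 0) by (intros k; now apply qprod_q_neq0).
assert (S1 : Cseries (fun k => h55 b c d (q * a) (q * a / (e * f)) q (q * v) (q * a) (q * a / e) (q * a / f) q k * q ^ k)
   = hser b c d (q * a / (e * f)) q (q * a / e) (q * a / f) (q * v) q).
{ apply Cseries_ext. intros k. unfold h55, h44.
  cfield. }
assert (S2 : Cseries (fun k => h55 (q * a / (c * d)) (q * a / (b * d)) (q * a / (b * c)) (q * l) z q (q / v) (q * l) (z * f) (z * e) q k * q ^ k)
   = hser (q * a / (b * c)) (q * a / (b * d)) (q * a / (c * d)) z q (q / v) (z * e) (z * f) q).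
{ apply Cseries_ext. intros k. unfold h55, h44.
  cfield. }
assert (S3 : Cseries (fun k => h55 (b / a) (c / a) (d / a) q (q / (e * f)) q (q / a) (q / l) (q / e) (q / f) q k * q ^ k)
   = hser (b / a) (c / a) (d / a) (q / (e * f)) (q / a) (q / e) (q / f) (q / l) q).
{ apply Cseries_ext. intros k. unfold h55, h44.
  cfield. }
assert (S4 : Cseries (fun k => h55 (e * q) (f * q) (a * q) (l * q) q q (e * f * q) (q * a / b * q) (q * a / c * q) (q * a / d * q) q k * q ^ k)
   = hser (a * q) (e * q) (f * q) (l * q) (q * a / b * q) (q * a / c * q) (q * a / d * q) (e * f * q) q).
{ apply Cseries_ext. intros k. unfold h55, h44.
  cfield. }
assert (S5 : Cseries (fun k => h55 (q / f) (q / e) (q * a / (e * f)) z (q / (e * f)) q (q / (e * f)) (q * q * a / (b * e * f)) (q * q * a / (c * e * f)) (q * q * a / (d * e * f)) q k * q ^ k)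
   = hser (q / e) (q / f) (q * a / (e * f)) z q (q * q * a / (b * e * f)) (q * q * a / (c * e * f)) (q * q * a / (d * e * f)) q).
{ apply Cseries_ext. intros k. unfold h55, h44.
  cfield. }
rewrite S1, S2, S3, S4, S5 in R. clear S1 S2 S3 S4 S5.
(* The leading 1 cancels the -1 of the statement, which avoids counting index 0 in both halves. *)
assert (HH := hser_head a e f l (q * a / b) (q * a / c) (q * a / d) (e * f) q hq1
  (qsep_reg _ _ sab) (qsep_reg _ _ sac) (qsep_reg _ _ sad) (qsep_reg _ _ (g_ef G))).
rewrite HH. clear HH.
assert (I : forall x, qsep q x -> qpoch_inf x q <> 0).
{ intros x h; apply qpoch_inf_neq0; [exact hq1|now apply qsep_reg]. }
assert (nq : qpoch_inf q q <> 0) by now apply qpoch_inf_neq0.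
assert (k1 := qpoch_inf_head (q * a / b) q hq1). assert (k2 := qpoch_inf_head (q * a / c) q hq1).
assert (k3 := qpoch_inf_head (q * a / d) q hq1). assert (k4 := qpoch_inf_head (1 / e) q hq1).
assert (k5 := qpoch_inf_head (1 / f) q hq1). assert (k6 := qpoch_inf_head (1 / (e * f)) q hq1).
assert (k7 := qpoch_inf_head a q hq1). assert (k8 := qpoch_inf_head l q hq1).
cast k4 (1 / e * q) (q / e).
cast k5 (1 / f * q) (q / f).
cast k6 (1 / (e * f) * q) (q / (e * f)).
assert (m1 := qsep_neq1 _ _ sab). assert (m2 := qsep_neq1 _ _ sac). assert (m3 := qsep_neq1 _ _ sad).
assert (m4 := qsep_neq1 _ _ (g_ef G)). assert (m5 := qsep_neq1 _ _ (g_a G)). assert (m6 := qsep_neq1 _ _ sl).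
assert (j1 : qpoch_inf (a * q) q <> 0) by (apply I; sepq (g_a G)).
assert (j2 : qpoch_inf (l * q) q <> 0) by (apply I; sepq sl).
assert (m7 : e * f - 1 <> 0) by (intros e0; apply m4; replace (1 - e * f) with (- (e * f - 1)) by ring; rewrite e0; ring).
rewrite (Cmult_comm q a) in R |- *.
rewrite (Cmult_comm q l) in R |- *.
rewrite (Cmult_comm q a) in k1, k2, k3, m1, m2, m3.
rewrite k1, k2, k3, k7, k8. rewrite k4, k5, k6 in R. rewrite k1, k2, k3, k7, k8 in R.
(* The coefficients are matched family by family; only the third term of the goal merges two of
   them, u = 1 and v = q. *)
match type of R with ?r1 + ?r2 + ?r3 + ?r4 + ?r5 = _ =>
  match goal with |- ?g1 + ?g2 + ?g3 = ?g5 =>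
   assert (t1 : g1 = - r1) by (unfold Cdiv; ring);
   assert (t2 : g2 = - r2) by (unfold Cdiv; ring);
   assert (t5 : g5 = r5) by (unfold Cdiv; ring);
   assert (t3 : g3 = - r3 - r4) end end.
{ clear R t1 t2 t5.
  set (Ta := hser (b / a) _ _ _ _ _ _ _ _). set (Tb := hser (a * q) _ _ _ _ _ _ _ _).
  clearbody Ta Tb.
  assert (m1' : b - a * q <> 0) by (intros e0; apply m1; replace (1 - a * q / b) with ((b - a * q) / b) by (field; auto); rewrite e0; field; auto).
  assert (m2' : c - a * q <> 0) by (intros e0; apply m2; replace (1 - a * q / c) with ((c - a * q) / c) by (field; auto); rewrite e0; field; auto).
  assert (m3' : d - a * q <> 0) by (intros e0; apply m3; replace (1 - a * q / d) with ((d - a * q) / d) by (field; auto); rewrite e0; field; auto).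
  cfield. }
etransitivity; [apply (f_equal2 Cplus (f_equal2 Cplus t1 t2) t3)|].
etransitivity; [|symmetry; exact t5].
match type of R with ?r1 + ?r2 + ?r3 + ?r4 + ?r5 = _ =>
  transitivity (r5 - (r1 + r2 + r3 + r4 + r5)); [ring|rewrite R; ring] end.
Qed.

Definition rhs_A (q a b c d e f : C) : C :=
    qpochs_inf [q * a; q / a; q / e; q / f; q * a / (b * c); q * a / (b * d);
                q * a / (c * d); q * a / (e * f)] q /
    qpochs_inf [q; q / b; q / c; q / d; q * a / e; q * a / f;
                q * a ^ 2 / (b * c * d); q / (e * f)] q.

Definition rhs_B (q a b c d e f : C) : C :=
    qpochs_inf [q * a; b / a; c / a; d / a; q * a / (e * f);
                q ^ 2 * a / (b * c * d); q ^ 2 * a ^ 2 / (b * c * d * e);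
                q ^ 2 * a ^ 2 / (b * c * d * f)] q /
    qpochs_inf [q / b; q / c; q / d; q * a / e; q * a / f;
                b * c * d / (q * a ^ 2); q ^ 2 * a ^ 2 / (b * c * d);
                q ^ 2 * a ^ 2 / (b * c * d * e * f)] q.

Definition rhs_C (q a b c d e f : C) : C :=
    qpochs_inf [a; q * a; q / a; e; f; q * a / (b * c); q * a / (b * d);
                q * a / (c * d); q ^ 2 * a / (b * e * f);
                q ^ 2 * a / (c * e * f); q ^ 2 * a / (d * e * f)] q /
    qpochs_inf [q / b; q / c; q / d; q * a / b; q * a / c; q * a / d;
                q * a / e; q * a / f; e * f / q; q ^ 2 / (e * f);
                q ^ 2 * a ^ 2 / (b * c * d * e * f)] q.

(** The right-hand side of the theorem with the 4psi4 split into two series that share the index 0.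
    Parameters keep their form in the theorem, so that the two are convertible there. *)
Definition rhs (q a b c d e f : C) : C :=
  rhs_A q a b c d e f *
    (hser a e f (q * a ^ 2 / (b * c * d)) (q * a / b) (q * a / c) (q * a / d) (e * f) q +
     (hser (b / a) (c / a) (d / a) (q / (e * f)) (q / a) (q / e) (q / f)
        (q / (q * a ^ 2 / (b * c * d))) q - 1)) +
  rhs_B q a b c d e f *
    hser (q * a / (b * c)) (q * a / (b * d)) (q * a / (c * d))
          (q ^ 2 * a ^ 2 / (b * c * d * e * f)) q
          (q ^ 2 * a / (b * c * d)) (q ^ 2 * a ^ 2 / (b * c * d * e))
          (q ^ 2 * a ^ 2 / (b * c * d * f)) q +
  rhs_C q a b c d e f *
    hser (q / e) (q / f) (q * a / (e * f))
          (q ^ 2 * a ^ 2 / (b * c * d * e * f)) q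
          (q ^ 2 * a / (b * e * f)) (q ^ 2 * a / (c * e * f))
          (q ^ 2 * a / (d * e * f)) q.

Lemma hser_swap (x1 x2 x3 x4 y1 y2 y3 y4 q : C) :
  hser x1 x2 x3 x4 y1 y2 y3 y4 q = hser x1 x2 x3 x4 y1 y2 y4 y3 q.
Proof. apply Cseries_ext. intros k. unfold h44. f_equal. f_equal. ring. Qed.

(** A multiple of [four_series_relation] removes the first series of [watson_qsep]; the coefficient
    left at the second series is a single product by [theta_identity]. *)
Lemma corollary_generic (q a b c d e f : C) :
  q <> 0 -> (Cmod q < 1)%R -> a <> 0 -> b <> 0 -> c <> 0 -> d <> 0 -> e <> 0 -> f <> 0 ->
  (Cmod (q ^ 2 * a ^ 2 / (b * c * d * e * f)) < 1)%R ->
  generic q a b c d e f ->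
  Cseries (fun k => w87 a b c d e f q k * (q ^ 2 * a ^ 2 / (b * c * d * e * f)) ^ k) = rhs q a b c d e f.
Proof.
intros hq hq1 ha hb hc hd he hf hz1 G.
set (z := q ^ 2 * a ^ 2 / (b * c * d * e * f)) in *.
set (l := q * a ^ 2 / (b * c * d)).
set (v := b * c * d / (q * a)).
assert (hl : l = q * a * a / (b * c * d)) by (unfold l; field; auto).
assert (hv : v = b * c * d / (q * a)) by reflexivity.
assert (hz : z = q * q * a * a / (b * c * d * e * f)) by (unfold z; field; auto 10).
assert (hl0 : l <> 0) by nz.
assert (hv0 : v <> 0) by nz.
assert (hz0 : z <> 0) by nz.
assert (sl : qsep q l) by (rewrite hl; sepq (g_l G)).
assert (sv : qsep q v) by (rewrite hv; sepq (g_v G)).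
assert (sz : qsep q z) by (rewrite hz; sepq (g_z G)).
assert (sze : qsep q (z * e)) by (rewrite hz; sepq (g_lf G)).
assert (szf : qsep q (z * f)) by (rewrite hz; sepq (g_le G)).
assert (saz : qsep q (a * z)) by (rewrite hz; sepq (g_az G)).
assert (sab : qsep q (q * a / b)) by sepq (g_ba G).
assert (sac : qsep q (q * a / c)) by sepq (g_ca G).
assert (sad : qsep q (q * a / d)) by sepq (g_da G).
assert (sae : qsep q (q * a / e)) by sepq (g_ea G).
assert (saf : qsep q (q * a / f)) by sepq (g_fa G).
assert (sbd : qsep q (q * a / (b * d))) by sepq (g_bd G).
assert (scd : qsep q (q * a / (c * d))) by sepq (g_cd G).
assert (W := watson_qsep q a b c d e f z v hq hq1 hz1 ha hb hc hd he hf hz hv (g_a G) sab sac sad sae saf sv sz sbd scd sze szf saz (g_d G)).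
assert (P := four_series_relation q a b c d e f l v z hq hq1 ha hb hc hd he hf G hl hv hz).
assert (T := theta_identity q a b c d e f hq hq1 ha hb hc hd he hf G).
unfold theta_rel in T. rewrite <- hl, <- hv in T.
fold (hser b c d (q * a / (e * f)) q (q * a / e) (q * a / f) (q * v) q) in W.
fold (hser (q * a / (b * c)) (q * a / (b * d)) (q * a / (c * d)) z q (q / v) (z * e) (z * f) q) in W.
rewrite W. clear W.
unfold rhs, rhs_A, rhs_B, rhs_C. fold l z.
replace (q ^ 2 * a / (b * c * d)) with (q / v) by (rewrite hv; field; auto).
replace (q ^ 2 * a ^ 2 / (b * c * d * e)) with (z * f) by (rewrite hz; field; auto 10).
replace (q ^ 2 * a ^ 2 / (b * c * d * f)) with (z * e) by (rewrite hz; field; auto 10).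
replace (q ^ 2 * a ^ 2 / (b * c * d)) with (q * l) by (rewrite hl; field; auto 10).
replace (b * c * d / (q * a ^ 2)) with (1 / l) by (rewrite hl; field; auto 10).
replace (q ^ 2 * a) with (q * q * a) by ring.
replace (q ^ 2) with (q * q) by ring.
rewrite (hser_swap _ _ _ _ _ _ (z * f)).
set (Ra := hser b c d _ _ _ _ _ _) in *. set (Rl := hser (q * a / (b * c)) _ _ _ _ _ _ _ _) in *.
set (psi := hser a e f _ _ _ _ _ _ + _) in *. set (Sf := hser (q / e) _ _ _ _ _ _ _ _) in *.
clearbody Ra Rl psi Sf.
unfold theta in T.
cast T (q / (b / a)) (q * a / b).
cast T (q / (c / a)) (q * a / c).
cast T (q / (d / a)) (q * a / d).
cast T (q / (c * d / a)) (q * a / (c * d)).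
cast T (q / (b * d / a)) (q * a / (b * d)).
cast T (q / (b * c / a)) (q * a / (b * c)).
assert (I : forall x, qsep q x -> qpoch_inf x q <> 0).
{ intros x h; apply qpoch_inf_neq0; [exact hq1|now apply qsep_reg]. }
assert (nq : qpoch_inf q q <> 0) by (apply qpoch_inf_neq0; [exact hq1|intros k; now apply qprod_q_neq0]).
assert (k1 := qpoch_inf_head a q hq1). rewrite (Cmult_comm a q) in k1.
assert (k2 := qpoch_inf_head (1 / a) q hq1). cast k2 (1 / a * q) (q / a).
assert (k3 := qpoch_inf_head l q hq1). rewrite (Cmult_comm l q) in k3.
assert (k4 := qpoch_inf_head (1 / l) q hq1). cast k4 (1 / l * q) (q / l).
assert (k5 := qpoch_inf_head (e * f / q) q hq1). cast k5 (e * f / q * q) (e * f).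
assert (k6 := qpoch_inf_head (q / (e * f)) q hq1). cast k6 (q / (e * f) * q) (q * q / (e * f)).
assert (m1 := qsep_neq1 _ _ (g_a G)). assert (m2 := qsep_neq1 _ _ sl).
assert (sef' : qsep q (e * f / q)) by sepq (g_ef G).
assert (m3 := qsep_neq1 _ _ sef').
assert (m4 : q - e * f <> 0).
{ intros e0. apply m3. replace (1 - e * f / q) with ((q - e * f) * / q) by (field; auto). rewrite e0. ring. }
assert (m5 : e * f - q <> 0).
{ intros e0. apply m4. replace (q - e * f) with (- (e * f - q)) by ring. rewrite e0. ring. }
assert (m6 : a - 1 <> 0) by (intros e0; apply m1; replace (1 - a) with (- (a - 1)) by ring; rewrite e0; ring).
assert (m7 : l - 1 <> 0) by (intros e0; apply m2; replace (1 - l) with (- (l - 1)) by ring; rewrite e0; ring).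
assert (i1 := I _ sab). assert (i2 := I _ sac). assert (i3 := I _ sad). assert (i4 := I _ sae).
assert (i5 := I _ saf). assert (i6 := I _ sz). assert (i7 := I _ sv).
assert (i8 : qpoch_inf (1 / v) q <> 0) by (apply I; sepq sv).
assert (i9 : qpoch_inf (q * a) q <> 0) by (apply I; sepq (g_a G)).
assert (i10 : qpoch_inf (q / a) q <> 0) by (apply I; sepq (g_a G)).
assert (i11 : qpoch_inf (q * l) q <> 0) by (apply I; sepq sl).
assert (i12 : qpoch_inf (q / l) q <> 0) by (apply I; sepq sl).
assert (i13 : qpoch_inf (q / b) q <> 0) by (apply I; sepq (g_b G)).
assert (i14 : qpoch_inf (q / c) q <> 0) by (apply I; sepq (g_c G)).
assert (i15 : qpoch_inf (q / d) q <> 0) by (apply I; sepq (g_d G)).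
assert (i16 : qpoch_inf (e * f) q <> 0) by (apply I; exact (g_ef G)).
assert (i17 : qpoch_inf (q * q / (e * f)) q <> 0) by (apply I; sepq (g_ef G)).
assert (i18 : qpoch_inf (q * a / (e * f)) q <> 0) by (apply I; sepq (g_efa G)).
unfold qpochs_inf, Cprod. cbn [map fold_right].
rewrite k1, k2, k3, k4, k6 in P. rewrite k1, k3 in T. rewrite k1, k3, k4, k5, k6.
clear - P T ha hl0 he hf hq m1 m2 m4 m5 m6 m7 nq i1 i2 i3 i4 i5 i6 i7 i8 i9 i10 i11 i12 i13 i14 i15 i16 i17 i18.
set (Q0 := qpoch_inf q q) in *.
set (A1 := qpoch_inf (q * a) q) in *. set (A2 := qpoch_inf (q / a) q) in *.
set (L1 := qpoch_inf (q * l) q) in *. set (L2 := qpoch_inf (q / l) q) in *.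
set (V1 := qpoch_inf v q) in *. set (V3 := qpoch_inf (q / v) q) in *.
set (B1 := qpoch_inf b q) in *. set (B2 := qpoch_inf (q / b) q) in *.
set (B3 := qpoch_inf (b / a) q) in *. set (B4 := qpoch_inf (q * a / b) q) in *.
set (C1' := qpoch_inf c q) in *. set (C2' := qpoch_inf (q / c) q) in *.
set (C3' := qpoch_inf (c / a) q) in *. set (C4' := qpoch_inf (q * a / c) q) in *.
set (D1 := qpoch_inf d q) in *. set (D2 := qpoch_inf (q / d) q) in *.
set (D3 := qpoch_inf (d / a) q) in *. set (D4 := qpoch_inf (q * a / d) q) in *.
set (F1 := qpoch_inf (c * d / a) q) in *. set (F2 := qpoch_inf (q * a / (c * d)) q) in *.
set (F3 := qpoch_inf (b * d / a) q) in *. set (F4 := qpoch_inf (q * a / (b * d)) q) in *.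
set (F5 := qpoch_inf (b * c / a) q) in *. set (F6 := qpoch_inf (q * a / (b * c)) q) in *.
set (E1 := qpoch_inf (q * a / e) q) in *. set (E2 := qpoch_inf (q * a / f) q) in *.
set (E3 := qpoch_inf (q * a / (e * f)) q) in *.
set (Z1 := qpoch_inf z q) in *. set (Z2 := qpoch_inf (z * e) q) in *. set (Z3 := qpoch_inf (z * f) q) in *.
clearbody Q0 A1 A2 L1 L2 V1 V3 B1 B2 B3 B4 C1' C2' C3' C4' D1 D2 D3 D4 F1 F2 F3 F4 F5 F6 E1 E2 E3 Z1 Z2 Z3 l v z.
assert (T' : B1 * B2 * (C1' * C2') * (D1 * D2) * ((1 - l) * L1 * L2) =
  (1 - a) * A1 * A2 * (F1 * F2) * (F3 * F4) * (F5 * F6) -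
  l * (B3 * B4 * (C3' * C4') * (D3 * D4) * (V1 * V3))) by (rewrite <- T; ring).
(* The ratio of the coefficients of [Ra] in the Watson transformation and in the four-series
   relation. *)
set (M := (a - 1) * Q0 * A1 * A1 * A2 * E3 * F6 * F4 * F2 / (B4 * C4' * D4 * B2 * C2' * D2 * E1 * E2)).
match type of P with ?pa * Ra + ?pl * Rl + ?pg * psi = ?ps * Sf =>
  set (ca := pa) in *; set (cl := pl) in *; set (cg := pg) in *; set (cs := ps) in * end.
match goal with |- ?ga * Ra + ?gl * Rl = ?hg * psi + ?hl * Rl + ?hs * Sf =>
  assert (t1 : ga = M * ca) by (unfold M, ca; field; repeat split; auto);
  assert (t2 : hg = - (M * cg)) by (unfold M, cg; field; repeat split; auto);
  assert (t3 : hs = - (M * - cs)) by (unfold M, cs; field; repeat split; auto);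
  (* The coefficient of [Rl]. It is extended by the first product of the addition formula so that
     [T'] can be substituted. *)
  assert (t4 : gl = M * cl + hl);
  [transitivity (A1 * Z2 * Z3 * E3 / (B4 * C4' * D4 * Z1 * E1 * E2 * V1) / (B2 * C2' * D2 * ((1 - l) * L1 * L2)) *
     (B1 * B2 * (C1' * C2') * (D1 * D2) * ((1 - l) * L1 * L2)));
   [field; repeat split; auto | rewrite T'; unfold M, cl; field; repeat split; auto]
  | generalize dependent hl; generalize dependent hs; generalize dependent hg;
    generalize dependent ga; generalize dependent gl]
end.
intros gl ga t1 hg t2 hs t3 hl t4. rewrite t1, t4, t2, t3.
transitivity (M * (ca * Ra + cl * Rl + cg * psi) - M * cg * psi + hl * Rl); [ring|].
rewrite P. ring.
Qed.

(** * Removing the genericity assumption *)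

(** Scale factors approach 1 strictly from above, so multiplication by a positive power of one
    strictly increases every nonzero modulus. *)
Definition sper (n : nat) : R := (1 + / INR (S n))%R.

Lemma sper_gt1 (n : nat) : (1 < sper n)%R.
Proof.
unfold sper. assert (0 < / INR (S n))%R by (apply Rinv_0_lt_compat, lt_0_INR; lia). lra.
Qed.

Lemma cvgC_sper : cvgC (fun n => RtoC (sper n)) 1.
Proof.
intros eps he. destruct (archimed_cor1 eps he) as (N & h & hN).
exists N. intros n hn. unfold sper. rewrite <- RtoC_minus, Cmod_R.
replace (1 + / INR (S n) - 1)%R with (/ INR (S n))%R by ring.
assert (hp : (0 < INR N)%R) by (apply lt_0_INR; lia).
rewrite Rabs_pos_eq.
- eapply Rle_lt_trans; [|exact h]. apply Rinv_le_contravar; [exact hp|apply le_INR; lia].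
- left. apply Rinv_0_lt_compat, lt_0_INR. lia.
Qed.

Lemma pow_antitone (r : R) (i j : nat) : (0 < r < 1)%R -> (r ^ i < r ^ j)%R -> (j < i)%nat.
Proof.
intros hr h. destruct (le_lt_dec i j) as [hij|hij]; [|exact hij]. exfalso.
assert (r ^ j <= r ^ i)%R; [|lra].
replace j with (i + (j - i))%nat by lia. rewrite pow_add.
assert (0 < r ^ i)%R by (apply pow_lt; lra).
assert (r ^ (j - i) <= 1)%R.
{ replace 1%R with (1 ^ (j - i))%R by apply pow1. apply pow_incr. lra. }
assert (0 < r ^ (j - i))%R by (apply pow_lt; lra). nra.
Qed.

(** Places X between consecutive integer powers of r. The interval is closed below and open above,
    so a small increase of X lands strictly inside it, even when X is itself a power. *)
Lemma bracket_pow (r X : R) : (0 < r < 1)%R -> (0 < X)%R ->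
  exists i j, (r ^ S i <= X * r ^ j < r ^ i)%R.
Proof.
intros hr hX.
destruct (pow_lt_1_zero r) with (y := (/ X)%R) as [j hj];
  [rewrite Rabs_pos_eq; lra|now apply Rinv_0_lt_compat|].
specialize (hj j (le_n j)). rewrite Rabs_pos_eq in hj by (apply pow_le; lra).
assert (hY : (0 < X * r ^ j < 1)%R).
{ split; [apply Rmult_lt_0_compat; [lra|apply pow_lt; lra]|].
  apply (Rmult_lt_compat_l X) in hj; [|exact hX]. rewrite Rinv_r in hj; lra. }
set (Y := (X * r ^ j)%R) in *.
destruct (pow_lt_1_zero r) with (y := Y) as [N hN];
  [rewrite Rabs_pos_eq; lra|lra|].
specialize (hN N (le_n N)). rewrite Rabs_pos_eq in hN by (apply pow_le; lra).
assert (H : exists i, (r ^ S i <= Y < r ^ i)%R).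
{ assert (H0 : forall n, (r ^ n <= Y)%R -> exists i, (r ^ S i <= Y < r ^ i)%R).
  { induction n as [|n IH]; intros h; [simpl in h; lra|].
    destruct (Rle_lt_dec (r ^ n) Y) as [h'|h']; [now apply IH|].
    exists n. split; assumption. }
  apply (H0 N). lra. }
destruct H as [i hi]. exists i, j. exact hi.
Qed.

(** Moving off a point radially leaves the discrete set [|q|^Z]. *)
Lemma qsep_perturb (q x : C) (w : nat) : (0 < Cmod q < 1)%R -> x <> 0 -> (1 <= w)%nat ->
  exists N, forall n, (N <= n)%nat -> qsep q (x * RtoC (sper n) ^ w).
Proof.
intros hq hx hw. assert (px : (0 < Cmod x)%R) by now apply Cmod_gt_0.
destruct (bracket_pow (Cmod q) (Cmod x) hq px) as (i & j & h1 & h2).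
set (r := Cmod q) in *. set (Y := (Cmod x * r ^ j)%R) in *.
assert (hY : (0 < Y)%R) by (apply Rmult_lt_0_compat; [lra|apply pow_lt; lra]).
assert (hgap : (0 < r ^ i / Y - 1)%R).
{ assert (1 < r ^ i / Y)%R; [|lra]. apply (Rmult_lt_reg_r Y); [exact hY|].
  unfold Rdiv. rewrite Rmult_assoc, Rinv_l; lra. }
destruct (cvgC_pow _ _ w cvgC_sper _ hgap) as [N HN].
exists N. intros n hn. specialize (HN n hn).
rewrite Cpow_1_l in HN. rewrite <- RtoC_pow, <- RtoC_minus, Cmod_R in HN.
assert (ht : (1 < sper n ^ w)%R) by (apply Rlt_pow_R1; [apply sper_gt1|lia]).
rewrite Rabs_pos_eq in HN by lra.
set (t := (sper n ^ w)%R) in *.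
assert (htY : (Y * t < r ^ i)%R).
{ assert (t < r ^ i / Y)%R by lra.
  apply (Rmult_lt_compat_l Y) in H; [|exact hY].
  replace (Y * (r ^ i / Y))%R with (r ^ i)%R in H by (field; lra). exact H. }
intros j' k' e. apply (f_equal Cmod) in e.
rewrite <- RtoC_pow, !Cmod_mult, Cmod_R, !Cmod_pow in e. fold t r in e.
rewrite (Rabs_pos_eq t) in e by lra.
assert (e' : (Y * t * r ^ j' = r ^ (k' + j))%R).
{ rewrite pow_add, <- e. unfold Y. ring. }
assert (pj : (0 < r ^ j')%R) by (apply pow_lt; lra).
(* If the perturbed modulus were a power of r, the exponent k' + j would lie strictly between i + j'
   and i + j' + 1. *)
assert (l1 : (r ^ (S i + j') < r ^ (k' + j))%R).
{ rewrite <- e', pow_add. apply Rmult_lt_compat_r; [exact pj|]. nra. }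
assert (l2 : (r ^ (k' + j) < r ^ (i + j'))%R).
{ rewrite <- e', pow_add. apply Rmult_lt_compat_r; [exact pj|exact htY]. }
apply pow_antitone in l1; [|exact hq]. apply pow_antitone in l2; [|exact hq]. lia.
Qed.

Lemma qsep_perturb_list (q : C) (L : list (C * nat)) : (0 < Cmod q < 1)%R ->
  (forall p, In p L -> fst p <> 0 /\ (1 <= snd p)%nat) ->
  exists N, forall n, (N <= n)%nat -> forall p, In p L -> qsep q (fst p * RtoC (sper n) ^ snd p).
Proof.
intros hq. induction L as [|p L IH]; intros h.
- exists 0%nat. intros n _ p [].
- destruct IH as [N1 H1]; [intros p' hp'; apply h; now right|].
  destruct (h p (or_introl eq_refl)) as [hp hw].
  destruct (qsep_perturb q (fst p) (snd p) hq hp hw) as [N2 H2].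
  exists (Nat.max N1 N2). intros n hn p' [<-|hp'].
  + apply H2. lia.
  + apply H1; [lia|exact hp'].
Qed.

Ltac pert p := match type of p with qsep _ ?x => match goal with |- qsep _ ?y =>
  replace y with x by (field; repeat split; assumption); exact p end end.

Lemma generic_perturb (q a b c d e f : C) : (0 < Cmod q < 1)%R ->
  a <> 0 -> b <> 0 -> c <> 0 -> d <> 0 -> e <> 0 -> f <> 0 ->
  exists N, forall n, (N <= n)%nat -> let s := RtoC (sper n) in
    generic q (a * s) (b * s ^ 2) (c * s ^ 2) (d * s ^ 2) (e * s ^ 3) (f * s ^ 3).
Proof.
intros hq ha hb hc hd he hf.
(* The monomials of [generic] in the order of its fields, each with its exponent of s. *)
pose (L := [(a, 1%nat);
  (b, 2%nat);
  (c, 2%nat);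
  (d, 2%nat);
  (e, 3%nat);
  (f, 3%nat);
  ((b / a), 1%nat);
  ((c / a), 1%nat);
  ((d / a), 1%nat);
  ((e / a), 2%nat);
  ((f / a), 2%nat);
  ((b * c / a), 3%nat);
  ((b * d / a), 3%nat);
  ((c * d / a), 3%nat);
  ((b * c * d / a), 5%nat);
  ((b * c * d / (a * a)), 4%nat);
  ((b * c * d * e * f / (a * a)), 10%nat);
  ((b * c * d * e * f / (a * a * a)), 9%nat);
  ((b * c * d * e / (a * a)), 7%nat);
  ((b * c * d * f / (a * a)), 7%nat);
  (e * f, 6%nat);
  ((e * f / a), 5%nat);
  ((b * e * f / a), 7%nat);
  ((c * e * f / a), 7%nat);
  ((d * e * f / a), 7%nat);
  ((b * c * d * f / (a * a * a)), 6%nat);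
  ((b * c * d * f / a), 8%nat);
  (b * c * d * f, 9%nat);
  (f * a, 4%nat);
  (f * f, 6%nat);
  (f * f * a, 7%nat);
  ((b * c * d / (a * a * f)), 1%nat);
  ((f * f * a * a / (b * c * d)), 2%nat);
  ((f * a / b), 2%nat);
  ((f * a / c), 2%nat);
  ((f * a / d), 2%nat);
  ((f * f * a / b), 5%nat);
  ((f * f * a / c), 5%nat);
  ((f * f * a / d), 5%nat)]).
assert (hL : List.Forall (fun p : C * nat => fst p <> 0 /\ (1 <= snd p)%nat) L).
{ unfold L. repeat apply List.Forall_cons; [.. | apply List.Forall_nil]; split; simpl; try lia;
  repeat first [assumption | apply neq0_div | apply Cmult_neq_0]. }
rewrite List.Forall_forall in hL.
destruct (qsep_perturb_list q L hq hL) as [N HN].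
exists N. intros n hn s. specialize (HN n hn). clear hn. rewrite <- List.Forall_forall in HN. rename HN into hn. fold s in hn. unfold L in hn.
assert (hs : s <> 0).
{ intros h. apply RtoC_inj in h. assert (h' := sper_gt1 n). lra. }
clearbody s. clear hL.
repeat match type of hn with List.Forall _ (_ :: _) =>
  let h := fresh "p" in apply List.Forall_cons_iff in hn; destruct hn as [h hn]; cbn [fst snd] in h end.
constructor.
- pert p.
- pert p0.
- pert p1.
- pert p2.
- pert p3.
- pert p4.
- pert p5.
- pert p6.
- pert p7.
- pert p8.
- pert p9.
- pert p10.
- pert p11.
- pert p12.
- pert p13.
- pert p14.
- pert p15.
- pert p16.
- pert p17.
- pert p18.
- pert p19.
- pert p20.
- pert p21.
- pert p22.
- pert p23.
- pert p24.
- pert p25.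
- pert p26.
- pert p27.
- pert p28.
- pert p29.
- pert p30.
- pert p31.
- pert p32.
- pert p33.
- pert p34.
- pert p35.
- pert p36.
- pert p37.
Qed.

(** * Continuity of both sides of the identity *)

Lemma ubdd_cvg (u : nat -> C) (x : C) : cvgC u x -> ubdd (fun n _ => u n).
Proof.
intros hu. destruct (cvgC_bounded u x hu) as [N HN]. exists (Cmod x + 1)%R, N. auto.
Qed.

Lemma w87_series_cont (q : C) (a b c d e f z : nat -> C) (A B C' D E F Z : C) :
  (Cmod q < 1)%R -> (Cmod Z < 1)%R ->
  cvgC a A -> cvgC b B -> cvgC c C' -> cvgC d D -> cvgC e E -> cvgC f F -> cvgC z Z ->
  1 - A <> 0 -> B <> 0 -> C' <> 0 -> D <> 0 -> E <> 0 -> F <> 0 ->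
  qreg (q * A / B) q -> qreg (q * A / C') q -> qreg (q * A / D) q ->
  qreg (q * A / E) q -> qreg (q * A / F) q ->
  cvgC (fun n => Cseries (fun k => w87 (a n) (b n) (c n) (d n) (e n) (f n) q k * z n ^ k))
       (Cseries (fun k => w87 A B C' D E F q k * Z ^ k)).
Proof.
intros hq hZ ca cb cc cd ce cf cz hA hB hC hD hE hF rB rC rD rE rF.
assert (rq : qreg q q) by (intros k; now apply qprod_q_neq0).
assert (cdiv : forall u U, cvgC u U -> U <> 0 -> cvgC (fun n => q * a n / u n) (q * A / U)).
{ intros u U hu hU. apply cvgC_div; [exact hU| |exact hu]. apply cvgC_mult; [apply cvgC_const|exact ca]. }
assert (c1a : cvgC (fun n => 1 - a n) (1 - A)) by (apply cvgC_minus; [apply cvgC_const|exact ca]).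
assert (U : ubdd (fun n k => w87 (a n) (b n) (c n) (d n) (e n) (f n) q k)).
{ assert (u1 : forall u U, cvgC u U -> ubdd (fun n k => qprod (u n) q k)).
  { intros u U hu. exact (qprod_upper_cvg q u U hq hu). }
  assert (u2 : forall u U, cvgC u U -> qreg U q -> ubdd (fun n k => / qprod (u n) q k)).
  { intros u U hu hU. exact (ubdd_inv q u U hq hu hU). }
  unfold w87, Cdiv.
  repeat apply ubdd_mult.
  - destruct (cvgC_bounded a A ca) as [N HN]. exists (1 + (Cmod A + 1))%R, N. intros n k hn.
    unfold Cminus. eapply Rle_trans; [apply Cmod_triangle|]. rewrite Cmod_1, Cmod_opp, Cmod_mult, Cmod_pow.
    apply Rplus_le_compat_l. rewrite <- (Rmult_1_r (Cmod A + 1)).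
    apply Rmult_le_compat; [apply Cmod_ge_0|apply pow_le, Cmod_ge_0|now apply HN|].
    replace 1%R with (1 ^ (2 * k))%R by apply pow1. apply pow_incr. split; [apply Cmod_ge_0|lra].
  - apply (ubdd_cvg (fun n => / (1 - a n)) (/ (1 - A))). now apply cvgC_inv.
  - exact (u1 _ _ ca).
  - exact (u2 _ _ (cvgC_const q) rq).
  - exact (u1 _ _ cb).
  - exact (u2 _ _ (cdiv _ _ cb hB) rB).
  - exact (u1 _ _ cc).
  - exact (u2 _ _ (cdiv _ _ cc hC) rC).
  - exact (u1 _ _ cd).
  - exact (u2 _ _ (cdiv _ _ cd hD) rD).
  - exact (u1 _ _ ce).
  - exact (u2 _ _ (cdiv _ _ ce hE) rE).
  - exact (u1 _ _ cf).
  - exact (u2 _ _ (cdiv _ _ cf hF) rF). }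
destruct U as (M & N & hM).
(* Midway between |Z| and 1: eventually |z n| <= r, which gives a geometric majorant common to all
   large n. *)
set (r := ((1 + Cmod Z) / 2)%R).
assert (hZ0 := Cmod_ge_0 Z).
assert (hr : (0 <= r < 1)%R) by (unfold r; lra).
destruct (cz (r - Cmod Z)%R) as [N' hN']; [unfold r; lra|].
refine (proj2 (tannery _ _ M r (N + N') hr _ _)).
- intros n k hn. specialize (hM n k ltac:(lia)). specialize (hN' n ltac:(lia)).
  assert (hzr : (Cmod (z n) <= r)%R).
  { replace (z n) with (Z + (z n - Z)) by ring. eapply Rle_trans; [apply Cmod_triangle|]. lra. }
  rewrite Cmod_mult, Cmod_pow. apply Rmult_le_compat; auto using Cmod_ge_0.
  + apply pow_le, Cmod_ge_0.
  + apply pow_incr. split; [apply Cmod_ge_0|exact hzr].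
- intros k. apply cvgC_mult; [|now apply cvgC_pow]. unfold w87.
  assert (v1 : forall u U, cvgC u U -> U <> 0 -> qreg (q * A / U) q ->
    cvgC (fun n => qprod (u n) q k / qprod (q * a n / u n) q k) (qprod U q k / qprod (q * A / U) q k)).
  { intros u U hu hU hr'. apply cvgC_div; [apply hr'|now apply cvgC_qprod|]. apply cvgC_qprod. now apply cdiv. }
  apply cvgC_mult; [apply cvgC_mult; [apply cvgC_div|apply cvgC_div]|].
  + exact hA.
  + apply cvgC_minus; [apply cvgC_const|]. apply cvgC_mult; [exact ca|apply cvgC_const].
  + exact c1a.
  + apply rq.
  + now apply cvgC_qprod.
  + apply cvgC_const.
  + apply cvgC_mult; [apply cvgC_mult; [apply cvgC_mult; [apply cvgC_mult|]|]|]; now apply v1.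
Qed.

Lemma hser_cont (q : C) (x1 x2 x3 x4 y1 y2 y3 y4 : nat -> C) (X1 X2 X3 X4 Y1 Y2 Y3 Y4 : C) :
  (Cmod q < 1)%R ->
  qreg Y1 q -> qreg Y2 q -> qreg Y3 q -> qreg Y4 q ->
  cvgC x1 X1 -> cvgC x2 X2 -> cvgC x3 X3 -> cvgC x4 X4 ->
  cvgC y1 Y1 -> cvgC y2 Y2 -> cvgC y3 Y3 -> cvgC y4 Y4 ->
  cvgC (fun n => hser (x1 n) (x2 n) (x3 n) (x4 n) (y1 n) (y2 n) (y3 n) (y4 n) q)
       (hser X1 X2 X3 X4 Y1 Y2 Y3 Y4 q).
Proof. intros. now apply h44_series_cont. Qed.

Lemma hser_ex (q X1 X2 X3 X4 Y1 Y2 Y3 Y4 : C) : (Cmod q < 1)%R ->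
  qreg Y1 q -> qreg Y2 q -> qreg Y3 q -> qreg Y4 q ->
  ex_Cseries (fun k => h44 X1 X2 X3 X4 Y1 Y2 Y3 Y4 q k * q ^ k).
Proof.
intros hq r1 r2 r3 r4.
apply (h44_series_cont q (fun _ => X1) (fun _ => X2) (fun _ => X3) (fun _ => X4)
  (fun _ => Y1) (fun _ => Y2) (fun _ => Y3) (fun _ => Y4)); auto using cvgC_const.
Qed.

Ltac cvg := repeat first
  [ assumption
  | apply cvgC_const
  | apply cvgC_div; [repeat first [assumption | exact C1_nz | apply Cpow_nz | apply Cmult_neq_0] | |]
  | apply cvgC_plus | apply cvgC_minus | apply cvgC_mult | apply cvgC_pow ].

(** Nonvanishing is asked at the limit point alone, since this is all that the theorem can
    provide. *)
Lemma rhs_cont (q A B C' D E F : C) (a b c d e f : nat -> C) :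
  q <> 0 -> (Cmod q < 1)%R ->
  A <> 0 -> B <> 0 -> C' <> 0 -> D <> 0 -> E <> 0 -> F <> 0 ->
  cvgC a A -> cvgC b B -> cvgC c C' -> cvgC d D -> cvgC e E -> cvgC f F ->
  qpochs_inf [q; q / B; q / C'; q / D; q * A / E; q * A / F;
              q * A ^ 2 / (B * C' * D); q / (E * F)] q <> 0 ->
  qpochs_inf [q / B; q / C'; q / D; q * A / E; q * A / F;
              B * C' * D / (q * A ^ 2); q ^ 2 * A ^ 2 / (B * C' * D);
              q ^ 2 * A ^ 2 / (B * C' * D * E * F)] q <> 0 ->
  qpochs_inf [q / B; q / C'; q / D; q * A / B; q * A / C'; q * A / D;
              q * A / E; q * A / F; E * F / q; q ^ 2 / (E * F);
              q ^ 2 * A ^ 2 / (B * C' * D * E * F)] q <> 0 ->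
  (forall y, In y [q * A / B; q * A / C'; q * A / D; E * F;
     q / A; q / E; q / F; q / (q * A ^ 2 / (B * C' * D));
     q ^ 2 * A / (B * C' * D); q ^ 2 * A ^ 2 / (B * C' * D * E); q ^ 2 * A ^ 2 / (B * C' * D * F);
     q ^ 2 * A / (B * E * F); q ^ 2 * A / (C' * E * F); q ^ 2 * A / (D * E * F)] -> qreg y q) ->
  cvgC (fun n => rhs q (a n) (b n) (c n) (d n) (e n) (f n)) (rhs q A B C' D E F).
Proof.
intros hq hq1 hA hB hC hD hE hF ca cb cc cd ce cf h1 h2 h3 R.
assert (rq : qreg q q) by (intros k; now apply qprod_q_neq0).
assert (nl : q * A ^ 2 / (B * C' * D) <> 0).
{ apply neq0_div; repeat apply Cmult_neq_0; auto. exact C1_nz. }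
assert (PI : forall (L : list (nat -> C)) (L' : list C), Forall2 cvgC L L' ->
   cvgC (fun n => qpochs_inf (map (fun u => u n) L) q) (qpochs_inf L' q)).
{ intros L L' H. induction H as [|u x L L' hu _ IH]; [exact (cvgC_const (qpochs_inf [] q))|].
  unfold qpochs_inf, Cprod in *. simpl. apply cvgC_mult; [|exact IH].
  now apply cvgC_qpoch_inf_cont. }
assert (cA : cvgC (fun n => rhs_A q (a n) (b n) (c n) (d n) (e n) (f n)) (rhs_A q A B C' D E F)).
{ unfold rhs_A. apply cvgC_div; [exact h1| |].
  - apply (PI [fun n => q * a n; fun n => q / a n; fun n => q / e n; fun n => q / f n;
      fun n => q * a n / (b n * c n); fun n => q * a n / (b n * d n);
      fun n => q * a n / (c n * d n); fun n => q * a n / (e n * f n)]).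
    repeat (apply Forall2_cons; [cvg|]). apply Forall2_nil.
  - apply (PI [fun n => q; fun n => q / b n; fun n => q / c n; fun n => q / d n;
      fun n => q * a n / e n; fun n => q * a n / f n;
      fun n => q * a n ^ 2 / (b n * c n * d n); fun n => q / (e n * f n)]).
    repeat (apply Forall2_cons; [cvg|]). apply Forall2_nil. }
assert (cB : cvgC (fun n => rhs_B q (a n) (b n) (c n) (d n) (e n) (f n)) (rhs_B q A B C' D E F)).
{ unfold rhs_B. apply cvgC_div; [exact h2| |].
  - apply (PI [fun n => q * a n; fun n => b n / a n; fun n => c n / a n; fun n => d n / a n;
      fun n => q * a n / (e n * f n);
      fun n => q ^ 2 * a n / (b n * c n * d n); fun n => q ^ 2 * a n ^ 2 / (b n * c n * d n * e n);
      fun n => q ^ 2 * a n ^ 2 / (b n * c n * d n * f n)]).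
    repeat (apply Forall2_cons; [cvg|]). apply Forall2_nil.
  - apply (PI [fun n => q / b n; fun n => q / c n; fun n => q / d n;
      fun n => q * a n / e n; fun n => q * a n / f n;
      fun n => b n * c n * d n / (q * a n ^ 2); fun n => q ^ 2 * a n ^ 2 / (b n * c n * d n);
      fun n => q ^ 2 * a n ^ 2 / (b n * c n * d n * e n * f n)]).
    repeat (apply Forall2_cons; [cvg|]). apply Forall2_nil. }
assert (cC : cvgC (fun n => rhs_C q (a n) (b n) (c n) (d n) (e n) (f n)) (rhs_C q A B C' D E F)).
{ unfold rhs_C. apply cvgC_div; [exact h3| |].
  - apply (PI [fun n => a n; fun n => q * a n; fun n => q / a n; fun n => e n; fun n => f n;
      fun n => q * a n / (b n * c n); fun n => q * a n / (b n * d n);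
      fun n => q * a n / (c n * d n); fun n => q ^ 2 * a n / (b n * e n * f n);
      fun n => q ^ 2 * a n / (c n * e n * f n); fun n => q ^ 2 * a n / (d n * e n * f n)]).
    repeat (apply Forall2_cons; [cvg|]). apply Forall2_nil.
  - apply (PI [fun n => q / b n; fun n => q / c n; fun n => q / d n;
      fun n => q * a n / b n; fun n => q * a n / c n; fun n => q * a n / d n;
      fun n => q * a n / e n; fun n => q * a n / f n; fun n => e n * f n / q; fun n => q ^ 2 / (e n * f n);
      fun n => q ^ 2 * a n ^ 2 / (b n * c n * d n * e n * f n)]).
    repeat (apply Forall2_cons; [cvg|]). apply Forall2_nil. }
unfold rhs. apply cvgC_plus; [apply cvgC_plus|]; (apply cvgC_mult; [assumption|]).
- apply cvgC_plus; [|apply cvgC_minus; [|apply cvgC_const]]; (apply hser_cont; [exact hq1|..]; cvg);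
  apply R; simpl; tauto.
- apply hser_cont; [exact hq1|..]; cvg; apply R; simpl; tauto.
- apply hser_cont; [exact hq1|..]; cvg; apply R; simpl; tauto.
Qed.

(** * From the stated series to the working ones *)

(** True also for zero factors because / 0 = 0. It allows terms of negative index to be rewritten
    without any nonvanishing condition on their factorials. *)
Lemma Cinv_mult_total (x y : C) : / (x * y) = / x * / y.
Proof.
destruct (Ceq_dec x 0) as [->|hx]; [rewrite Cmult_0_l, Cinv_0; ring|].
destruct (Ceq_dec y 0) as [->|hy]; [rewrite Cmult_0_r, Cinv_0; ring|].
field. auto.
Qed.

Lemma Cpowz_of_nat (z : C) (n : nat) : Cpowz z (Z.of_nat n) = z ^ n.
Proof. unfold Cpowz. rewrite <- (Nat2Z.id n) at 2. destruct n; reflexivity. Qed.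

Lemma Cpowz_neg (z : C) (n : nat) : Cpowz z (- Z.of_nat (S n)) = / z ^ S n.
Proof. unfold Cpowz, Z.of_nat, Z.opp. now rewrite SuccNat2Pos.id_succ. Qed.

Lemma W87_term_w87 (a b c d e f q z : C) (k : nat) :
  W87_term a b c d e f q z k = w87 a b c d e f q k * z ^ k.
Proof.
unfold W87_term, w87, Cprod. cbn [map fold_right]. rewrite !qpoch_of_nat. ring.
Qed.

Lemma phi43_term_h44 (a1 a2 a3 a4 b1 b2 b3 q z : C) (k : nat) :
  phi43_term a1 a2 a3 a4 b1 b2 b3 q z k = h44 a1 a2 a3 a4 q b1 b2 b3 q k * z ^ k.
Proof.
unfold phi43_term, h44, qpochs, Cprod. cbn [map fold_right]. rewrite !qpoch_of_nat.
now rewrite !Cmult_1_r, !Cmult_assoc.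
Qed.

Lemma psi44_term_pos (a1 a2 a3 a4 b1 b2 b3 b4 q z : C) (k : nat) :
  psi44_term a1 a2 a3 a4 b1 b2 b3 b4 q z (Z.of_nat k) = h44 a1 a2 a3 a4 b1 b2 b3 b4 q k * z ^ k.
Proof.
unfold psi44_term, h44, qpochs, Cprod. cbn [map fold_right].
rewrite !qpoch_of_nat, Cpowz_of_nat. now rewrite !Cmult_1_r, !Cmult_assoc.
Qed.

Lemma qpoch_neg (x q : C) (n : nat) : x <> 0 -> q <> 0 ->
  / qpoch x q (- Z.of_nat n) = (x / q ^ n) ^ n * qsign q n * qprod (q / x) q n.
Proof.
intros hx hq. rewrite Cinv_qpoch_neg.
assert (h := qprod_div_pow x q n n hx hq (le_n n)).
rewrite Nat.sub_diag in h. rewrite <- h. simpl. ring.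
Qed.

(** Reflection of the index. The condition on the parameters reduces the powers from the eight
    reversals to q^(2m) with m = n + 1, and division by q^m leaves q^m, so the reflected series has
    argument q again. *)
Lemma psi44_term_neg (a1 a2 a3 a4 b1 b2 b3 b4 q : C) (n : nat) :
  q <> 0 -> a1 <> 0 -> a2 <> 0 -> a3 <> 0 -> a4 <> 0 ->
  b1 <> 0 -> b2 <> 0 -> b3 <> 0 -> b4 <> 0 ->
  b1 * b2 * b3 * b4 = q * q * (a1 * a2 * a3 * a4) ->
  psi44_term a1 a2 a3 a4 b1 b2 b3 b4 q q (- Z.of_nat (S n)) =
  h44 (q / b1) (q / b2) (q / b3) (q / b4) (q / a1) (q / a2) (q / a3) (q / a4) q (S n) * q ^ S n.
Proof.
intros hq h1 h2 h3 h4 k1 k2 k3 k4 hb.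
unfold psi44_term, h44, qpochs, Cprod. cbn [map fold_right].
rewrite Cpowz_neg. set (m := S n).
assert (hqm := Cpow_nz q m hq).
unfold Cdiv at 1 2. rewrite !Cinv_mult_total.
rewrite (qpoch_neg b1), (qpoch_neg b2), (qpoch_neg b3), (qpoch_neg b4) by assumption.
(* [qpoch_neg] concerns inverses, so the upper factorials are first written as double inverses. *)
rewrite <- (Cinv_invol (qpoch a1 q _)), <- (Cinv_invol (qpoch a2 q _)),
  <- (Cinv_invol (qpoch a3 q _)), <- (Cinv_invol (qpoch a4 q _)).
rewrite (qpoch_neg a1), (qpoch_neg a2), (qpoch_neg a3), (qpoch_neg a4) by assumption.
rewrite !Cinv_mult_total.
replace (/ 1) with (RtoC 1) by (field; exact C1_nz).
assert (hp : (b1 / q ^ m) ^ m * (b2 / q ^ m) ^ m * (b3 / q ^ m) ^ m * (b4 / q ^ m) ^ m =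
  (a1 / q ^ m) ^ m * (a2 / q ^ m) ^ m * (a3 / q ^ m) ^ m * (a4 / q ^ m) ^ m * (q ^ m * q ^ m)).
{ rewrite <- !Cpow_mult_l. f_equal.
  replace (b1 / q ^ m * (b2 / q ^ m) * (b3 / q ^ m) * (b4 / q ^ m)) with
    (b1 * b2 * b3 * b4 / (q ^ m * q ^ m * q ^ m * q ^ m)) by (field; auto).
  rewrite hb. field. auto. }
assert (n1 : (a1 / q ^ m) ^ m <> 0) by auto using Cpow_nz, neq0_div.
assert (n2 : (a2 / q ^ m) ^ m <> 0) by auto using Cpow_nz, neq0_div.
assert (n3 : (a3 / q ^ m) ^ m <> 0) by auto using Cpow_nz, neq0_div.
assert (n4 : (a4 / q ^ m) ^ m <> 0) by auto using Cpow_nz, neq0_div.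
assert (n5 := qsign_neq0 q m hq).
unfold Cdiv in *.
set (A1 := (a1 * / q ^ m) ^ m) in *. set (A2 := (a2 * / q ^ m) ^ m) in *.
set (A3 := (a3 * / q ^ m) ^ m) in *. set (A4 := (a4 * / q ^ m) ^ m) in *.
set (B1 := (b1 * / q ^ m) ^ m) in *. set (B2 := (b2 * / q ^ m) ^ m) in *.
set (B3 := (b3 * / q ^ m) ^ m) in *. set (B4 := (b4 * / q ^ m) ^ m) in *.
set (s := qsign q m) in *.
set (P1 := / qprod (q * / a1) q m). set (P2 := / qprod (q * / a2) q m).
set (P3 := / qprod (q * / a3) q m). set (P4 := / qprod (q * / a4) q m).
set (Q1 := qprod (q * / b1) q m). set (Q2 := qprod (q * / b2) q m).
set (Q3 := qprod (q * / b3) q m). set (Q4 := qprod (q * / b4) q m).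
set (K := q ^ m) in *.
clearbody A1 A2 A3 A4 B1 B2 B3 B4 s P1 P2 P3 P4 Q1 Q2 Q3 Q4 K.
transitivity (B1 * B2 * B3 * B4 * (Q1 * Q2 * Q3 * Q4 * (P1 * P2 * P3 * P4)) * / (A1 * A2 * A3 * A4) * / K).
- field. repeat split; auto.
- rewrite hp. field. repeat split; auto.
Qed.

Lemma ex_Cseries_ext (t t' : nat -> C) : (forall k, t k = t' k) -> ex_Cseries t -> ex_Cseries t'.
Proof.
intros e h. apply ex_Cseries_eq in h. apply (ex_Cseries_cvgC _ (Cseries t)).
revert h. apply cvgC_ext. intros n. apply sumC_ext. auto.
Qed.

Lemma ex_Cseries_tail (t : nat -> C) : ex_Cseries t -> ex_Cseries (fun k => t (S k)).
Proof.
intros h. apply ex_Cseries_eq in h. apply (ex_Cseries_cvgC _ (Cseries t - t 0%nat)).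
apply (cvgC_ext (fun n => sumC t (S n) - t 0%nat)).
- intros n. rewrite sumC_head. ring.
- apply cvgC_minus; [|apply cvgC_const]. apply (cvgC_sub _ _ S); [lia|exact h].
Qed.

Theorem corollary3p12 (q a b c d e f : C)
  (hq : (0 < Cmod q < 1)%R)
  (ha : a <> 0) (hb : b <> 0) (hc : c <> 0) (hd : d <> 0) (he : e <> 0)
  (hf : f <> 0)
  (hconv : (Cmod (q ^ 2 * a ^ 2) < Cmod (b * c * d * e * f))%R)
  (hW : W87_wd a b c d e f q)
  (hpsi : psi44_wd a e f (q * a ^ 2 / (b * c * d))
                   (q * a / b) (q * a / c) (q * a / d) (e * f) q)
  (hphi1 : phi43_wd (q ^ 2 * a / (b * c * d)) (q ^ 2 * a ^ 2 / (b * c * d * e))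
                    (q ^ 2 * a ^ 2 / (b * c * d * f)) q)
  (hphi2 : phi43_wd (q ^ 2 * a / (b * e * f)) (q ^ 2 * a / (c * e * f))
                    (q ^ 2 * a / (d * e * f)) q)
  (hden1 : qpochs_inf [q; q / b; q / c; q / d; q * a / e; q * a / f;
                       q * a ^ 2 / (b * c * d); q / (e * f)] q <> 0)
  (hden2 : qpochs_inf [q / b; q / c; q / d; q * a / e; q * a / f;
                       b * c * d / (q * a ^ 2); q ^ 2 * a ^ 2 / (b * c * d);
                       q ^ 2 * a ^ 2 / (b * c * d * e * f)] q <> 0)
  (hden3 : qpochs_inf [q / b; q / c; q / d; q * a / b; q * a / c; q * a / d;
                       q * a / e; q * a / f; e * f / q; q ^ 2 / (e * f);
                       q ^ 2 * a ^ 2 / (b * c * d * e * f)] q <> 0) :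
  ex_Cseries (W87_term a b c d e f q (q ^ 2 * a ^ 2 / (b * c * d * e * f))) /\
  ex_Cbiseries (psi44_term a e f (q * a ^ 2 / (b * c * d))
                  (q * a / b) (q * a / c) (q * a / d) (e * f) q q) /\
  ex_Cseries (phi43_term (q * a / (b * c)) (q * a / (b * d)) (q * a / (c * d))
                (q ^ 2 * a ^ 2 / (b * c * d * e * f))
                (q ^ 2 * a / (b * c * d)) (q ^ 2 * a ^ 2 / (b * c * d * e))
                (q ^ 2 * a ^ 2 / (b * c * d * f)) q q) /\
  ex_Cseries (phi43_term (q / e) (q / f) (q * a / (e * f))
                (q ^ 2 * a ^ 2 / (b * c * d * e * f))
                (q ^ 2 * a / (b * e * f)) (q ^ 2 * a / (c * e * f))
                (q ^ 2 * a / (d * e * f)) q q) /\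
  W87 a b c d e f q (q ^ 2 * a ^ 2 / (b * c * d * e * f)) =
    qpochs_inf [q * a; q / a; q / e; q / f; q * a / (b * c); q * a / (b * d);
                q * a / (c * d); q * a / (e * f)] q /
    qpochs_inf [q; q / b; q / c; q / d; q * a / e; q * a / f;
                q * a ^ 2 / (b * c * d); q / (e * f)] q *
    psi44 a e f (q * a ^ 2 / (b * c * d))
          (q * a / b) (q * a / c) (q * a / d) (e * f) q q
  + qpochs_inf [q * a; b / a; c / a; d / a; q * a / (e * f);
                q ^ 2 * a / (b * c * d); q ^ 2 * a ^ 2 / (b * c * d * e);
                q ^ 2 * a ^ 2 / (b * c * d * f)] q /
    qpochs_inf [q / b; q / c; q / d; q * a / e; q * a / f;
                b * c * d / (q * a ^ 2); q ^ 2 * a ^ 2 / (b * c * d);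
                q ^ 2 * a ^ 2 / (b * c * d * e * f)] q *
    phi43 (q * a / (b * c)) (q * a / (b * d)) (q * a / (c * d))
          (q ^ 2 * a ^ 2 / (b * c * d * e * f))
          (q ^ 2 * a / (b * c * d)) (q ^ 2 * a ^ 2 / (b * c * d * e))
          (q ^ 2 * a ^ 2 / (b * c * d * f)) q q
  + qpochs_inf [a; q * a; q / a; e; f; q * a / (b * c); q * a / (b * d);
                q * a / (c * d); q ^ 2 * a / (b * e * f);
                q ^ 2 * a / (c * e * f); q ^ 2 * a / (d * e * f)] q /
    qpochs_inf [q / b; q / c; q / d; q * a / b; q * a / c; q * a / d;
                q * a / e; q * a / f; e * f / q; q ^ 2 / (e * f);
                q ^ 2 * a ^ 2 / (b * c * d * e * f)] q *
    phi43 (q / e) (q / f) (q * a / (e * f))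
          (q ^ 2 * a ^ 2 / (b * c * d * e * f))
          (q ^ 2 * a / (b * e * f)) (q ^ 2 * a / (c * e * f))
          (q ^ 2 * a / (d * e * f)) q q.
Proof.
destruct hq as [hq0 hq1].
assert (q0 : q <> 0) by (intros e0; rewrite e0, Cmod_0 in hq0; lra).
assert (rq : qreg q q) by (intros k; now apply qprod_q_neq0).
set (l := q * a ^ 2 / (b * c * d)). set (z := q ^ 2 * a ^ 2 / (b * c * d * e * f)).
assert (hl : l <> 0) by (apply neq0_div; repeat first [assumption | apply Cpow_nz | apply Cmult_neq_0]).
assert (hz : (Cmod z < 1)%R).
{ unfold z. assert (hne : b * c * d * e * f <> 0) by (repeat apply Cmult_neq_0; assumption).
  assert (hp := proj1 (Cmod_gt_0 _) hne).
  rewrite Cmod_div by exact hne. apply (Rmult_lt_reg_r (Cmod (b * c * d * e * f))); [exact hp|].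
  unfold Rdiv. rewrite Rmult_assoc, Rinv_l, Rmult_1_r, Rmult_1_l by lra. exact hconv. }
destruct hW as (ha1 & _ & hW).
assert (rW : forall x, In x [b; c; d; e; f] -> qreg (q * a / x) q).
{ intros x hx k. rewrite <- qpoch_of_nat. now apply hW. }
destruct hpsi as [hpsi1 hpsi2].
assert (rP : forall x, In x [q * a / b; q * a / c; q * a / d; e * f] -> qreg x q).
{ intros x hx k. rewrite <- qpoch_of_nat. now apply hpsi1. }
(* The upper parameters of the 4psi4 become lower parameters q/x after reflection; reversal carries
   the hypothesis over. *)
assert (rN : forall x : C, x <> 0 -> In x [a; e; f; l] -> qreg (q / x) q).
{ intros x hx0 hx n e0. apply (hpsi2 x hx n).
  assert (h := qprod_div_pow x q n n hx0 q0 (le_n n)).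
  rewrite Nat.sub_diag, e0 in h. simpl in h. rewrite Cmult_1_r in h. rewrite h. ring. }
assert (r1 : forall x, In x [q; q ^ 2 * a / (b * c * d); q ^ 2 * a ^ 2 / (b * c * d * e);
   q ^ 2 * a ^ 2 / (b * c * d * f)] -> qreg x q).
{ intros x hx k. rewrite <- qpoch_of_nat. now apply hphi1. }
assert (r2 : forall x, In x [q; q ^ 2 * a / (b * e * f); q ^ 2 * a / (c * e * f);
   q ^ 2 * a / (d * e * f)] -> qreg x q).
{ intros x hx k. rewrite <- qpoch_of_nat. now apply hphi2. }
assert (hWt : forall k, w87 a b c d e f q k * z ^ k = W87_term a b c d e f q z k)
  by (intros k; symmetry; apply W87_term_w87).
assert (hneg : forall k, h44 (b / a) (c / a) (d / a) (q / (e * f)) (q / a) (q / e) (q / f) (q / l) q (S k) * q ^ S k =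
  psi44_term a e f l (q * a / b) (q * a / c) (q * a / d) (e * f) q q (- Z.of_nat (S k))).
{ intros k. rewrite psi44_term_neg; try assumption.
  - replace (q / (q * a / b)) with (b / a) by (field; auto).
    replace (q / (q * a / c)) with (c / a) by (field; auto).
    replace (q / (q * a / d)) with (d / a) by (field; auto). reflexivity.
  - apply neq0_div; [apply Cmult_neq_0|]; assumption.
  - apply neq0_div; [apply Cmult_neq_0|]; assumption.
  - apply neq0_div; [apply Cmult_neq_0|]; assumption.
  - now apply Cmult_neq_0.
  - unfold l. field. auto. }
assert (exW := w87_series_ex a b c d e f q z hq1 hz rq (rW b ltac:(simpl; tauto)) (rW c ltac:(simpl; tauto))
  (rW d ltac:(simpl; tauto)) (rW e ltac:(simpl; tauto)) (rW f ltac:(simpl; tauto))).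
assert (exP := hser_ex q a e f l (q * a / b) (q * a / c) (q * a / d) (e * f) hq1
  (rP (q * a / b) ltac:(simpl; tauto)) (rP (q * a / c) ltac:(simpl; tauto)) (rP (q * a / d) ltac:(simpl; tauto))
  (rP (e * f) ltac:(simpl; tauto))).
assert (exN := hser_ex q (b / a) (c / a) (d / a) (q / (e * f)) (q / a) (q / e) (q / f) (q / l) hq1
  (rN _ ha ltac:(simpl; tauto)) (rN _ he ltac:(simpl; tauto)) (rN _ hf ltac:(simpl; tauto)) (rN _ hl ltac:(simpl; tauto))).
assert (ex1 := hser_ex q (q * a / (b * c)) (q * a / (b * d)) (q * a / (c * d)) z q _ _ _ hq1 rq
  (r1 (q ^ 2 * a / (b * c * d)) ltac:(simpl; tauto)) (r1 (q ^ 2 * a ^ 2 / (b * c * d * e)) ltac:(simpl; tauto))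
  (r1 (q ^ 2 * a ^ 2 / (b * c * d * f)) ltac:(simpl; tauto))).
assert (ex2 := hser_ex q (q / e) (q / f) (q * a / (e * f)) z q _ _ _ hq1 rq
  (r2 (q ^ 2 * a / (b * e * f)) ltac:(simpl; tauto)) (r2 (q ^ 2 * a / (c * e * f)) ltac:(simpl; tauto))
  (r2 (q ^ 2 * a / (d * e * f)) ltac:(simpl; tauto))).
split; [exact (ex_Cseries_ext _ _ hWt exW)|].
split.
{ split.
  - revert exP. apply ex_Cseries_ext. intros k. symmetry. apply psi44_term_pos.
  - apply ex_Cseries_tail in exN. revert exN. apply ex_Cseries_ext. exact hneg. }
split; [revert ex1; apply ex_Cseries_ext; intros k; symmetry; apply phi43_term_h44|].
split; [revert ex2; apply ex_Cseries_ext; intros k; symmetry; apply phi43_term_h44|].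
assert (eW : W87 a b c d e f q z = Cseries (fun k => w87 a b c d e f q k * z ^ k))
  by (symmetry; apply Cseries_ext, hWt).
(* The reflected series starts at index 0 with the term 1, while the negative half of the 4psi4
   starts at -1. *)
assert (ePsi : psi44 a e f l (q * a / b) (q * a / c) (q * a / d) (e * f) q q =
  hser a e f l (q * a / b) (q * a / c) (q * a / d) (e * f) q +
  (hser (b / a) (c / a) (d / a) (q / (e * f)) (q / a) (q / e) (q / f) (q / l) q - 1)).
{ unfold psi44, Cbiseries. f_equal.
  - apply Cseries_ext. intros k. apply psi44_term_pos.
  - unfold hser. rewrite (Cseries_head _ exN). rewrite <- (Cseries_ext _ _ hneg).
    unfold h44 at 2. simpl. field. }
rewrite eW, ePsi.
replace (phi43 (q * a / (b * c)) _ _ _ _ _ _ _ _) with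
  (hser (q * a / (b * c)) (q * a / (b * d)) (q * a / (c * d)) z q (q ^ 2 * a / (b * c * d))
     (q ^ 2 * a ^ 2 / (b * c * d * e)) (q ^ 2 * a ^ 2 / (b * c * d * f)) q)
  by (apply Cseries_ext; intros k; symmetry; apply phi43_term_h44).
replace (phi43 (q / e) _ _ _ _ _ _ _ _) with
  (hser (q / e) (q / f) (q * a / (e * f)) z q (q ^ 2 * a / (b * e * f))
     (q ^ 2 * a / (c * e * f)) (q ^ 2 * a / (d * e * f)) q)
  by (apply Cseries_ext; intros k; symmetry; apply phi43_term_h44).
change (Cseries (fun k => w87 a b c d e f q k * z ^ k) = rhs q a b c d e f).
pose (s n := RtoC (sper n)).
assert (cs : forall x w, cvgC (fun n => x * s n ^ w) x).
{ intros x w. replace x with (x * 1 ^ w) at 1 by (rewrite Cpow_1_l; ring).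
  apply cvgC_mult; [apply cvgC_const|]. apply cvgC_pow, cvgC_sper. }
assert (ca : cvgC (fun n => a * s n) a).
{ apply (cvgC_ext (fun n => a * s n ^ 1)); [intros n; simpl; ring|apply cs]. }
assert (hs : forall n, s n <> 0).
{ intros n e0. apply RtoC_inj in e0. assert (h := sper_gt1 n). lra. }
assert (hne : b * c * d * e * f <> 0) by (repeat apply Cmult_neq_0; assumption).
assert (cz : cvgC (fun n => q ^ 2 * (a * s n) ^ 2 / (b * s n ^ 2 * (c * s n ^ 2) * (d * s n ^ 2) * (e * s n ^ 3) * (f * s n ^ 3))) z).
{ apply cvgC_div; [exact hne| |].
  - apply cvgC_mult; [apply cvgC_const|]. now apply cvgC_pow.
  - repeat (apply cvgC_mult; [|apply cs]). apply cs. }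
(* Along the perturbed parameters the right-hand sides tend to both members of the goal: to the 8W7
   through the generic identity, and to [rhs] by its continuity. *)
apply (cvgC_unique (fun n => rhs q (a * s n) (b * s n ^ 2) (c * s n ^ 2) (d * s n ^ 2) (e * s n ^ 3) (f * s n ^ 3))).
- destruct (generic_perturb q a b c d e f (conj hq0 hq1) ha hb hc hd he hf) as [N1 H1].
  (* The condition |z| < 1 is open, so it also holds for the perturbed parameters from some index
     on. *)
  destruct (cz (1 - Cmod z)%R ltac:(lra)) as [N2 H2].
  refine (cvgC_ext_ev _ _ _ (N1 + N2) _ (w87_series_cont q (fun n => a * s n) (fun n => b * s n ^ 2)
    (fun n => c * s n ^ 2) (fun n => d * s n ^ 2) (fun n => e * s n ^ 3) (fun n => f * s n ^ 3) _
    a b c d e f z hq1 hz ca (cs _ _) (cs _ _) (cs _ _) (cs _ _) (cs _ _) cz ha1 hb hc hd he hf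
    (rW b ltac:(simpl; tauto)) (rW c ltac:(simpl; tauto))
    (rW d ltac:(simpl; tauto)) (rW e ltac:(simpl; tauto)) (rW f ltac:(simpl; tauto)))).
  intros n hn. cbv beta. specialize (H1 n ltac:(lia)). specialize (H2 n ltac:(lia)). cbv beta in H2.
  assert (hs2 := Cpow_nz _ 2 (hs n)). assert (hs3 := Cpow_nz _ 3 (hs n)).
  apply corollary_generic; auto using Cmult_neq_0.
  match goal with |- (Cmod ?x < 1)%R => replace x with (z + (x - z)) by ring end.
  eapply Rle_lt_trans; [apply Cmod_triangle|]. lra.
- apply rhs_cont; auto.
  intros y hy. simpl in hy.
  repeat match type of hy with _ \/ _ => destruct hy as [hy|hy] end; try contradiction; subst y;
  first [apply rP; simpl; tauto | apply rN; [assumption|simpl; tauto] | apply r1; simpl; tauto | apply r2; simpl; tauto].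
Qed.
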